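(* Let $k>0$, $R>0$, and assume that $k^2$ is not a Dirichlet eigenvalue of $-\Delta$ on $O_R$. Let $f\in H^{1/2}(\partial O_R)$ and let $u$ satisfy $$\Delta u+k^2u=0\ \text{ in }O_R,\qquad u=f\ \text{ on }\partial O_R .$$ Then there exists $\{c_n\}_{n\in\mathbb{Z}}$ such that $$u(x)=\sum_{n=-\infty}^{\infty}c_nJ_n(kr)e^{\mathrm{i}n\theta},\qquad x\in O_R .$$ Moreover, with a constant $C>0$ independent of $u$ and $\varepsilon$, for every $\varepsilon\in(0,1)$: (i) For $\rho>R$ there exists $\tilde u$ satisfying $\Delta\tilde u+k^2\tilde u=0$ in $O_\rho$ such that $$\|(u-\tilde u)|_{\partial O_R}\|_{L^2(\partial O_R)}\le\varepsilon\|u\|_{H^{1/2}(\partial O_R)},\qquad \|\tilde u\|_{H^{1/2}(\partial O_\rho)}\le Ce^{\left(\log\frac{\rho}{R}\right)\varepsilon^{-2}}\|u\|_{L^2(\partial O_R)} .$$ (ii) If $u$ can be extended (as a solution of the Helmholtz equation) to $O_\sigma$, where $R<\sigma<\rho$, then there exists $\tilde u$ satisfying $\Delta\tilde u+k^2\tilde u=0$ in $O_\rho$ such that $$\|(u-\tilde u)|_{\partial O_R}\|_{L^2(\partial O_R)}\le\varepsilon\|u\|_{H^{1/2}(\partial O_\sigma)},\qquad \|\tilde u\|_{H^{1/2}(\partial O_\rho)}\le C\varepsilon^{-\frac{\log\frac{\rho}{R}}{\log\frac{\sigma}{R}}}\|u\|_{L^2(\partial O_R)} .$$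
   Context: $O_r$ is the open disk of radius $r$ in $\mathbb{R}^2$ centered at the origin; $(r,\theta)$ are polar coordinates. $J_n$ is the Bessel function of the first kind of order $n$. Values and norms on circles are those of traces. $H^{1/2}(\partial O_r)$ is the usual Sobolev space on the circle; for $f(\theta)=\sum_m\hat f_me^{\mathrm{i}m\theta}$ its norm may be taken as $\|f\|_{H^{1/2}(\partial O_r)}^2=2\pi r\sum_{m\in\mathbb{Z}}\sqrt{1+m^2}\,|\hat f_m|^2$, with $\|f\|_{L^2(\partial O_r)}^2=2\pi r\sum_m|\hat f_m|^2$. In (ii) the trace of $u$ on $\partial O_\sigma$ is understood to lie in $H^{1/2}(\partial O_\sigma)$. *)

(* Defs.v *)
From HB Require Import structures.
From mathcomp Require Import all_boot all_order all_algebra.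
From mathcomp Require Import all_classical all_reals all_analysis.
From mathcomp.real_closed Require Import complex.

Set Implicit Arguments.
Unset Strict Implicit.
Unset Printing Implicit Defensive.

Import Order.TTheory GRing.Theory Num.Theory.
Import numFieldNormedType.Exports.

Local Open Scope classical_set_scope.
Local Open Scope ring_scope.
Local Open Scope complex_scope.

Section Plane.
Variable R : realType.

Definition disk (r : R) : set (R * R) := [set x | x.1 ^+ 2 + x.2 ^+ 2 < r ^+ 2].

Definition closed_disk (r : R) : set (R * R) :=
  [set x | x.1 ^+ 2 + x.2 ^+ 2 <= r ^+ 2].

Definition circle (r : R) : set (R * R) :=
  [set x | x.1 ^+ 2 + x.2 ^+ 2 = r ^+ 2].

Definition polar (r t : R) : R * R := (r * cos t, r * sin t).

Definition expi (t : R) : R[i] := cos t +i* sin t.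

Definition e1 : R * R := (1, 0).
Definition e2 : R * R := (0, 1).

Definition C1_on (A : set (R * R)) (w : R * R -> R) : Prop :=
  forall x, A x ->
    [/\ derivable w x e1, derivable w x e2,
        {for x, continuous ('D_e1 w)} & {for x, continuous ('D_e2 w)}].

Definition C2_on (A : set (R * R)) (w : R * R -> R) : Prop :=
  [/\ C1_on A w, C1_on A ('D_e1 w) & C1_on A ('D_e2 w)].

Definition laplacian (w : R * R -> R) (x : R * R) : R :=
  'D_e1 ('D_e1 w) x + 'D_e2 ('D_e2 w) x.

(* R[i] carries no normed R-module structure in the library, so calculus on
   complex-valued functions is done on real and imaginary parts. *)
Definition C2C_on (A : set (R * R)) (w : R * R -> R[i]) : Prop :=
  C2_on A (fun x => complex.Re (w x)) /\ C2_on A (fun x => complex.Im (w x)).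

Definition laplacianC (w : R * R -> R[i]) (x : R * R) : R[i] :=
  laplacian (fun y => complex.Re (w y)) x
    +i* laplacian (fun y => complex.Im (w y)) x.

(* By interior elliptic regularity every weak (even distributional) solution
   has a C^2 representative, so solutions are taken to be classical ones. *)
Definition helmholtz (k r : R) (u : R * R -> R[i]) : Prop :=
  C2C_on (disk r) u /\
  forall x, disk r x -> laplacianC u x + (k ^+ 2)%:C * u x = 0.

(* Dirichlet eigenfunctions of a disk are smooth up to the boundary, hence
   the classical formulation. *)
Definition dirichlet_eigenvalue (r lambda : R) : Prop :=
  exists w : R * R -> R[i],
    [/\ C2C_on (disk r) w,
        {within closed_disk r, continuous (fun x => complex.Re (w x))} /\
        {within closed_disk r, continuous (fun x => complex.Im (w x))},
        forall x, circle r x -> w x = 0,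
        forall x, disk r x -> - laplacianC w x = lambda%:C * w x
      & exists2 x, disk r x & w x <> 0].

(* Functions on the circle of radius r are represented by functions of the
   angle t in [0, 2 pi]; their values elsewhere are irrelevant. *)
Definition angles : set R := `[0, 2 * pi]%classic.

Definition fourier_coef (f : R -> R[i]) (m : int) : R[i] :=
  let g t := f t * expi (- (m%:~R * t)) in
  ((2 * pi)^-1)%:C *
    ((\int[lebesgue_measure]_(t in angles) complex.Re (g t))
       +i* (\int[lebesgue_measure]_(t in angles) complex.Im (g t))).

Definition L2norm (r : R) (f : R -> R[i]) : \bar R :=
  sqrte (\int[lebesgue_measure]_(t in angles)
           (r * ComplexField.Normc.normc (f t) ^+ 2)%:E)%E.

(* Meaningful for square-integrable f only: the Fourier coefficients are junk
   otherwise. *)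
Definition H12norm (r : R) (f : R -> R[i]) : \bar R :=
  sqrte ((2 * pi * r)%:E *
    \esum_(m in [set: int])
      (Num.sqrt (1 + m%:~R ^+ 2) *
         ComplexField.Normc.normc (fourier_coef f m) ^+ 2)%:E)%E.

Definition inL2 (r : R) (f : R -> R[i]) : Prop :=
  [/\ measurable_fun angles (fun t => complex.Re (f t)),
      measurable_fun angles (fun t => complex.Im (f t))
    & (L2norm r f < +oo)%E].

Definition inH12 (r : R) (f : R -> R[i]) : Prop :=
  inL2 r f /\ (H12norm r f < +oo)%E.

(* f is the trace on the circle of radius r of a function u continuous in the
   open disk: the restrictions of u to the circles of radius s < r converge
   to f in L^2 of the angle.  For u in H^1 this is the usual trace. *)
Definition is_trace (r : R) (u : R * R -> R[i]) (f : R -> R[i]) : Prop :=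
  L2norm r (fun t => u (polar s t) - f t) @[s --> r^'-] --> 0%E.

Definition besselJ_nat (n : nat) (x : R) : R :=
  limn (series (fun m : nat =>
    (-1) ^+ m / (m`! * (m + n)`!)%:R * (x / 2) ^+ (2 * m + n))).

(* Negz n is the integer - n.+1, and J_(-p) = (-1)^p J_p. *)
Definition besselJ (n : int) (x : R) : R :=
  match n with
  | Posz p => besselJ_nat p x
  | Negz p => (-1) ^+ p.+1 * besselJ_nat p.+1 x
  end.

Definition sum_to (a : nat -> R[i]) (s : R[i]) : Prop :=
  series (fun n => complex.Re (a n)) @ \oo --> complex.Re s /\
  series (fun n => complex.Im (a n)) @ \oo --> complex.Im s.

Definition bilateral_sum_to (a : int -> R[i]) (s : R[i]) : Prop :=
  exists sp sn : R[i],
    [/\ sum_to (fun n => a (Posz n)) sp, sum_to (fun n => a (Negz n)) sn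
      & s = sp + sn].

Definition dirichlet_solution (k r : R) (f : R -> R[i]) (u : R * R -> R[i]) :
    Prop :=
  [/\ inH12 r f, helmholtz k r u & is_trace r u f].

End Plane.

(* Main.v *)
Require Import Defs.
From HB Require Import structures.
From mathcomp Require Import all_boot all_order all_algebra.
From mathcomp Require Import all_classical all_reals all_analysis.
From mathcomp Require Import measurable_realfun.
From mathcomp.real_closed Require Import complex.
From mathcomp Require Import ring lra.
Import Order.TTheory GRing.Theory Num.Theory.
Import numFieldNormedType.Exports.
Local Open Scope classical_set_scope.
Local Open Scope ring_scope.
Local Open Scope complex_scope.

Set Implicit Arguments.
Unset Strict Implicit.
Unset Printing Implicit Defensive.

(* Green's identity on circles, in the form of differentiation under the integral sign, shows that
   the m-th Fourier coefficient of t |-> u(r e^(it)) solves the Bessel equation in r and is regular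
   at 0; hence it equals c_m J_m(kr), and Fourier inversion on each circle gives the expansion of u.
   As k^2 is not a Dirichlet eigenvalue, J_m(ka) <> 0 for all m, so that J_m(k rho) / J_m(ka) is
   O((rho/a)^|m|).  The approximation v is obtained by multiplying c_m by a cut-off l_m.  With
   s_m = (1 + m^2)^(1/4), the choice l_m = max(0, 1 - eps s_m) gives (i), since 1 - l_m <= eps s_m
   and l_m vanishes unless |m| <= eps^-2.  For (ii), l_m = 1 when (sigma/a)^|m| s_m is at most of
   order 1/eps and l_m = 0 otherwise, because the Fourier coefficients of u at radius sigma exceed
   those at radius a by a factor of order (sigma/a)^|m|. *)

(** The trace f is given only as an L^2 limit of u on smaller circles, so facts about f are proved
    for u on a circle of radius s < a and passed to the limit. This concerns the formula for its
    Fourier coefficients and the mean-square convergence of its Fourier series: Chernoff's argument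
    yields the latter for Lipschitz functions, and it survives L^2 limits. The cut-offs vanish
    outside a finite range, so v is a finite sum of waves; it solves the equation in the whole plane
    and its trace is its restriction. The H^{1/2} norm of v carries an extra factor s_m in each
    mode. In (i) a sharp cut-off at s_m <= 1/eps would therefore cost a factor 1/eps beside the
    exponential; the tapered one trades this factor against the slack in the exponent. In (ii) the
    factor s_m is put into the threshold and absorbed on raising to the power log(rho/a) /
    log(sigma/a) >= 1. The leading term (x/2)^m / m! of J_m controls all large orders, and the
    nonvanishing of J_m(ka) takes care of the finitely many others. *)

(** * Bessel functions, their recurrences and asymptotics, and the cylindrical waves J_n(kr)
    e^(int) *)

Section BesselSeries.
Variable R : realType.
Implicit Types (n m : nat) (s x y : R).

Definition besselE_coef n m : R := (-1) ^+ m / (m`! * (m + n)`!)%:R.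

(** Stripping J_n of its factor (x/2)^n leaves a power series in s = (x/2)^2, which is 0F1(; n + 1;
    -s) / n!. As a function of s it keeps the radial factor of a wave smooth at the origin. *)
Definition besselE n s : R := limn (pseries (besselE_coef n) s).

Lemma fact_neq0R n : (n`!)%:R != 0 :> R.
Proof.
by rewrite pnatr_eq0 -lt0n fact_gt0.
Qed.

Lemma factSR n : (n.+1`!)%:R = n.+1%:R * (n`!)%:R :> R.
Proof.
by rewrite factS natrM.
Qed.

Lemma besselE_coefE n m : besselE_coef n m = (-1) ^+ m / ((m`!)%:R * ((m + n)`!)%:R).
Proof.
by rewrite /besselE_coef natrM.
Qed.

Lemma besselE_coef_norm n m : `|besselE_coef n m| <= (m`!)%:R^-1.
Proof.
rewrite /besselE_coef normrM normrX normrN1 expr1n mul1r ger0_norm ?invr_ge0//.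
rewrite lef_pV2 ?posrE ?ltr0n ?muln_gt0 ?fact_gt0// ler_nat.
by rewrite leq_pmulr// fact_gt0.
Qed.

Lemma is_cvg_besselE n s : cvgn (pseries (besselE_coef n) s).
Proof.
apply: normed_cvg; apply: (@series_le_cvg _ _ (exp_coeff `|s|)).
- by move=> m; exact: normr_ge0.
- by move=> m; exact: exp_coeff_ge0.
- move=> m; rewrite /= normrM normrX /exp_coeff mulrC /=.
  by rewrite ler_wpM2l// ?exprn_ge0// besselE_coef_norm.
- exact: is_cvg_series_exp_coeff.
Qed.

Lemma pseriesS (f : nat -> R) s m :
  pseries f s m.+1 = pseries f s m + f m * s ^+ m.
Proof.
by rewrite /pseries seriesSr.
Qed.

Lemma pseries_diffs_besselE_coef n : pseries_diffs (besselE_coef n) = - besselE_coef n.+1.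
Proof.
apply/funext => m; rewrite /pseries_diffs /besselE_coef opprfctE addnS addSn.
rewrite (natrM _ m.+1`!) (natrM _ m`!) factS natrM exprS.
have := fact_neq0R m; have := fact_neq0R (m + n).+1.
move: (m`!%:R) ((m + n).+1`!%:R) => u v h1 h2.
have h3 : m.+1%:R != 0 :> R by rewrite pnatr_eq0.
by field; rewrite h1 h2 nat1r h3.
Qed.

Lemma pseries_oppr (f : nat -> R) s : pseries (- f) s = - pseries f s.
Proof.
rewrite /pseries -seriesN; congr series; apply/funext => i.
by rewrite /= !opprfctE mulNr.
Qed.

(** Termwise differentiation only raises the order and changes the sign, so the derived series that
    [pseries_snd_diffs] requires to converge are of the same kind. *)
Global Instance is_derive_bE n s : is_derive s 1 (besselE n) (- besselE n.+1 s).
Proof.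
have -> : - besselE n.+1 s = limn (pseries (pseries_diffs (besselE_coef n)) s).
  by rewrite pseries_diffs_besselE_coef pseries_oppr limN//; exact: is_cvg_besselE.
apply: (@pseries_snd_diffs _ _ (`|s| + 1)).
- exact: is_cvg_besselE.
- rewrite pseries_diffs_besselE_coef pseries_oppr; apply: is_cvgN; exact: is_cvg_besselE.
- rewrite pseries_diffs_besselE_coef pseries_diffsN pseries_diffs_besselE_coef opprK.
  exact: is_cvg_besselE.
- by rewrite [ltRHS]ger0_norm ?addr_ge0// ltrDl.
Qed.

Lemma besselE_coef_rec n m :
  besselE_coef n m.+1 = n.+1%:R * besselE_coef n.+1 m.+1 - besselE_coef n.+2 m.
Proof.
rewrite !besselE_coefE !addnS !addSn (factSR m) (factSR (m + n).+1) exprS.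
have := fact_neq0R m; have := fact_neq0R (m + n).+1.
move: (m`!%:R) ((m + n).+1`!%:R) => u v h1 h2.
have h3 : m.+1%:R != 0 :> R by rewrite pnatr_eq0.
have h4 : (m + n).+2%:R != 0 :> R by rewrite pnatr_eq0.
rewrite -!natr1 natrD.
by field; rewrite h1 h2 /= -?natrD ?nat1r ?natr1 ?pnatr_eq0.
Qed.

(** This is J_n + J_(n+2) = (2 (n + 1) / x) J_(n+1) after removal of the powers of x/2. *)
Lemma besselE_rec n s : besselE n s = n.+1%:R * besselE n.+1 s - s * besselE n.+2 s.
Proof.
(* The last partial sum is one term shorter because the factor s raises its degree by one. *)
have key N : pseries (besselE_coef n) s N.+1 =
    n.+1%:R * pseries (besselE_coef n.+1) s N.+1 - s * pseries (besselE_coef n.+2) s N.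
  elim: N => [|N IH].
    rewrite /pseries /series/= !big_nat1 big_geq// mulr0 subr0 !expr0 !mulr1.
    rewrite !besselE_coefE !expr0 !div1r !add0n !fact0 !mul1r factSR.
    by rewrite invfM mulVKf// pnatr_eq0.
  rewrite !(pseriesS _ _ N.+1) IH besselE_coef_rec (pseriesS (besselE_coef n.+2)) exprS; ring.
have c m : pseries (besselE_coef m) s @ \oo --> besselE m s by exact: is_cvg_besselE.
have cS m : pseries (besselE_coef m) s N.+1 @[N --> \oo] --> besselE m s.
  by have := c m; rewrite -(cvg_shiftS (pseries (besselE_coef m) s)).
have h : pseries (besselE_coef n) s N.+1 @[N --> \oo] -->
    n.+1%:R * besselE n.+1 s - s * besselE n.+2 s.
  rewrite (_ : (fun N => _) = (fun N => n.+1%:R * pseries (besselE_coef n.+1) s N.+1 -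
      s * pseries (besselE_coef n.+2) s N)); last by apply/funext.
  by apply: cvgB; apply: cvgMr.
by rewrite -(cvg_lim _ (cS n))// (cvg_lim _ h).
Qed.

Lemma besselE_coef_normS n m :
  (n`!)%:R * `|besselE_coef n m.+1| <= (m.+1`!)%:R^-1 / n.+1%:R.
Proof.
rewrite besselE_coefE normrM normrX normrN1 expr1n mul1r ger0_norm ?invr_ge0 ?mulr_ge0//.
rewrite -invfM -!natrM ler_pdivrMr ?ltr0n ?muln_gt0 ?fact_gt0//.
rewrite mulrC ler_pdivlMr ?ltr0n ?muln_gt0 ?fact_gt0// -!natrM ler_nat.
rewrite mulnCA leq_mul2l; apply/orP; right.
rewrite mulnC addSn factS; apply: leq_mul; first by rewrite ltnS leq_addl.
by elim: m => // p IH; rewrite addSn factS (leq_trans IH)// leq_pmull.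
Qed.

(** The leading term of n! E_n is 1, and each later term is at most 1 / (n + 1) times the
    corresponding term of the exponential series. *)
Lemma besselE_asymp n s : `|(n`!)%:R * besselE n s - 1| <= expR `|s| / n.+1%:R.
Proof.
have key N : `|(n`!)%:R * pseries (besselE_coef n) s N.+1 - 1| <=
    series (exp_coeff `|s|) N.+1 / n.+1%:R.
  elim: N => [|N IH].
    rewrite /pseries /series/= !big_nat1 expr0 mulr1 /besselE_coef expr0 add0n fact0.
    rewrite mul1n div1r divff ?fact_neq0R// subrr normr0 mulr_ge0 ?invr_ge0//.
    by rewrite /exp_coeff/= mulr_ge0 ?invr_ge0.
  rewrite (pseriesS _ _ N.+1) (seriesSr _ N.+1) mulrDr mulrDl addrAC.
  apply: (le_trans (ler_normD _ _)); apply: lerD => //.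
  rewrite 2!normrM normr_nat (normrX _ s) /exp_coeff /= -mulrA [leRHS]mulrC mulrA.
  by rewrite ler_wpM2r ?exprn_ge0// besselE_coef_normS.
have c : `|(n`!)%:R * pseries (besselE_coef n) s N.+1 - 1| @[N --> \oo] -->
    `|(n`!)%:R * besselE n s - 1|.
  apply: cvg_norm; apply: cvgB; last exact: cvg_cst.
  apply: cvgMr; rewrite (cvg_shiftS (pseries (besselE_coef n) s)).
  exact: is_cvg_besselE.
have c2 : series (exp_coeff `|s|) N.+1 / n.+1%:R @[N --> \oo] -->
    expR `|s| / n.+1%:R.
  apply: cvgMl; rewrite (cvg_shiftS (series (exp_coeff `|s|))).
  exact: is_cvg_series_exp_coeff.
by apply: (ler_cvg_to c c2); exact: nearW.
Qed.

Lemma besselJ_natE n x : besselJ_nat n x = (x / 2) ^+ n * besselE n ((x / 2) ^+ 2).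
Proof.
rewrite /besselJ_nat /besselE -[RHS]lim_seriesZ; last exact: is_cvg_besselE.
congr (limn _); congr series; apply/funext => m.
have -> : ((x / 2) ^+ n *: [sequence besselE_coef n i * (x / 2) ^+ 2 ^+ i]_i) m =
  (x / 2) ^+ n * (besselE_coef n m * (x / 2) ^+ 2 ^+ m) by [].
by rewrite -exprM exprD /besselE_coef [_ * (x / 2) ^+ n]mulrC mulrCA.
Qed.

(* The real and imaginary parts of (x + iy)^n. *)
Fixpoint zpow n (p : R * R) : R * R :=
  if n is m.+1 then
    (p.1 * (zpow m p).1 - p.2 * (zpow m p).2, p.1 * (zpow m p).2 + p.2 * (zpow m p).1)
  else (1, 0).

Lemma zpow_polar n r t : zpow n (polar r t) = (r ^+ n * cos (n%:R * t), r ^+ n * sin (n%:R * t)).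
Proof.
elim: n => [|n IH] /=; first by rewrite !mul0r cos0 sin0 expr0 mulr0 mulr1.
rewrite IH /=; have -> : n.+1%:R * t = n%:R * t + t by rewrite -natr1 mulrDl mul1r.
by rewrite cosD sinD exprS; congr pair; ring.
Qed.

(** The two difference quotients coincide, which brings the one-variable chain rule to directional
    derivatives in the plane. *)
Lemma is_derive_line (V : normedModType R) (f : V -> R) (x v : V) (d : R) :
  is_derive (0 : R) 1 (fun h : R => f (h *: v + x)) d <-> is_derive x v f d.
Proof.
have E : (fun h : R => h^-1 *: (((fun h => f (h *: v + x)) \o shift 0) (h *: (1 : R)) -
   (fun h : R => f (h *: v + x)) 0)) =
   (fun h : R => h^-1 *: ((f \o shift x) (h *: v) - f x)).
  by apply/funext => h /=; rewrite addr0 scale0r add0r [h *: 1]mulr1.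
split => -[h1 h2]; split.
- by move: h1; rewrite /derivable E.
- by move: h2; rewrite /derive E.
- by rewrite /derivable E.
- by rewrite /derive E.
Qed.

Lemma is_derive_comp1 (V : normedModType R) (f : R -> R) (g : V -> R) (x v : V) (df dg : R) :
  is_derive (g x) 1 f df -> is_derive x v g dg -> is_derive x v (f \o g) (df * dg).
Proof.
move=> hf /is_derive_line hg; apply/is_derive_line.
have h : is_derive ((fun h : R => g (h *: v + x)) 0) 1 f df.
  by rewrite /= scale0r add0r.
exact: (is_derive1_comp h hg).
Qed.

Lemma is_derive_fst (p v : R * R) : is_derive p v (fun q : R * R => q.1) (v.1 : R).
Proof.
apply/is_derive_line.
have -> : (fun h : R => (h *: v + p).1) = (v.1 *: id) + cst p.1.
  by apply/funext => h; exact: (congr1 (+%R^~ _) (mulrC _ _)).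
by apply: is_derive_eq; rewrite addr0 [_ *: _]mulr1.
Qed.

Lemma is_derive_snd (p v : R * R) : is_derive p v (fun q : R * R => q.2) (v.2 : R).
Proof.
apply/is_derive_line.
have -> : (fun h : R => (h *: v + p).2) = (v.2 *: id) + cst p.2.
  by apply/funext => h; exact: (congr1 (+%R^~ _) (mulrC _ _)).
by apply: is_derive_eq; rewrite addr0 [_ *: _]mulr1.
Qed.

(* d z^(n+1) along v is (n+1) z^n v, read in complex notation. *)
Lemma is_derive_zpow1 n (p v : R * R) :
  is_derive p v (fun q => (zpow n.+1 q).1)
    (n.+1%:R * (v.1 * (zpow n p).1 - v.2 * (zpow n p).2)) /\
  is_derive p v (fun q => (zpow n.+1 q).2)
    (n.+1%:R * (v.1 * (zpow n p).2 + v.2 * (zpow n p).1)).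
Proof.
have hx := is_derive_fst p v; have hy := is_derive_snd p v.
elim: n => [|n [IH1 IH2]].
  split.
    rewrite (_ : (fun q => _) = (fun q : R * R => q.1)); last first.
      by apply/funext => q /=; rewrite mulr1 mulr0 subr0.
    by apply: is_derive_eq; rewrite /= mul1r mulr0 mulr1 subr0.
  rewrite (_ : (fun q => _) = (fun q : R * R => q.2)); last first.
    by apply/funext => q /=; rewrite mulr1 mulr0 add0r.
  by apply: is_derive_eq; rewrite /= mul1r mulr0 mulr1 add0r.
split.
  have -> : (fun q => (zpow n.+2 q).1) = (fun q : R * R => q.1) * (fun q => (zpow n.+1 q).1)
     - (fun q : R * R => q.2) * (fun q => (zpow n.+1 q).2) by [].
  apply: is_derive_eq; rewrite -[n.+2%:R]natr1 /GRing.scale /=; ring.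
have -> : (fun q => (zpow n.+2 q).2) = (fun q : R * R => q.1) * (fun q => (zpow n.+1 q).2)
   + (fun q : R * R => q.2) * (fun q => (zpow n.+1 q).1) by [].
apply: is_derive_eq; rewrite -[n.+2%:R]natr1 /GRing.scale /=; ring.
Qed.

Section CylindricalWaves.
Variable k : R.

Let kE n (p : R * R) := besselE n ((k / 2) ^+ 2 * (p.1 ^+ 2 + p.2 ^+ 2)).

Lemma is_derive_kE n (p v : R * R) :
  is_derive p v (kE n)
    (- (k ^+ 2 / 2) * (p.1 * v.1 + p.2 * v.2) * kE n.+1 p).
Proof.
have hx := is_derive_fst p v; have hy := is_derive_snd p v.
have hs : is_derive p v (fun q : R * R => (k / 2) ^+ 2 * (q.1 ^+ 2 + q.2 ^+ 2))
   (k ^+ 2 / 2 * (p.1 * v.1 + p.2 * v.2)).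
  have -> : (fun q : R * R => (k / 2) ^+ 2 * (q.1 ^+ 2 + q.2 ^+ 2)) =
     (k / 2) ^+ 2 *: ((fun q : R * R => q.1) * (fun q : R * R => q.1) +
       (fun q : R * R => q.2) * (fun q : R * R => q.2)).
    by apply/funext => q; rewrite /= !expr2.
  by apply: is_derive_eq; rewrite /GRing.scale /=; field.
apply: is_derive_eq.
  exact: (is_derive_comp1 (is_derive_bE n _) hs).
rewrite /kE; ring.
Qed.

(** With z = x + iy, J_n(kr) e^(int) is (k/2)^n z^n times an entire function of |z|^2. In this
    Cartesian form the origin is an ordinary point. *)
Definition wave_nat n (p : R * R) : R * R :=
  ((k / 2) ^+ n * (zpow n p).1 * kE n p, (k / 2) ^+ n * (zpow n p).2 * kE n p).

(* Real and imaginary parts of J_n(kr) e^(int). *)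
Definition wave_re (n : int) (p : R * R) : R :=
  match n with
  | Posz m => (wave_nat m p).1
  | Negz m => (-1) ^+ m.+1 * (wave_nat m.+1 p).1
  end.
Definition wave_im (n : int) (p : R * R) : R :=
  match n with
  | Posz m => (wave_nat m p).2
  | Negz m => (-1) ^+ m * (wave_nat m.+1 p).2
  end.

Lemma is_derive_wave0 (p v : R * R) :
  is_derive p v (fun q => (wave_nat 0 q).1)
    (- k * (v.1 * (wave_nat 1 p).1 + v.2 * (wave_nat 1 p).2)).
Proof.
have h := is_derive_kE 0 p v.
have -> : (fun q => (wave_nat 0 q).1) = kE 0.
  by apply/funext => q; rewrite /wave_nat /= expr0 !mul1r.
by apply: is_derive_eq; rewrite /wave_nat /= expr1; field.
Qed.

Lemma is_derive_waveS n (p v : R * R) :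
  is_derive p v (fun q => (wave_nat n.+1 q).1)
    (k / 2 * (v.1 * ((wave_nat n p).1 - (wave_nat n.+2 p).1)
       - v.2 * ((wave_nat n p).2 + (wave_nat n.+2 p).2))) /\
  is_derive p v (fun q => (wave_nat n.+1 q).2)
    (k / 2 * (v.1 * ((wave_nat n p).2 - (wave_nat n.+2 p).2)
       + v.2 * ((wave_nat n p).1 + (wave_nat n.+2 p).1))).
Proof.
have [h1 h2] := is_derive_zpow1 n p v.
have h3 := is_derive_kE n.+1 p v.
(* Differentiating z^(n+1) produces a factor n + 1; the recurrence trades it for the waves of orders
   n and n + 2. *)
have rec : kE n p = n.+1%:R * kE n.+1 p -
  (k / 2) ^+ 2 * (p.1 ^+ 2 + p.2 ^+ 2) * kE n.+2 p by exact: besselE_rec.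
split.
  have -> : (fun q => (wave_nat n.+1 q).1) =
    (k / 2) ^+ n.+1 *: ((fun q => (zpow n.+1 q).1) * kE n.+1).
    by apply/funext => q; rewrite /wave_nat [RHS]/(_ *: _)/= mulrA.
  apply: is_derive_eq; rewrite /wave_nat [kE n p]rec /GRing.scale /=.
  rewrite !exprS; move: (kE n.+1 p) (kE n.+2 p) (zpow n p).1 (zpow n p).2 => E1 E2 z1 z2.
  move: (_ ^+ n) (n.+1%:R) => u m; by field.
have -> : (fun q => (wave_nat n.+1 q).2) =
  (k / 2) ^+ n.+1 *: ((fun q => (zpow n.+1 q).2) * kE n.+1).
  by apply/funext => q; rewrite /wave_nat [RHS]/(_ *: _)/= mulrA.
apply: is_derive_eq; rewrite /wave_nat [kE n p]rec /GRing.scale /=.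
rewrite !exprS; move: (kE n.+1 p) (kE n.+2 p) (zpow n p).1 (zpow n p).2 => E1 E2 z1 z2.
move: (_ ^+ n) (n.+1%:R) => u m; by field.
Qed.

(** With W_n the wave and v read as a complex number, the two parts say D_v W_n = (k/2) (v W_(n-1) -
    conj(v) W_(n+1)). These are the ladder relations 2 d/dz W_n = k W_(n-1) and 2 d/dzbar W_n = -k
    W_(n+1), valid for all integer orders. *)
Lemma is_derive_wave (n : int) (p v : R * R) :
  is_derive p v (wave_re n) (k / 2 * (v.1 * (wave_re (n - 1) p - wave_re (n + 1) p)
       - v.2 * (wave_im (n - 1) p + wave_im (n + 1) p))) /\
  is_derive p v (wave_im n) (k / 2 * (v.1 * (wave_im (n - 1) p - wave_im (n + 1) p)
       + v.2 * (wave_re (n - 1) p + wave_re (n + 1) p))).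
Proof.
have ZrE (c : R) (f : R * R -> R) d d' : is_derive p v f d -> c * d = d' ->
    is_derive p v (fun q => c * f q) d'.
  by move=> hf <-; exact: is_deriveZ.
case: n => [[|n]|n].
- have h := is_derive_wave0 p v; split.
    apply: is_derive_eq; rewrite /= expr1 expr0 /wave_nat /=; by field.
  have -> : wave_im 0 = cst 0 by apply/funext => q; rewrite /wave_im /wave_nat /= mulr0 mul0r.
  apply: is_derive_eq; rewrite /= expr1 expr0 /wave_nat /=; ring.
- have -> : (Posz n.+1 - 1)%R = n by rewrite -addn1 PoszD addrK.
  have -> : (Posz n.+1 + 1)%R = n.+2 by rewrite -PoszD addn1.
  exact: is_derive_waveS.
- have -> : (Negz n + 1)%R = - n%:Z by rewrite NegzE -addn1 PoszD opprD subrK.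
  have -> : (Negz n - 1)%R = Negz n.+1 by rewrite !NegzE -(addn1 n.+1) PoszD opprD.
  have [h1 h2] := is_derive_waveS n p v.
  have -> : wave_re (- n%:Z) p = (-1) ^+ n * (wave_nat n p).1.
    by case: n {h1 h2} => [|n]; rewrite ?oppr0 /= ?expr0 ?mul1r// -NegzE.
  (* At n = 0 the order is [Posz 0] and the two sides have opposite signs; they agree because the
     imaginary part of the wave of order 0 vanishes. *)
  have -> : wave_im (- n%:Z) p = - (-1) ^+ n * (wave_nat n p).2.
    case: n {h1 h2} => [|n]; last first.
      by rewrite -NegzE /wave_im exprS mulN1r opprK.
    by rewrite oppr0 /= /wave_nat /= !mulr0 mul0r mulr0.
  by split; [apply: (ZrE _ _ _ _ h1)|apply: (ZrE _ _ _ _ h2)];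
    rewrite /= !exprS; ring.
Qed.

Lemma wave_polar (n : int) (r t : R) :
  wave_re n (polar r t) = besselJ n (k * r) * cos (n%:~R * t) /\
  wave_im n (polar r t) = besselJ n (k * r) * sin (n%:~R * t).
Proof.
have H m : wave_nat m (polar r t) = (besselJ_nat m (k * r) * cos (m%:R * t),
    besselJ_nat m (k * r) * sin (m%:R * t)).
  rewrite /wave_nat zpow_polar besselJ_natE /kE /=.
  have -> : (k / 2) ^+ 2 * ((r * cos t) ^+ 2 + (r * sin t) ^+ 2) = (k * r / 2) ^+ 2.
    rewrite !exprMn -mulrDr cos2Dsin2; ring.
  have -> : (k * r / 2) ^+ m = (k / 2) ^+ m * r ^+ m by rewrite -exprMn mulrAC.
  by congr pair; ring.
case: n => n; rewrite /wave_re /wave_im H /besselJ [(_, _).1]/= [(_, _).2]/= -?pmulrn//.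
have -> : (Negz n)%:~R * t = - (n.+1%:R * t) :> R by rewrite NegzE mulrNz mulNr pmulrn.
by rewrite cosN sinN exprS; split; ring.
Qed.

Lemma continuous_besselE n : continuous (besselE n : R -> R).
Proof.
move=> s; apply: differentiable_continuous; apply/derivable1_diffP.
by have [h _] := is_derive_bE n (s : R); exact: h.
Qed.

Lemma continuous_wave (n : int) : continuous (wave_re n) /\ continuous (wave_im n).
Proof.
have c1 : continuous (fun p : R * R => p.1) by move=> p; exact: cvg_fst.
have c2 : continuous (fun p : R * R => p.2) by move=> p; exact: cvg_snd.
have cz m : continuous (fun p => (zpow m p).1) /\ continuous (fun p => (zpow m p).2).
  elim: m => [|m [IH1 IH2]]; first by split => p; exact: cvg_cst.
  split => p /=.
    by apply: cvgB; apply: cvgM; [exact: c1|exact: IH1|exact: c2|exact: IH2].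
  by apply: cvgD; apply: cvgM; [exact: c1|exact: IH2|exact: c2|exact: IH1].
have ck m : continuous (kE m).
  move=> p; apply: (@continuous_comp _ _ _
    (fun q : R * R => (k / 2) ^+ 2 * (q.1 ^+ 2 + q.2 ^+ 2)) (besselE m)); last exact: continuous_besselE.
  apply: cvgM; first exact: cvg_cst.
  by apply: cvgD; rewrite !expr2; apply: cvgM; (exact: c1 || exact: c2).
have cw m : continuous (fun p => (wave_nat m p).1) /\ continuous (fun p => (wave_nat m p).2).
  split => p; apply: cvgM; try exact: ck; apply: cvgM; try exact: cvg_cst;
    [exact: (cz m).1|exact: (cz m).2].
case: n => n; first exact: cw.
by split => p; (apply: cvgM; first exact: cvg_cst); [exact: (cw _).1|exact: (cw _).2].
Qed.

End CylindricalWaves.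

(** The factor E_n takes the positive value 1 / n! at 0. This gives a point where J_n is nonzero,
    both for comparing solutions of the Bessel equation and for showing that an eigenfunction is not
    identically zero. *)
Lemma besselJ_nat_small n : exists2 d : R, 0 < d & forall x, 0 < x < d -> 0 < besselJ_nat n x.
Proof.
have h0 : 0 < besselE n 0.
  have -> : besselE n 0 = (n`!)%:R^-1.
    rewrite /besselE; apply: (@cvg_lim R) => //; apply: cvg_near_cst; near=> m.
    rewrite -(@prednK m); last by near: m; exact: nbhs_infty_gt.
    elim: (m.-1) => [|p IH]; last by rewrite pseriesS IH expr0n mulr0 addr0.
    by rewrite /pseries/= /series/= big_nat1 expr0 mulr1 besselE_coefE expr0 fact0 !mul1r add0n.
  by rewrite invr_gt0 ltr0n fact_gt0.
have c : (fun x : R => besselE n ((x / 2) ^+ 2)) @ (0 : R) --> besselE n 0.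
  have {2}-> : 0 = (0 / 2) ^+ 2 :> R by rewrite mul0r expr0n.
  apply: (@continuous_comp _ _ _ (fun x : R => (x / 2) ^+ 2) (besselE n)); last exact: continuous_besselE.
  by apply: cvgM; apply: cvgMl; exact: cvg_id.
have /nbhs_ballP[d /= d0 hd] : \forall x \near (0 : R), 0 < besselE n ((x / 2) ^+ 2).
  exact: (cvgr_gt _ c).
exists d => // x /andP[x0 xd]; rewrite besselJ_natE mulr_gt0 ?exprn_gt0 ?divr_gt0//.
by apply: hd; rewrite /ball /= sub0r normrN gtr0_norm.
Unshelve. all: by end_near.
Qed.

(** The condition on n makes the relative error in [besselE_asymp] at most 1/2; the upper factor 3/2
    is rounded up to 2. *)
Lemma besselJ_nat_asymp n x : 0 <= x -> 2 * expR ((x / 2) ^+ 2) <= n.+1%:R ->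
  (x / 2) ^+ n / (n`!)%:R / 2 <= besselJ_nat n x <= (x / 2) ^+ n / (n`!)%:R * 2.
Proof.
move=> x0 hn.
have h : `|(n`!)%:R * besselE n ((x / 2) ^+ 2) - 1| <= 1 / 2.
  apply: (le_trans (besselE_asymp _ _)); rewrite ger0_norm ?sqr_ge0//.
  by rewrite ler_pdivrMr ?ltr0n//; lra.
have u0 : 0 <= (x / 2) ^+ n / (n`!)%:R :> R by rewrite !mulr_ge0 ?exprn_ge0 ?divr_ge0.
have -> : besselJ_nat n x = (x / 2) ^+ n / (n`!)%:R * ((n`!)%:R * besselE n ((x / 2) ^+ 2)).
  by rewrite besselJ_natE mulrA divfK ?fact_neq0R.
move: h u0; rewrite ler_norml; move: (_ * besselE _ _) (_ / _`!%:R) => e u h u0.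
by apply/andP; split; nra.
Qed.

Lemma continuous_besselJ (n : int) : continuous (besselJ n : R -> R).
Proof.
have H m : continuous (besselJ_nat m : R -> R).
  rewrite (_ : besselJ_nat m = fun x => (x / 2) ^+ m * besselE m ((x / 2) ^+ 2)); last first.
    by apply/funext => x; exact: besselJ_natE.
  have c : continuous (fun x : R => x / 2) by move=> x; apply: cvgMl; exact: cvg_id.
  have cX p : continuous (fun x : R => (x / 2) ^+ p).
    elim: p => [|p IH] x; first by under eq_fun do rewrite expr0; exact: cvg_cst.
    have -> : (fun x0 : R => (x0 / 2) ^+ p.+1) = (fun x0 => (x0 / 2) * (x0 / 2) ^+ p).
      by apply/funext => y; rewrite exprS.
    by apply: cvgM; [exact: c|exact: IH].
  move=> x; apply: cvgM; first exact: cX.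
  by apply: (@continuous_comp _ _ _ (fun x : R => (x / 2) ^+ 2) (besselE m)); [exact: cX|exact: continuous_besselE].
case: n => n; first exact: H.
by move=> x; apply: cvgM; [exact: cvg_cst|exact: H].
Qed.

End BesselSeries.

(** * Solutions of the Helmholtz equation on the whole plane and their linear combinations *)

Section EntireSolutions.
Variable R : realType.
Implicit Types (n : int) (k c d : R) (f g : R * R -> R) (p v : R * R).

Definition lcomb c d f g : R * R -> R := fun p => c * f p + d * g p.

Lemma is_derive_lcomb c d f g p v (df dg : R) :
  is_derive p v f df -> is_derive p v g dg ->
  is_derive p v (lcomb c d f g) (c * df + d * dg).
Proof.
by move=> hf hg; exact: (is_deriveD (is_deriveZ c hf) (is_deriveZ d hg)).
Qed.

Lemma continuous_lcomb c d f g : continuous f -> continuous g ->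
  continuous (lcomb c d f g).
Proof.
by move=> hf hg p; apply: cvgD; apply: cvgM; (exact: cvg_cst || exact: hf || exact: hg).
Qed.

Definition gradient f f1 f2 : Prop :=
  [/\ forall p, is_derive p (e1 R) f (f1 p), forall p, is_derive p (e2 R) f (f2 p),
      continuous f1 & continuous f2].

Lemma gradient_lcomb c d f f1 f2 g g1 g2 : gradient f f1 f2 -> gradient g g1 g2 ->
  gradient (lcomb c d f g) (lcomb c d f1 g1) (lcomb c d f2 g2).
Proof.
move=> [hf1 hf2 cf1 cf2] [hg1 hg2 cg1 cg2]; split=> p.
- exact: (is_derive_lcomb c d (hf1 p) (hg1 p)).
- exact: (is_derive_lcomb c d (hf2 p) (hg2 p)).
- exact: (continuous_lcomb cf1 cg1).
- exact: (continuous_lcomb cf2 cg2).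
Qed.

(** All derivatives up to order two are carried as explicit functions, so that linear combinations
    are formed on these witnesses and the operators ['D_v] appear only at the end, in
    [entire_helmE]. *)
Definition entire_helm k f := exists f1 f2 f11 f12 f21 f22,
  [/\ gradient f f1 f2, gradient f1 f11 f12, gradient f2 f21 f22 &
    forall p, f11 p + f22 p = - k ^+ 2 * f p].

Lemma gradient_C1 f f1 f2 : gradient f f1 f2 ->
  [/\ C1_on setT f, 'D_(e1 R) f = f1 & 'D_(e2 R) f = f2].
Proof.
move=> [h1 h2 c1 c2].
have E1 : 'D_(e1 R) f = f1 by apply/funext => p; have [] := h1 p.
have E2 : 'D_(e2 R) f = f2 by apply/funext => p; have [] := h2 p.
split; [|exact: E1|exact: E2] => p _.
rewrite E1 E2; split; [by have [] := h1 p|by have [] := h2 p|exact: c1|exact: c2].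
Qed.

Lemma entire_helmE k f : entire_helm k f ->
  C2_on setT f /\ forall p, laplacian f p = - k ^+ 2 * f p.
Proof.
move=> [f1 [f2 [f11 [f12 [f21 [f22 [/gradient_C1[c0 E1 E2]]]]]]]].
move=> /gradient_C1[c1 E11 _] /gradient_C1[c2 _ E22] h.
split; first by rewrite /C2_on E1 E2.
move=> p; rewrite -h -E11 -E22 -E1 -E2; reflexivity.
Qed.

Lemma entire_helm_lcomb k c d f g :
  entire_helm k f -> entire_helm k g -> entire_helm k (lcomb c d f g).
Proof.
move=> [f1 [f2 [f11 [f12 [f21 [f22 [hf hf1 hf2 Ef]]]]]]].
move=> [g1 [g2 [g11 [g12 [g21 [g22 [hg hg1 hg2 Eg]]]]]]].
exists (lcomb c d f1 g1), (lcomb c d f2 g2), (lcomb c d f11 g11), (lcomb c d f12 g12),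
  (lcomb c d f21 g21), (lcomb c d f22 g22).
split; try exact: gradient_lcomb.
move=> p; have := Eg p; have := Ef p; rewrite /lcomb => {}Ef {}Eg.
have -> : - k ^+ 2 * (c * f p + d * g p) = c * (- k ^+ 2 * f p) + d * (- k ^+ 2 * g p) by ring.
rewrite -Ef -Eg; ring.
Qed.

Lemma entire_helm0 k : entire_helm k (fun=> 0).
Proof.
have h : gradient (fun=> 0) (fun=> 0) (fun=> 0).
  by split=> p; (exact: is_derive_cst || exact: cvg_cst).
do 6 exists (fun=> 0); split; [exact: h|exact: h|exact: h|].
by move=> p; rewrite mulr0 addr0.
Qed.

Lemma gradient_wave k n :
  gradient (wave_re k n) (lcomb (k / 2) (- (k / 2)) (wave_re k (n - 1)) (wave_re k (n + 1)))
    (lcomb (- (k / 2)) (- (k / 2)) (wave_im k (n - 1)) (wave_im k (n + 1))) /\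
  gradient (wave_im k n) (lcomb (k / 2) (- (k / 2)) (wave_im k (n - 1)) (wave_im k (n + 1)))
    (lcomb (k / 2) (k / 2) (wave_re k (n - 1)) (wave_re k (n + 1))).
Proof.
have [c1 c2] := continuous_wave k (n - 1); have [c3 c4] := continuous_wave k (n + 1).
split; split => p.
- by apply: (is_derive_eq (is_derive_wave k n p (e1 R)).1); rewrite /lcomb /e1 [_.1]/= [_.2]/=; ring.
- by apply: (is_derive_eq (is_derive_wave k n p (e2 R)).1); rewrite /lcomb /e2 [_.1]/= [_.2]/=; ring.
- exact: (continuous_lcomb c1 c3).
- exact: (continuous_lcomb c2 c4).
- by apply: (is_derive_eq (is_derive_wave k n p (e1 R)).2); rewrite /lcomb /e1 [_.1]/= [_.2]/=; ring.
- by apply: (is_derive_eq (is_derive_wave k n p (e2 R)).2); rewrite /lcomb /e2 [_.1]/= [_.2]/=; ring.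
- exact: (continuous_lcomb c2 c4).
- exact: (continuous_lcomb c1 c3).
Qed.

(** On applying the ladder relations twice, the orders n - 2 and n + 2 cancel between the two pure
    second derivatives and order n remains with the factor -k^2. *)
Lemma entire_helm_wave k n : entire_helm k (wave_re k n) /\ entire_helm k (wave_im k n).
Proof.
have [g1 g2] := gradient_wave k n.
have [g3 g4] := gradient_wave k (n - 1).
have [g5 g6] := gradient_wave k (n + 1).
have n1 : n - 1 + 1 = n by rewrite subrK.
have n2 : n + 1 - 1 = n by rewrite addrK.
split.
- do 6 eexists; split; [exact: g1|exact: gradient_lcomb g3 g5|exact: gradient_lcomb g4 g6|].
  by move=> p; rewrite n1 n2 /lcomb; field.
- do 6 eexists; split; [exact: g2|exact: gradient_lcomb g4 g6|exact: gradient_lcomb g3 g5|].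
  by move=> p; rewrite n1 n2 /lcomb; field.
Qed.

End EntireSolutions.

(** * Differential calculus for C^1 functions on a disk *)

Section PlaneCalculus.
Variable R : realType.
Implicit Types (a b r s t eps : R) (w : R * R -> R) (x : R * R).

Lemma MVT01 (f df : R -> R) : (forall s, 0 <= s <= 1 -> is_derive s 1 f (df s)) ->
  exists2 s, 0 <= s <= 1 & f 1 - f 0 = df s.
Proof.
move=> h.
have [||c c01 E] := @MVT_segment R f df 0 1 ler01.
- by move=> x; rewrite in_itv /= => /andP[x0 x1]; apply: h; rewrite !ltW.
- apply: derivable_within_continuous => x; rewrite in_itv /= => hx.
  by have [] := h x hx.
exists c; first by move: c01; rewrite in_itv.
by rewrite E subr0 mulr1.
Qed.

Lemma is_derive_along (f : R * R -> R) (x v : R * R) (s d : R) :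
  is_derive (s *: v + x) v f d -> is_derive s 1 (fun t => f (t *: v + x)) d.
Proof.
move=> /is_derive_line h.
have -> : (fun t => f (t *: v + x)) = (fun t => f (t *: v + (s *: v + x))) \o (fun t => t - s).
  by apply/funext => t /=; rewrite addrA -scalerDl subrK.
have h1 : is_derive ((fun t => t - s) s) 1 (fun t => f (t *: v + (s *: v + x))) d.
  by rewrite subrr.
have h2 : is_derive s 1 (fun t : R => t - s) 1.
  by apply: is_derive_eq; rewrite subr0.
by have := @is_derive1_comp R (fun t => f (t *: v + (s *: v + x))) (fun t => t - s) s _ _ h1 h2; rewrite mulr1.
Qed.

Lemma mvt_dir w x (v : R * R) (h : R) :
  (forall s, 0 <= s <= 1 -> derivable w ((s * h) *: v + x) v) ->
  exists2 s, 0 <= s <= 1 & w (h *: v + x) - w x = 'D_v w ((s * h) *: v + x) * h.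
Proof.
move=> H.
have [|s s01 E] := @MVT01 (fun s => w ((s * h) *: v + x)) (fun s => 'D_v w ((s * h) *: v + x) * h).
  move=> s s01.
  have h1 := is_derive_along (derivableP (H s s01)).
  have h2 : is_derive s 1 (fun t : R => t * h) h.
    have -> : (fun t : R => t * h) = h *: id by apply/funext => t; exact: mulrC.
    by apply: is_derive_eq; exact: mulr1.
  exact: (@is_derive1_comp R (fun t => w (t *: v + x)) (fun t => t * h) s _ _ h1 h2).
by exists s => //; move: E; rewrite /= mul1r mul0r scale0r add0r.
Qed.

Lemma open_disk a : open (disk a).
Proof.
have -> : disk a = (fun x : R * R => x.1 ^+ 2 + x.2 ^+ 2) @^-1` [set y | y < a ^+ 2] by [].
apply: open_comp; last exact: open_lt.
move=> x _; apply: cvgD; rewrite !expr2; apply: cvgM; (exact: cvg_fst || exact: cvg_snd).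
Qed.

Lemma compact_closed_disk a : compact (closed_disk a).
Proof.
apply: (@subclosed_compact _ _ (`[- `|a|, `|a|] `*` `[- `|a|, `|a|])).
- have -> : closed_disk a = (fun x : R * R => x.1 ^+ 2 + x.2 ^+ 2) @^-1` [set y | y <= a ^+ 2] by [].
  apply: closed_comp; last exact: closed_le.
  move=> x _; apply: cvgD; rewrite !expr2; apply: cvgM; (exact: cvg_fst || exact: cvg_snd).
- by apply: compact_setX; exact: segment_compact.
- move=> x; rewrite /closed_disk /= -[a ^+ 2]real_normK ?num_real// => h.
  have ub (y z : R) : y ^+ 2 + z ^+ 2 <= `|a| ^+ 2 -> `|y| <= `|a|.
    move=> hyz; rewrite -ler_sqr ?nnegrE// real_normK ?num_real//.
    by apply: le_trans hyz; rewrite lerDl sqr_ge0.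
  split; rewrite /= in_itv /= -ler_norml; first exact: ub h.
  by apply: (ub _ x.1); rewrite addrC.
Qed.

Lemma disk_ball a x : disk a x -> exists2 d : R, 0 < d &
  forall y, `|y.1 - x.1| < d -> `|y.2 - x.2| < d -> disk a y.
Proof.
move=> ax; have /nbhs_ballP[d /= d0 hd] := open_nbhs_nbhs (conj (@open_disk a) ax).
by exists d => // y h1 h2; apply: hd; split; rewrite /ball /= distrC.
Qed.

Lemma continuous_disk_ball w x eps : {for x, continuous w} -> 0 < eps -> exists2 d : R, 0 < d &
  forall y, `|y.1 - x.1| < d -> `|y.2 - x.2| < d -> `|w y - w x| <= eps.
Proof.
move=> cw e0.
have /nbhs_ballP[d /= d0 hd] : \forall y \near x, `|w x - w y| <= eps.
  by move/cvgrPdist_le : cw; apply.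
by exists d => // y h1 h2; rewrite distrC; apply: hd; split; rewrite /ball /= distrC.
Qed.

(** The increment is split into a vertical and a horizontal one; the mean value theorem on each
    segment and the continuity of the partial derivatives give the error bound. *)
Lemma C1_frechet a w x eps : C1_on (disk a) w -> disk a x -> 0 < eps ->
  exists2 d : R, 0 < d & forall p q : R, `|p| < d -> `|q| < d ->
    `|w (x.1 + p, x.2 + q) - w x - ('D_(e1 R) w x * p + 'D_(e2 R) w x * q)| <= eps * (`|p| + `|q|).
Proof.
move=> hw ax e0.
have [d1 d10 H1] := disk_ball ax.
have [_ _ c1 c2] := hw x ax.
have [d2 d20 H2] := continuous_disk_ball c1 e0.
have [d3 d30 H3] := continuous_disk_ball c2 e0.
exists (Num.min d1 (Num.min d2 d3)); first by rewrite !lt_min d10 d20.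
move=> p q; rewrite !lt_min => /and3P[p1 p2 p3] /and3P[q1 q2 q3].
have sm s (z d : R) : 0 <= s <= 1 -> `|z| < d -> `|s * z| < d.
  move=> /andP[s0 s1] zd; rewrite normrM (ger0_norm s0).
  by apply: le_lt_trans zd; rewrite -[leRHS]mul1r ler_wpM2r.
have d0 d : 0 < d -> `|0 : R| < d by rewrite normr0.
have [|s s01 E1] := @mvt_dir w (x.1, x.2 + q) (e1 R) p.
  move=> s s01.
  suff /hw[] : disk a ((s * p) *: e1 R + (x.1, x.2 + q)) by [].
  apply: H1; rewrite /=; rewrite /GRing.scale /= ?mulr1 ?mulr0 ?add0r ?addrK; first exact: sm.
  by rewrite addrC addKr.
have [|u u01 E2] := @mvt_dir w x (e2 R) q.
  move=> u u01.
  suff /hw[] : disk a ((u * q) *: e2 R + x) by [].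
  apply: H1; rewrite /=; rewrite /GRing.scale /= ?mulr1 ?mulr0 ?add0r ?addrK; last exact: sm.
  by rewrite subrr; exact: d0.
have F1 : `|'D_(e1 R) w ((s * p) *: e1 R + (x.1, x.2 + q)) - 'D_(e1 R) w x| <= eps.
  apply: H2; rewrite /=; rewrite /GRing.scale /= ?mulr1 ?mulr0 ?add0r ?addrK; first exact: sm.
  by rewrite addrC addKr.
have F2 : `|'D_(e2 R) w ((u * q) *: e2 R + x) - 'D_(e2 R) w x| <= eps.
  apply: H3; rewrite /=; rewrite /GRing.scale /= ?mulr1 ?mulr0 ?add0r ?addrK; last exact: sm.
  by rewrite subrr; exact: d0.
have pairE (y z : R * R) : y.1 = z.1 -> y.2 = z.2 -> y = z.
  by case: y z => [? ?] [? ?] /= -> ->.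
have G1 : p *: e1 R + (x.1, x.2 + q) = (x.1 + p, x.2 + q).
  by apply: pairE; rewrite /= /GRing.scale /= ?mulr1 ?mulr0 ?add0r// addrC.
have G2 : q *: e2 R + x = (x.1, x.2 + q).
  by apply: pairE; rewrite /= /GRing.scale /= ?mulr1 ?mulr0 ?add0r// addrC.
rewrite G1 in E1; rewrite G2 in E2.
move: F1 F2 E1 E2; move: ('D_(e1 R) w _) ('D_(e2 R) w _) => A1 A2.
set B1 := 'D_(e1 R) w x; set B2 := 'D_(e2 R) w x => F1 F2 E1 E2.
have -> : w (x.1 + p, x.2 + q) - w x - (B1 * p + B2 * q) = (A1 - B1) * p + (A2 - B2) * q.
  rewrite !mulrBl -E1 -E2; ring.
rewrite mulrDr (le_trans (ler_normD _ _))// !normrM.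
by apply: lerD; rewrite ler_wpM2r.
Qed.

Lemma is_derive_continuous (f : R -> R) s d : is_derive s 1 f d -> {for s, continuous f}.
Proof.
by move=> [h _]; apply: differentiable_continuous; apply/derivable1_diffP.
Qed.

Lemma is_derive_quot (f : R -> R) s d :
  is_derive s 1 f d <-> h^-1 * (f (s + h) - f s) @[h --> 0^'] --> d.
Proof.
have E : (fun h : R => h^-1 *: ((f \o shift s) (h *: 1) - f s)) =
   (fun h : R => h^-1 * (f (s + h) - f s)).
  by apply/funext => h; rewrite /= /shift /= [h *: 1]mulr1 [h + s]addrC.
split.
  by move=> [h1 h2]; move: h1; rewrite /derivable -/(derive f s 1) h2 E.
move=> c.
have c' : (fun h : R => h^-1 *: ((f \o shift s) (h *: 1) - f s)) @ 0^' --> d by rewrite E.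
split; first by apply/cvg_ex; exists d.
by apply: cvg_lim.
Qed.

Lemma C1_chain a w (p q : R -> R) s dp dq : C1_on (disk a) w -> disk a (p s, q s) ->
  is_derive s 1 p dp -> is_derive s 1 q dq ->
  is_derive s 1 (fun t => w (p t, q t))
    ('D_(e1 R) w (p s, q s) * dp + 'D_(e2 R) w (p s, q s) * dq).
Proof.
move=> hw ax hp hq; apply/is_derive_quot.
have cp := is_derive_continuous hp; have cq := is_derive_continuous hq.
have /is_derive_quot dp' := hp; have /is_derive_quot dq' := hq.
set D1 := 'D_(e1 R) w _; set D2 := 'D_(e2 R) w _.
have lin : D1 * (h^-1 * (p (s + h) - p s)) + D2 * (h^-1 * (q (s + h) - q s)) @[h --> 0^']
    --> D1 * dp + D2 * dq.
  by apply: cvgD; apply: cvgM => //; exact: cvg_cst.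
have err : h^-1 * (w (p (s + h), q (s + h)) - w (p s, q s)) -
   (D1 * (h^-1 * (p (s + h) - p s)) + D2 * (h^-1 * (q (s + h) - q s))) @[h --> 0^'] --> (0 : R).
  apply/cvgrPdist_le => eps e0.
  (* Near s the difference quotients of p and q are at most |dp| + 1 and |dq| + 1, and the
     denominator is the sum of these bounds. *)
  pose e' := eps / (`|dp| + `|dq| + 2).
  have M0 : 0 < `|dp| + `|dq| + 2 by rewrite ltr_wpDl// addr_ge0.
  have e'0 : 0 < e' by rewrite divr_gt0.
  have [d d0 H] := C1_frechet hw ax e'0.
  have shift0 (f : R -> R) : {for s, continuous f} ->
      \forall h \near 0^', `|f (s + h) - f s| < d.
    move=> cf; have /nbhs_ballP[z /= z0 hz] : \forall y \near s, `|f s - f y| < d.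
      by move/cvgrPdist_lt : cf; apply.
    apply/nbhs_ballP; exists z => // h /= hh _; rewrite distrC; apply: hz.
    by move: hh; rewrite /ball /= sub0r normrN opprD addrA subrr sub0r normrN.
  have bd (f : R -> R) df : h^-1 * (f (s + h) - f s) @[h --> 0^'] --> df ->
     \forall h \near 0^', `|h^-1 * (f (s + h) - f s)| <= `|df| + 1.
    move=> /cvgrPdist_le /(_ 1 ltr01); apply: filterS => h hh.
    rewrite -[X in `|X|](subrK df) addrC; apply: (le_trans (ler_normD _ _)).
    by rewrite lerD2l distrC.
  have hpn := shift0 _ cp; have hqn := shift0 _ cq.
  have bp := bd _ _ dp'; have bq := bd _ _ dq'.
  near=> h.
  have h0 : h != 0 by near: h; exact: nbhs_dnbhs_neq.
  have Hp : `|p (s + h) - p s| < d by near: h.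
  have Hq : `|q (s + h) - q s| < d by near: h.
  have Bp : `|h^-1 * (p (s + h) - p s)| <= `|dp| + 1 by near: h.
  have Bq : `|h^-1 * (q (s + h) - q s)| <= `|dq| + 1 by near: h.
  have := H _ _ Hp Hq; rewrite /= ![_ + (_ - _)]addrC !subrK => Hw.
  rewrite sub0r normrN.
  have -> : h^-1 * (w (p (s + h), q (s + h)) - w (p s, q s)) -
      (D1 * (h^-1 * (p (s + h) - p s)) + D2 * (h^-1 * (q (s + h) - q s))) =
      h^-1 * (w (p (s + h), q (s + h)) - w (p s, q s) -
      (D1 * (p (s + h) - p s) + D2 * (q (s + h) - q s))) by ring.
  rewrite normrM; apply: le_trans (ler_wpM2l (normr_ge0 _) Hw) _.
  rewrite mulrCA mulrDr -!normrM.
  apply: (@le_trans _ _ (e' * (`|dp| + `|dq| + 2))); last by rewrite divfK// gt_eqF.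
  by rewrite ler_wpM2l ?(ltW e'0)//; move: Bp Bq; lra.
have := cvgD err lin; rewrite add0r.
have -> : (fun h => h^-1 * (w (p (s + h), q (s + h)) - w (p s, q s))) =
  (fun h => h^-1 * (w (p (s + h), q (s + h)) - w (p s, q s)) -
     (D1 * (h^-1 * (p (s + h) - p s)) + D2 * (h^-1 * (q (s + h) - q s)))) +
  (fun h => D1 * (h^-1 * (p (s + h) - p s)) + D2 * (h^-1 * (q (s + h) - q s))).
  by apply/funext => h; exact: (esym (subrK _ _)).
exact.
Unshelve. all: by end_near.
Qed.

Lemma C1_continuous a w x : C1_on (disk a) w -> disk a x -> {for x, continuous w}.
Proof.
move=> hw ax; apply/cvgrPdist_le => eps e0.
have [d d0 H] := C1_frechet hw ax ltr01.
set D1 := 'D_(e1 R) w x in H; set D2 := 'D_(e2 R) w x in H.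
pose M := `|D1| + `|D2| + 2.
have M0 : 0 < M by rewrite ltr_wpDl// addr_ge0.
have m0 : 0 < Num.min d (eps / M) by rewrite lt_min d0 divr_gt0.
suff : \forall y \near x, `|w x - w y| <= eps by [].
apply/nbhs_ballP; exists (Num.min d (eps / M)) => // y [] /=; rewrite /ball /= distrC !lt_min.
move=> /andP[h1 h1']; rewrite distrC => /andP[h2 h2'].
have := H _ _ h1 h2.
have -> : (x.1 + (y.1 - x.1), x.2 + (y.2 - x.2)) = y.
  by rewrite ![_ + (_ - _)]addrC !subrK; case: (y).
move: h1' h2'; move: (y.1 - x.1) (y.2 - x.2) => p q h1' h2' Hw.
rewrite distrC -[X in `|X|](subrK (D1 * p + D2 * q)).
apply: le_trans (ler_normD _ _) _.
apply: le_trans (lerD Hw (ler_normD _ _)) _; rewrite mul1r !normrM.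
move: h1' h2'; rewrite !ltr_pdivlMr// /M => h1' h2'.
have := normr_ge0 p; have := normr_ge0 q; have := normr_ge0 D1; have := normr_ge0 D2.
move: h1' h2'; move: `|p| `|q| `|D1| `|D2| => P Q A B; nra.
Qed.

Lemma closed_disk_bounded a b w : (forall x, disk a x -> {for x, continuous w}) ->
  0 <= b < a -> exists2 M, 0 <= M & forall x, closed_disk b x -> `|w x| <= M.
Proof.
move=> cw /andP[b0 ba].
have sub x : closed_disk b x -> disk a x.
  move=> h; apply: (le_lt_trans h); rewrite ltr_sqr ?nnegrE// (le_trans b0)// ltW//.
have [|||M cM hM] := @compact_EVT_max _ R (fun x => `|w x|) (closed_disk b).
- by exists (0, 0); rewrite /closed_disk /= expr0n addr0 sqr_ge0.
- exact: compact_closed_disk.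
- apply: continuous_in_subspaceT => x /[!inE] /sub /cw h.
  by apply: continuous_comp; [exact: h|exact: norm_continuous].
exists `|w M| => // x bx; apply: hM; exact: mem_set.
Qed.

End PlaneCalculus.

(** * Weighted integrals over circles, and the Bessel equation they satisfy in the radius *)

Section CircleIntegrals.
Variable R : realType.
Implicit Types (a b r s t eps : R) (w v : R * R -> R) (x : R * R) (xi eta : R -> R).

Definition continuous_disk a w := forall x, disk a x -> {for x, continuous w}.

Definition circ_int w xi r : R :=
  \int[lebesgue_measure]_(t in @angles R) (w (polar r t) * xi t).

Lemma polar_norm2 r t : (polar r t).1 ^+ 2 + (polar r t).2 ^+ 2 = r ^+ 2.
Proof.
by rewrite /= !exprMn -mulrDr cos2Dsin2 mulr1.
Qed.

Lemma polar_disk a r t : `|r| < a -> disk a (polar r t).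
Proof.
move=> ra; rewrite /disk /= -/(polar r t) polar_norm2 -real_normK ?num_real//.
by rewrite ltr_sqr ?nnegrE// (le_trans (normr_ge0 r))// ltW.
Qed.

Lemma polar2pi r : polar r (2 * pi) = polar r 0.
Proof.
by rewrite /polar mulr_natl cos2pi sin2pi cos0 sin0.
Qed.

Lemma is_derive_polar_radius a w r t : C1_on (disk a) w -> `|r| < a ->
  is_derive r 1 (fun r => w (polar r t))
    ('D_(e1 R) w (polar r t) * cos t + 'D_(e2 R) w (polar r t) * sin t).
Proof.
move=> hw ra; apply: (C1_chain hw); first exact: polar_disk.
- rewrite (_ : (fun r => r * cos t) = cos t *: id); last by apply/funext => z; exact: mulrC.
  by apply: is_derive_eq; exact: mulr1.
- rewrite (_ : (fun r => r * sin t) = sin t *: id); last by apply/funext => z; exact: mulrC.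
  by apply: is_derive_eq; exact: mulr1.
Qed.

Lemma is_derive_polar_angle a w r t : C1_on (disk a) w -> `|r| < a ->
  is_derive t 1 (fun t => w (polar r t))
    ('D_(e1 R) w (polar r t) * (r * - sin t) + 'D_(e2 R) w (polar r t) * (r * cos t)).
Proof.
move=> hw ra; by apply: (C1_chain hw); first exact: polar_disk.
Qed.

Lemma continuous_polar a w r : continuous_disk a w -> `|r| < a ->
  continuous (fun t => w (polar r t)).
Proof.
move=> cw ra t.
apply: (@continuous_comp _ _ _ (polar r) w); last by apply: cw; exact: polar_disk.
have h1 : r * cos x @[x --> t] --> r * cos t by apply: cvgM; [exact: cvg_cst|exact: continuous_cos].
have h2 : r * sin x @[x --> t] --> r * sin t by apply: cvgM; [exact: cvg_cst|exact: continuous_sin].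
exact: (cvg_pair h1 h2).
Qed.

Lemma integrable_angles (f : R -> R) : continuous f ->
  (@lebesgue_measure R).-integrable (@angles R) (EFin \o f).
Proof.
move=> cf; apply: continuous_compact_integrable; first exact: segment_compact.
exact: continuous_subspaceT.
Qed.

Lemma continuousM (f g : R -> R) : continuous f -> continuous g -> continuous (fun t => f t * g t).
Proof.
by move=> cf cg t; apply: cvgM; [exact: cf|exact: cg].
Qed.

Lemma integrable_circ a w xi r : continuous_disk a w -> continuous xi -> `|r| < a ->
  (@lebesgue_measure R).-integrable (@angles R) (EFin \o (fun t => w (polar r t) * xi t)).
Proof.
move=> cw cx ra; apply: integrable_angles; apply: continuousM => //.
exact: (continuous_polar cw).
Qed.

Lemma measurable_angles : measurable (@angles R).
Proof.
exact: measurable_itv.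
Qed.

Lemma Rintegral_FTC2 (F f : R -> R) : (forall t, is_derive t 1 F (f t)) -> continuous f ->
  \int[lebesgue_measure]_(t in @angles R) f t = F (2 * pi) - F 0.
Proof.
move=> hF cf; have pi20 : 0 < 2 * pi :> R by rewrite mulr_gt0// pi_gt0.
have := @continuous_FTC2 R f F 0 (2 * pi) pi20.
rewrite /Rintegral => ->//.
- exact: continuous_subspaceT.
- split.
  + by move=> t _; have [] := hF t.
  + exact/cvg_at_right_filter/(is_derive_continuous (hF 0)).
  + exact/cvg_at_left_filter/(is_derive_continuous (hF (2 * pi))).
- by move=> t _; rewrite derive1E; have [] := hF t.
Qed.

Lemma Rintegral_angles_cst (c : R) : \int[lebesgue_measure]_(t in @angles R) c = 2 * pi * c.
Proof.
have h t : is_derive t 1 (fun t => c * t) (cst c t).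
  by apply: (is_derive_eq (is_deriveZ c (is_derive_id t 1))); exact: mulr1.
by rewrite (Rintegral_FTC2 h); [rewrite mulr0 subr0 mulrC|move=> t; exact: cvg_cst].
Qed.

Lemma RintegralDZ (c d : R) (f g : R -> R) :
  (@lebesgue_measure R).-integrable (@angles R) (EFin \o f) ->
  (@lebesgue_measure R).-integrable (@angles R) (EFin \o g) ->
  \int[lebesgue_measure]_(t in @angles R) (c * f t + d * g t) =
  c * \int[lebesgue_measure]_(t in @angles R) f t + d * \int[lebesgue_measure]_(t in @angles R) g t.
Proof.
move=> hf hg.
have m := measurable_angles.
have Zi (e : R) (h : R -> R) : (@lebesgue_measure R).-integrable (@angles R) (EFin \o h) ->
   (@lebesgue_measure R).-integrable (@angles R) (EFin \o (fun t => e * h t)).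
  by move=> hh; apply: (integrableZl _ e hh); exact: measurable_itv.
by rewrite RintegralD// ?RintegralZl//; exact: Zi.
Qed.

Lemma circ_int_linr a w xi eta r (c d : R) : continuous_disk a w -> continuous xi ->
  continuous eta -> `|r| < a ->
  circ_int w (fun t => c * xi t + d * eta t) r = c * circ_int w xi r + d * circ_int w eta r.
Proof.
move=> cw cx ce ra; rewrite /circ_int -RintegralDZ; [|exact: (integrable_circ cw)|exact: (integrable_circ cw)].
by apply: eq_Rintegral => t _; ring.
Qed.

Lemma circ_int_linl a w v xi r (c d : R) : continuous_disk a w -> continuous_disk a v ->
  continuous xi -> `|r| < a ->
  circ_int (fun x => c * w x + d * v x) xi r = c * circ_int w xi r + d * circ_int v xi r.
Proof.
move=> cw cv cx ra; rewrite /circ_int -RintegralDZ; [|exact: (integrable_circ cw)|exact: (integrable_circ cv)].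
by apply: eq_Rintegral => t _; ring.
Qed.

Lemma C1_continuous_disk a w : C1_on (disk a) w ->
  [/\ continuous_disk a w, continuous_disk a ('D_(e1 R) w) & continuous_disk a ('D_(e2 R) w)].
Proof.
move=> hw; split=> x ax; first exact: (C1_continuous hw ax).
- by have [_ _ h _] := hw x ax; exact: h.
- by have [_ _ _ h] := hw x ax; exact: h.
Qed.

Lemma is_derive_circ_int a w xi r : C1_on (disk a) w -> continuous xi -> `|r| < a ->
  is_derive r 1 (circ_int w xi)
    (circ_int ('D_(e1 R) w) (fun t => cos t * xi t) r +
     circ_int ('D_(e2 R) w) (fun t => sin t * xi t) r).
Proof.
move=> hw cx ra; have [c0 c1 c2] := C1_continuous_disk hw.
(* On the compact disk of radius b both partial derivatives are bounded, which gives a dominating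
   function valid for all radii in ]-b, b[. *)
have [b /andP[rb ba]] : exists b, `|r| < b < a.
  by exists ((`|r| + a) / 2); apply/andP; split; lra.
have b0 : 0 <= b by rewrite (le_trans (normr_ge0 r))// ltW.
have b0a : 0 <= b < a by rewrite b0.
have [M1 M10 hM1] := closed_disk_bounded c1 b0a.
have [M2 M20 hM2] := closed_disk_bounded c2 b0a.
have inb (z : R) : `]-b, b[%classic z -> `|z| < b by rewrite /= in_itv /= ltr_norml.
have D (z t : R) : `|z| < a -> is_derive z 1 (fun z => w (polar z t) * xi t)
   (('D_(e1 R) w (polar z t) * cos t + 'D_(e2 R) w (polar z t) * sin t) * xi t).
  move=> za; have h := is_derive_polar_radius t hw za.
  rewrite (_ : (fun z => w (polar z t) * xi t) = xi t *: (fun z => w (polar z t))); last first.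
    by apply/funext => y; exact: mulrC.
  by apply: is_derive_eq; exact: mulrC.
have P (z t : R) : `|z| < a -> partial1of2 (fun z t => w (polar z t) * xi t) z t =
   ('D_(e1 R) w (polar z t) * cos t + 'D_(e2 R) w (polar z t) * sin t) * xi t.
  by move=> za; rewrite /partial1of2 derive1E; have [] := D z t za.
have := @cvg_differentiation_under_integral R _ _ lebesgue_measure
  (fun z t => w (polar z t) * xi t) (@angles R) measurable_angles r (- b) b.
move=> /(_ _ _ _ (fun t => (M1 + M2) * `|xi t|)) H.
apply/is_derive_quot.
have -> : circ_int ('D_(e1 R) w) (fun t => cos t * xi t) r +
     circ_int ('D_(e2 R) w) (fun t => sin t * xi t) r =
   \int[lebesgue_measure]_(y in @angles R) partial1of2 (fun z t => w (polar z t) * xi t) r y.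
  rewrite /circ_int -RintegralD//; first last.
  - by apply: (integrable_circ c2) => //; apply: continuousM => //; exact: continuous_sin.
  - by apply: (integrable_circ c1) => //; apply: continuousM => //; exact: continuous_cos.
  - exact: measurable_angles.
  by apply: eq_Rintegral => t _; rewrite P//; ring.
have E : (fun h => h^-1 * (circ_int w xi (r + h) - circ_int w xi r)) =
  (fun h => h^-1 *: ((fun x' : R => \int[lebesgue_measure]_(y in @angles R) (w (polar x' y) * xi y)) (h + r) -
 (fun x' : R => \int[lebesgue_measure]_(y in @angles R) (w (polar x' y) * xi y)) r)).
  by apply/funext => h; rewrite [r + h]addrC.
rewrite E; apply: H.
- by rewrite /= in_itv /= -ltr_norml.
- move=> z /inb zb; apply: (integrable_circ c0) => //; exact: lt_trans ba.
- by move=> z t /inb zb _; have [] := D z t (lt_trans zb ba).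
- by move=> t; rewrite mulr_ge0// addr_ge0.
- apply: integrable_angles => t; apply: cvgM; first exact: cvg_cst.
  by apply: cvg_norm; exact: cx.
- move=> z t /inb zb _; rewrite P ?(lt_trans zb ba)// normrM ler_wpM2r//.
  have zbd : closed_disk b (polar z t).
    by rewrite /closed_disk /= -/(polar z t) polar_norm2 -real_normK ?num_real// ler_sqr ?nnegrE// ltW.
  have H1 := hM1 _ zbd; have H2 := hM2 _ zbd.
  rewrite (le_trans (ler_normD _ _))// !normrM lerD//.
  + by rewrite -[leRHS]mulr1 ler_pM// cos_max.
  + by rewrite -[leRHS]mulr1 ler_pM// sin_max.
Qed.

(** The integrand is the derivative in t of w(r e^(it)) xi(t), and this product takes equal values
    at 0 and 2 pi. *)
Lemma circ_int_by_parts a w xi dxi r : C1_on (disk a) w -> `|r| < a ->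
  (forall t, is_derive t 1 xi (dxi t)) -> continuous dxi -> xi (2 * pi) = xi 0 ->
  r * circ_int ('D_(e2 R) w) (fun t => cos t * xi t) r
  - r * circ_int ('D_(e1 R) w) (fun t => sin t * xi t) r + circ_int w dxi r = 0.
Proof.
move=> hw ra hx cdx per; have [c0 c1 c2] := C1_continuous_disk hw.
have cx : continuous xi by move=> t; exact: (is_derive_continuous (hx t)).
have cc := @continuous_cos R; have cs := @continuous_sin R.
have i1 : (@lebesgue_measure R).-integrable (@angles R)
   (EFin \o (fun t => 'D_(e1 R) w (polar r t) * (sin t * xi t))).
  by apply: (integrable_circ c1) => //; exact: continuousM.
have i2 : (@lebesgue_measure R).-integrable (@angles R)
   (EFin \o (fun t => 'D_(e2 R) w (polar r t) * (cos t * xi t))).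
  by apply: (integrable_circ c2) => //; exact: continuousM.
have i0 : (@lebesgue_measure R).-integrable (@angles R)
   (EFin \o (fun t => w (polar r t) * dxi t)) by exact: (integrable_circ c0).
pose g t := r * ('D_(e2 R) w (polar r t) * (cos t * xi t)) +
   (- r) * ('D_(e1 R) w (polar r t) * (sin t * xi t)).
have cg : continuous g.
  have q1 := continuous_polar c1 ra; have q2 := continuous_polar c2 ra.
  move=> t; apply: cvgD; (apply: cvgM; first exact: cvg_cst).
    by apply: (continuousM q2 (continuousM cc cx)).
  by apply: (continuousM q1 (continuousM cs cx)).
have -> : r * circ_int ('D_(e2 R) w) (fun t => cos t * xi t) r
  - r * circ_int ('D_(e1 R) w) (fun t => sin t * xi t) r + circ_int w dxi r =
  \int[lebesgue_measure]_(t in @angles R) (g t + w (polar r t) * dxi t).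
  rewrite RintegralD//; [|exact: measurable_angles|exact: integrable_angles].
  by rewrite RintegralDZ// mulNr.
have F t : is_derive t 1 (fun t => w (polar r t) * xi t) (g t + w (polar r t) * dxi t).
  have h1 := is_derive_polar_angle t hw ra; have h2 := hx t.
  apply: is_derive_eq; rewrite /g /GRing.scale /=; ring.
rewrite (Rintegral_FTC2 F); first by rewrite per polar2pi subrr.
move=> t; apply: cvgD; first exact: cg.
exact: (continuousM (continuous_polar c0 ra) cdx).
Qed.

Lemma eq_circ_int a w v xi eta r : (forall x, disk a x -> w x = v x) -> xi =1 eta -> `|r| < a ->
  circ_int w xi r = circ_int v eta r.
Proof.
move=> h1 h2 ra; apply: eq_Rintegral => t _.
by rewrite h2 h1//; exact: polar_disk.
Qed.

(** Here m is the square of the order. The equation is posed on |r| < a, negative r included, since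
    [polar r t] still lies in the disk. Thus 0 is an interior point, and two derivatives there
    express the regularity that rules out solutions of the second kind. *)
Definition bessel_ode k m a (U dU ddU : R -> R) : Prop :=
  [/\ forall r, `|r| < a -> is_derive r 1 U (dU r),
     forall r, `|r| < a -> is_derive r 1 dU (ddU r) &
     forall r, `|r| < a ->
       r ^+ 2 * ddU r + r * dU r + (k ^+ 2 * r ^+ 2 - m) * U r = 0].

(** E1 comes from integrating w by parts against xi', E2 and E3 from its two partial derivatives
    against sin t xi and cos t xi, and L is the Helmholtz equation integrated against xi. The
    conclusion is E1 + r E2 - r E3 + r^2 L. *)
Let helm_algebra (r k m U y1 y1' y2 y2' x1 x1' x2 x2' x3 x3' x4 x4' z1 z4 : R) :
  r * y2' - r * y1' + (- m * U + 0 * U) = 0 ->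
  r * x2' - r * x1' + (1 * y1 + 1 * y1') = 0 ->
  r * x4' - r * x3' + (-1 * y2 + 1 * y2') = 0 ->
  x1 + x1' = z1 -> x4' + x4 = z4 -> z1 + z4 + k ^+ 2 * U = 0 -> x2 = x2' -> x3 = x3' ->
  r ^+ 2 * (x1 + x2 + (x3 + x4)) + r * (y1 + y2) + (k ^+ 2 * r ^+ 2 - m) * U = 0.
Proof.
move=> E1 E2 E3 <- <- L -> ->.
transitivity ((r * y2' - r * y1' + (- m * U + 0 * U))
  + r * (r * x2' - r * x1' + (1 * y1 + 1 * y1'))
  - r * (r * x4' - r * x3' + (-1 * y2 + 1 * y2'))
  + r ^+ 2 * (x1 + x1' + (x4' + x4) + k ^+ 2 * U)); first by ring.
by rewrite E1 E2 E3 L; ring.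
Qed.

Let lin_algebra (A B C k : R) :
  (A + B + k ^+ 2 * C = 0 -> 1 * A + 1 * B = - k ^+ 2 * C + 0 * C) /\
  (1 * A + 1 * B = - k ^+ 2 * C + 0 * C -> A + B + k ^+ 2 * C = 0).
Proof.
by split; lra.
Qed.

(** Separation of variables without the polar form of the Laplacian: integration by parts moves the
    angular derivatives onto xi, where xi'' = -m xi. *)
Lemma circ_int_helmholtz k a (m : R) w xi (dxi : R -> R) : C2_on (disk a) w ->
  (forall x, disk a x -> laplacian w x + k ^+ 2 * w x = 0) ->
  (forall t, is_derive t 1 xi (dxi t)) -> (forall t, is_derive t 1 dxi (- m * xi t)) ->
  xi (2 * pi) = xi 0 -> dxi (2 * pi) = dxi 0 ->
  exists dU ddU, bessel_ode k m a (circ_int w xi) dU ddU.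
Proof.
move=> [hw hw1 hw2] hlap hx hdx per dper.
have [c0 c1 c2] := C1_continuous_disk hw.
have [_ c11 c21] := C1_continuous_disk hw1.
have [_ c12 c22] := C1_continuous_disk hw2.
have cc := @continuous_cos R; have cs := @continuous_sin R.
have cx : continuous xi by move=> t; exact: (is_derive_continuous (hx t)).
have cdx : continuous dxi by move=> t; exact: (is_derive_continuous (hdx t)).
have ccx := continuousM cc cx; have csx := continuousM cs cx.
have ccdx := continuousM cc cdx; have csdx := continuousM cs cdx.
have cccx := continuousM cc ccx; have cssx := continuousM cs csx.
pose D1 := 'D_(e1 R) w; pose D2 := 'D_(e2 R) w.
pose D11 := 'D_(e1 R) D1; pose D21 := 'D_(e2 R) D1.
pose D12 := 'D_(e1 R) D2; pose D22 := 'D_(e2 R) D2.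
exists (fun r => circ_int D1 (fun t => cos t * xi t) r + circ_int D2 (fun t => sin t * xi t) r).
exists (fun r => circ_int D11 (fun t => cos t * (cos t * xi t)) r
  + circ_int D21 (fun t => sin t * (cos t * xi t)) r
  + (circ_int D12 (fun t => cos t * (sin t * xi t)) r
  + circ_int D22 (fun t => sin t * (sin t * xi t)) r)).
split=> r ra.
- exact: (is_derive_circ_int hw cx ra).
- exact: (is_deriveD (is_derive_circ_int hw1 ccx ra) (is_derive_circ_int hw2 csx ra)).
have dsx t : is_derive t 1 (fun t => sin t * xi t) (1 * (cos t * xi t) + 1 * (sin t * dxi t)).
  have h := hx t; apply: is_derive_eq; rewrite /GRing.scale /=; ring.
have dcx t : is_derive t 1 (fun t => cos t * xi t) ((-1) * (sin t * xi t) + 1 * (cos t * dxi t)).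
  have h := hx t; apply: is_derive_eq; rewrite /GRing.scale /=; ring.
have cl (p q : R) (f g : R -> R) : continuous f -> continuous g -> continuous (fun t => p * f t + q * g t).
  by move=> cf cg t; apply: cvgD; apply: cvgM; (exact: cvg_cst || exact: cf || exact: cg).
have dcx2 t : is_derive t 1 dxi (- m * xi t + 0 * xi t).
  by apply: (is_derive_eq (hdx t)); rewrite mul0r addr0.
have sper : sin (2 * pi) * xi (2 * pi) = sin 0 * xi 0.
  by rewrite mulr_natl sin2pi sin0 !mul0r.
have cper : cos (2 * pi) * xi (2 * pi) = cos 0 * xi 0.
  by rewrite -per mulr_natl cos2pi cos0.
have := circ_int_by_parts hw ra dcx2 (cl _ _ _ _ cx cx) dper.
have := circ_int_by_parts hw1 ra dsx (cl _ _ _ _ ccx csdx) sper.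
have := circ_int_by_parts hw2 ra dcx (cl _ _ _ _ csx ccdx) cper.
rewrite (circ_int_linr _ _ c0 cx cx ra) (circ_int_linr _ _ c1 ccx csdx ra).
rewrite (circ_int_linr _ _ c2 csx ccdx ra) => E3 E2 E1.
have P (f : R * R -> R) : continuous_disk a f -> circ_int f (fun t => cos t * (cos t * xi t)) r +
   circ_int f (fun t => sin t * (sin t * xi t)) r = circ_int f xi r.
  move=> cf; have := @circ_int_linr a f _ _ r 1 1 cf cccx cssx ra; rewrite !mul1r => <-.
  apply: (@eq_circ_int a) => // t.
  by rewrite !mul1r !mulrA -mulrDl -!expr2 cos2Dsin2 mul1r.
have L : circ_int D11 xi r + circ_int D22 xi r + k ^+ 2 * circ_int w xi r = 0.
  have h1 := @circ_int_linl a D11 D22 xi r 1 1 c11 c22 cx ra.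
  have h2 := @circ_int_linl a w w xi r (- k ^+ 2) 0 c0 c0 cx ra.
  have h3 : circ_int (fun x => 1 * D11 x + 1 * D22 x) xi r =
      circ_int (fun x => - k ^+ 2 * w x + 0 * w x) xi r.
    apply: (@eq_circ_int a) => // x ax.
    have hl : D11 x + D22 x + k ^+ 2 * w x = 0 := hlap x ax.
    exact: (lin_algebra _ _ _ _).1 hl.
  exact: (lin_algebra _ _ _ _).2 (etrans (esym h1) (etrans h3 h2)).
have S1 : circ_int D21 (fun t => sin t * (cos t * xi t)) r = circ_int D21 (fun t => cos t * (sin t * xi t)) r.
  by apply: (@eq_circ_int a) => // t; rewrite mulrCA.
have S2 : circ_int D12 (fun t => cos t * (sin t * xi t)) r = circ_int D12 (fun t => sin t * (cos t * xi t)) r.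
  by apply: (@eq_circ_int a) => // t; rewrite mulrCA.
exact: (helm_algebra E1 E2 E3 (P _ c11) (P _ c22) L S1 S2).
Qed.

End CircleIntegrals.

(** * Uniqueness, up to a factor, of solutions of the Bessel equation regular at 0 *)

Section BesselODE.
Variable R : realType.
Implicit Types (a r : R).

(** To the right of r0 the product of E with exp(-K s) cannot grow, and to the left the product with
    exp(K s) cannot grow as s decreases; both start from 0 at r0, and E is nonnegative. *)
Lemma gronwall_zero (E dE : R -> R) (K r0 r1 r2 : R) :
  (forall r, r1 <= r <= r2 -> is_derive r 1 E (dE r)) ->
  (forall r, r1 <= r <= r2 -> 0 <= E r) ->
  (forall r, r1 <= r <= r2 -> `|dE r| <= K * E r) -> r1 <= r0 <= r2 -> E r0 = 0 ->
  forall r, r1 <= r <= r2 -> E r = 0.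
Proof.
move=> dEP E0 besselE r012 Er0 r r12.
have D (c s : R) : r1 <= s <= r2 ->
    is_derive s 1 (fun s => E s * expR (c * s)) ((dE s + c * E s) * expR (c * s)).
  move=> h; have h1 := dEP s h.
  have h3 : is_derive s 1 (fun s : R => c * s) c by apply: is_derive_eq; exact: mulr1.
  have h2 : is_derive s 1 (fun s => expR (c * s)) (expR (c * s) * c).
    exact: (@is_derive1_comp R expR (fun s => c * s) s _ _ (is_derive_expR _) h3).
  by apply: is_derive_eq; rewrite /GRing.scale /=; ring.
have key (c x y : R) : x <= y -> r1 <= x -> y <= r2 -> exists2 s, r1 <= s <= r2 &
   E y * expR (c * y) - E x * expR (c * x) = (dE s + c * E s) * expR (c * s) * (y - x).
  move=> xy x1 y2.
  have itv z : z \in `[x, y] -> r1 <= z <= r2.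
    by rewrite in_itv /= => /andP[h1 h2]; rewrite (le_trans x1 h1) (le_trans h2 y2).
  have [||s s1 ->] := @MVT_segment R (fun s => E s * expR (c * s))
    (fun s => (dE s + c * E s) * expR (c * s)) x y xy.
  - by move=> s hs; apply/D/itv/subset_itv_oo_cc.
  - by apply: derivable_within_continuous => z /itv hz; have [] := D c z hz.
  by exists s => //; exact: itv.
have [/andP[a1 a2] /andP[b1 b2]] := (r012, r12).
suff : E r <= 0 by move=> h; apply/eqP; rewrite eq_le h E0.
have [h|h] := leP r0 r.
  have [s s1 Es] := key (- K) r0 r h a1 b2.
  have : E r * expR (- K * r) <= 0.
    rewrite Er0 mul0r subr0 in Es; rewrite Es mulr_le0_ge0 ?subr_ge0//.
    rewrite mulr_le0_ge0 ?expR_ge0//.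
    by have := besselE s s1; have := ler_norm (dE s); lra.
  by rewrite pmulr_lle0 ?expR_gt0.
have [s s1 Es] := key K r r0 (ltW h) b1 a2.
have : 0 <= - (E r * expR (K * r)).
  rewrite Er0 mul0r sub0r in Es; rewrite Es mulr_ge0 ?subr_ge0 ?(ltW h)//.
  rewrite mulr_ge0 ?expR_ge0//.
  by have := besselE s s1; have := ler_norm (- dE s); rewrite normrN; lra.
by rewrite oppr_ge0 pmulr_lle0 ?expR_gt0.
Qed.

(* The Wronskian r (U' V - U V') is constant and vanishes at r = 0, so U is a multiple of V as long
   as V > 0; an energy estimate for the difference carries this past the zeros of V. *)
Lemma bessel_ode_unique (k m a d : R) (U dU ddU V dV ddV : R -> R) : 0 < a -> 0 < d ->
  bessel_ode k m a U dU ddU -> bessel_ode k m a V dV ddV ->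
  (forall r, 0 < r < d -> 0 < V r) ->
  exists c, forall r, 0 <= r < a -> U r = c * V r.
Proof.
move=> a0 d0 [U1 U2 U3] [V1 V2 V3] Vpos.
have inA r : 0 <= r -> r < a -> `|r| < a by move=> r0; rewrite ger0_norm.
have wr r : 0 < r < a -> dU r * V r = U r * dV r.
  move=> /andP[r0 ra].
  pose W r := r * (dU r * V r - U r * dV r).
  pose dW r := dU r * V r - U r * dV r + r * (ddU r * V r - U r * ddV r).
  have D (s : R) : `|s| < a -> is_derive s 1 W (dW s).
    move=> sa; have h1 := U1 s sa; have h2 := U2 s sa; have h3 := V1 s sa; have h4 := V2 s sa.
    have h5 : is_derive s 1 (id * (dU * V - U * dV)) (dW s).
      have e : (dU * V - U * dV) s = dU s * V s - U s * dV s by [].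
      by apply: is_derive_eq; rewrite e /dW /GRing.scale /=; ring.
    exact: h5.
  have sub s : s \in `[0, r] -> `|s| < a.
    by rewrite in_itv /= => /andP[h1 h2]; rewrite inA// (le_lt_trans h2).
  have [||s] := @MVT R W dW 0 r r0.
  - by move=> s hs; apply: D; apply: sub; apply: subset_itv_oo_cc.
  - by apply: derivable_within_continuous => s hs; have [] := D s (sub s hs).
  rewrite in_itv /= => /andP[s0 sr]; rewrite /W mul0r !subr0.
  have sa : `|s| < a by rewrite inA ?(lt_trans sr)// ltW.
  have -> : dW s = 0.
    apply: (@mulfI _ s); first by rewrite gt_eqF.
    rewrite mulr0 /dW.
    transitivity ((s ^+ 2 * ddU s + s * dU s + (k ^+ 2 * s ^+ 2 - m) * U s) * V s -
      U s * (s ^+ 2 * ddV s + s * dV s + (k ^+ 2 * s ^+ 2 - m) * V s)); first by ring.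
    by rewrite U3// V3// mul0r mulr0 subr0.
  rewrite mul0r => /eqP; rewrite mulf_eq0 gt_eqF//= subr_eq0 => /eqP; exact.
(* At this radius V is positive, so c can be chosen to make U - c V vanish; the Wronskian relation
   then makes its derivative vanish as well. *)
pose r0 := Num.min d a / 2.
have r00 : 0 < r0 by rewrite divr_gt0// lt_min d0.
have r0m : r0 < Num.min d a.
  by rewrite ltr_pdivrMr// ltr_pMr ?ltr1n// lt_min d0.
have [r0d r0a] : r0 < d /\ r0 < a by move: r0m; rewrite lt_min => /andP[].
have V0 : 0 < V r0 by apply: Vpos; rewrite r00.
pose c := U r0 / V r0; exists c.
pose D r := U r - c * V r; pose dD r := dU r - c * dV r; pose ddD r := ddU r - c * ddV r.
have D1 (r : R) : `|r| < a -> is_derive r 1 D (dD r).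
  by move=> ra; exact: (is_deriveB (U1 r ra) (is_deriveZ c (V1 r ra))).
have D2 (r : R) : `|r| < a -> is_derive r 1 dD (ddD r).
  by move=> ra; exact: (is_deriveB (U2 r ra) (is_deriveZ c (V2 r ra))).
have D3 (r : R) : `|r| < a -> r ^+ 2 * ddD r + r * dD r + (k ^+ 2 * r ^+ 2 - m) * D r = 0.
  move=> ra; transitivity ((r ^+ 2 * ddU r + r * dU r + (k ^+ 2 * r ^+ 2 - m) * U r) -
    c * (r ^+ 2 * ddV r + r * dV r + (k ^+ 2 * r ^+ 2 - m) * V r)); first by rewrite /ddD /dD /D; ring.
  by rewrite U3// V3// mulr0 subr0.
have Dr0 : D r0 = 0 by rewrite /D /c divfK ?subrr// gt_eqF.
have dDr0 : dD r0 = 0.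
  rewrite /dD /c; apply: (@mulIf _ (V r0)); first by rewrite gt_eqF.
  by rewrite mul0r mulrBl wr ?r00//; field; rewrite gt_eqF.
have pos r : 0 < r < a -> D r = 0.
  move=> /andP[rp ra].
  pose r1 := Num.min r r0; pose r2 := Num.max r r0.
  have r10 : 0 < r1 by rewrite lt_min rp.
  have r2a : r2 < a by rewrite gt_max ra.
  have sub s : r1 <= s <= r2 -> 0 < s /\ `|s| < a.
    move=> /andP[h1 h2]; have s0 := lt_le_trans r10 h1; split => //.
    by rewrite inA ?(ltW s0)// (le_lt_trans h2).
  pose Q := k ^+ 2 + `|m| / r1 ^+ 2; pose P := r1^-1.
  have := @gronwall_zero (fun r => D r ^+ 2 + dD r ^+ 2)
    (fun r => 2 * D r * dD r + 2 * dD r * ddD r) (1 + Q + 2 * P) r0 r1 r2.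
  move=> /(_ _ _ _ _ _ r) H.
  suff /eqP : D r ^+ 2 + dD r ^+ 2 = 0.
    by rewrite paddr_eq0 ?sqr_ge0// sqrf_eq0 => /andP[/eqP].
  apply: H.
  - move=> s /sub[s0 sa]; have h1 := D1 s sa; have h2 := D2 s sa.
    have h5 : is_derive s 1 (D ^+ 2 + dD ^+ 2) (2 * D s * dD s + 2 * dD s * ddD s).
      by apply: is_derive_eq; rewrite /GRing.scale /= !expr1; ring.
    exact: h5.
  - by move=> s _; rewrite addr_ge0 ?sqr_ge0.
  - move=> s hs; have [s0 sa] := sub s hs.
    have r1s : r1 <= s by case/andP: hs.
    pose p := s^-1; pose q := k ^+ 2 - m * p ^+ 2.
    have -> : ddD s = - p * dD s - q * D s.
      apply: (@mulfI _ (s ^+ 2)); first by rewrite sqrf_eq0 gt_eqF.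
      have := D3 s sa; rewrite -addrA => /eqP; rewrite addr_eq0 => /eqP ->.
      by rewrite /q /p; field; rewrite gt_eqF.
    have p0 : 0 <= p by rewrite invr_ge0 ltW.
    have pP : p <= P by rewrite lef_pV2 ?posrE.
    have qQ : `|q| <= Q.
      rewrite (le_trans (ler_normB _ _))// ger0_norm ?sqr_ge0// lerD2l normrM.
      rewrite ler_wpM2l// ger0_norm ?sqr_ge0// -exprVn -/P ler_sqr ?nnegrE//.
      by rewrite (le_trans p0).
    move: (D s) (dD s) => x y; move: qQ p0 pP; rewrite ler_norml => /andP[q1 q2] p0 pP.
    have Q0 : 0 <= Q by lra.
    have xy1 : 2 * x * y <= x ^+ 2 + y ^+ 2 by have := sqr_ge0 (x - y); lra.
    have xy2 : - (2 * x * y) <= x ^+ 2 + y ^+ 2 by have := sqr_ge0 (x + y); lra.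
    have -> : 2 * x * y + 2 * y * (- p * y - q * x) = (2 * x * y) * (1 - q) - 2 * p * y ^+ 2 by ring.
    have x20 := sqr_ge0 x; have y20 := sqr_ge0 y.
    move: (x ^+ 2) (y ^+ 2) x20 y20 xy1 xy2 => X Y X0 Y0.
    move: (2 * x * y) => Z Z1 Z2.
    have h1 : `|Z * (1 - q)| <= (X + Y) * (1 + Q).
      rewrite normrM ler_pM//; first by rewrite ler_norml; apply/andP; split; lra.
      by rewrite ler_norml; apply/andP; split; lra.
    have h2 : `|2 * p * Y| <= 2 * P * (X + Y).
      by rewrite ger0_norm ?mulr_ge0// ler_pM ?mulr_ge0// ?ler_pM2l//; lra.
    rewrite (le_trans (ler_normB _ _))//; lra.
  - by rewrite /r1 /r2 ge_min lexx orbT le_max lexx orbT.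
  - by rewrite Dr0 dDr0 expr0n addr0.
  - by rewrite /r1 /r2 ge_min lexx le_max lexx.
move=> r /andP[r0' ra]; apply/eqP; rewrite -subr_eq0; apply/eqP; rewrite -/(D r).
(* The equation degenerates at r = 0, where the identity follows from continuity from the right. *)
move: r0'; rewrite le_eqVlt => /orP[/eqP <-|r0']; last by apply: pos; rewrite r0'.
have c1 : D x @[x --> 0^'+] --> D 0.
  apply: cvg_at_right_filter; apply: (is_derive_continuous (D1 0 _)).
  by rewrite normr0.
have c2 : D x @[x --> 0^'+] --> (0 : R).
  apply: cvg_near_cst; near=> x; apply: pos; apply/andP; split.
    by near: x; exact: nbhs_right_gt.
  by near: x; exact: nbhs_right_lt.
by rewrite -(cvg_lim _ c1)// (cvg_lim _ c2).
Unshelve. all: by end_near.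
Qed.

End BesselODE.

(** * Real and imaginary parts under the complex operations *)

Section ComplexParts.
Variable R : rcfType.
Implicit Types x y : R[i].

Lemma ReM x y : complex.Re (x * y) = complex.Re x * complex.Re y - complex.Im x * complex.Im y.
Proof.
by case: x y => [a b] [c d].
Qed.

Lemma ImM x y : complex.Im (x * y) = complex.Re x * complex.Im y + complex.Im x * complex.Re y.
Proof.
by case: x y => [a b] [c d] /=; rewrite [b * c]mulrC.
Qed.

Lemma ReD x y : complex.Re (x + y) = complex.Re x + complex.Re y.
Proof.
by case: x y => [a b] [c d].
Qed.

Lemma ImD x y : complex.Im (x + y) = complex.Im x + complex.Im y.
Proof.
by case: x y => [a b] [c d].
Qed.

Lemma ReN x : complex.Re (- x) = - complex.Re x.
Proof.
by case: x.
Qed.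

Lemma ImN x : complex.Im (- x) = - complex.Im x.
Proof.
by case: x.
Qed.

Lemma complexP x y : complex.Re x = complex.Re y -> complex.Im x = complex.Im y -> x = y.
Proof.
by case: x y => [a b] [c d] /= -> ->.
Qed.

End ComplexParts.

(** * Fourier coefficients of Helmholtz solutions on circles *)

Section HelmholtzModes.
Variable R : realType.
Implicit Types (k a r t : R) (w : R * R -> R).

Lemma cos_sin_2pi_int (m : int) :
  cos (m%:~R * (2 * pi)) = 1 :> R /\ sin (m%:~R * (2 * pi)) = 0 :> R.
Proof.
have H n : cos (n%:R * (2 * pi)) = 1 :> R /\ sin (n%:R * (2 * pi)) = 0 :> R.
  elim: n => [|n [IH1 IH2]]; first by rewrite mul0r cos0 sin0.
  by rewrite -natr1 mulrDl mul1r cosD sinD IH1 IH2 mulr_natl cos2pi sin2pi; split; ring.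
case: m => n; first by rewrite -pmulrn; exact: H.
by rewrite NegzE mulrNz mulNr cosN sinN -pmulrn; have [-> ->] := H n.+1; rewrite oppr0.
Qed.

Lemma is_derive_cosM (c t : R) : is_derive t 1 (fun t => cos (c * t)) (- c * sin (c * t)) /\
  is_derive t 1 (fun t => sin (c * t)) (c * cos (c * t)).
Proof.
have h3 : is_derive t 1 (fun s : R => c * s) c by apply: is_derive_eq; exact: mulr1.
split.
  have h := @is_derive1_comp R cos (fun s => c * s) t _ _ (is_derive_cos _) h3.
  by apply: (is_derive_eq h); ring.
have h := @is_derive1_comp R sin (fun s => c * s) t _ _ (is_derive_sin _) h3.
by apply: (is_derive_eq h); ring.
Qed.

Lemma bessel_ode_circ_int_trig k a w (m : int) : C2_on (disk a) w ->
  (forall x, disk a x -> laplacian w x + k ^+ 2 * w x = 0) ->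
  (exists dU ddU, bessel_ode k (m%:~R ^+ 2) a (circ_int w (fun t => cos (m%:~R * t))) dU ddU) /\
  (exists dU ddU, bessel_ode k (m%:~R ^+ 2) a (circ_int w (fun t => sin (m%:~R * t))) dU ddU).
Proof.
move=> hw hl; have [c2 s2] := cos_sin_2pi_int m.
pose c : R := m%:~R; rewrite -/c in c2 s2 *.
have d1 t := (is_derive_cosM c t).1; have d2 t := (is_derive_cosM c t).2.
split.
  apply: (@circ_int_helmholtz _ k a _ w _ (fun t => - c * sin (c * t))) => //.
  - by move=> t; apply: (is_derive_eq (is_deriveZ (- c) (d2 t))); rewrite /GRing.scale /=; ring.
  - by rewrite c2 mulr0 cos0.
  - by rewrite s2 [c * 0]mulr0 sin0.
apply: (@circ_int_helmholtz _ k a _ w _ (fun t => c * cos (c * t))) => //.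
- by move=> t; apply: (is_derive_eq (is_deriveZ c (d1 t))); rewrite /GRing.scale /=; ring.
- by rewrite s2 mulr0 sin0.
- by rewrite c2 [c * 0]mulr0 cos0.
Qed.

Lemma C1_on_setT (A : set (R * R)) w : C1_on setT w -> C1_on A w.
Proof.
by move=> h x _; exact: h.
Qed.

Lemma C2_on_setT (A : set (R * R)) w : C2_on setT w -> C2_on A w.
Proof.
by move=> [h1 h2 h3]; split; exact: C1_on_setT.
Qed.

Lemma bessel_odeD k m a (U dU ddU V dV ddV : R -> R) :
  bessel_ode k m a U dU ddU -> bessel_ode k m a V dV ddV ->
  bessel_ode k m a (fun r => U r + V r) (fun r => dU r + dV r) (fun r => ddU r + ddV r).
Proof.
move=> [U1 U2 U3] [V1 V2 V3]; split=> r ra.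
- exact: (is_deriveD (U1 r ra) (V1 r ra)).
- exact: (is_deriveD (U2 r ra) (V2 r ra)).
- have := U3 r ra; have := V3 r ra => E1 E2.
  transitivity ((r ^+ 2 * ddU r + r * dU r + (k ^+ 2 * r ^+ 2 - m) * U r) +
    (r ^+ 2 * ddV r + r * dV r + (k ^+ 2 * r ^+ 2 - m) * V r)); first by ring.
  by rewrite E1 E2 addr0.
Qed.

(* Since [wave_re k n] and [wave_im k n] solve the Helmholtz equation, their Fourier coefficients
   yield the Bessel equation for J_n without differentiating the series again. *)
Lemma bessel_ode_besselJ k a (n : nat) : 0 < a -> exists dV ddV,
  bessel_ode k ((n%:Z)%:~R ^+ 2) a (fun r => 2 * pi * besselJ_nat n (k * r)) dV ddV.
Proof.
move=> a0.
have [/entire_helmE[h1 l1] /entire_helmE[h2 l2]] := entire_helm_wave k n%:Z.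
have [|[dU [ddU HU]] _] := @bessel_ode_circ_int_trig k a _ n (C2_on_setT (disk a) h1).
  by move=> x _; rewrite l1 mulNr addNr.
have [|_ [dV [ddV HV]]] := @bessel_ode_circ_int_trig k a _ n (C2_on_setT (disk a) h2).
  by move=> x _; rewrite l2 mulNr addNr.
have := bessel_odeD HU HV.
set f := (fun r => _) => H; exists (fun r => dU r + dV r), (fun r => ddU r + ddV r).
rewrite (_ : (fun r => _) = f)//; apply/funext => r; rewrite /f /circ_int.
have [cc cs] : continuous (fun t : R => cos (n%:Z%:~R * t)) /\ continuous (fun t : R => sin (n%:Z%:~R * t)).
  by split => t; [have := (is_derive_cosM n%:Z%:~R t).1|have := (is_derive_cosM n%:Z%:~R t).2];
    move/is_derive_continuous.
have ra : `|r| < `|r| + 1 by rewrite ltrDl.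
have [c1 c2] := continuous_wave k (n%:Z).
have i1 : (@lebesgue_measure R).-integrable (@angles R)
   (EFin \o (fun t => wave_re k n (polar r t) * cos (n%:Z%:~R * t))).
  by apply: (integrable_circ _ cc ra) => x _; exact: c1.
have i2 : (@lebesgue_measure R).-integrable (@angles R)
   (EFin \o (fun t => wave_im k n (polar r t) * sin (n%:Z%:~R * t))).
  by apply: (integrable_circ _ cs ra) => x _; exact: c2.
have := RintegralDZ 1 1 i1 i2; rewrite !mul1r => <-.
rewrite -Rintegral_angles_cst.
apply: eq_Rintegral => t _; have [-> ->] := wave_polar k n r t.
rewrite !mul1r /= -!mulrA -!expr2 -mulrDr cos2Dsin2 mulr1; reflexivity.
Qed.

Lemma circ_int_besselJ k a w (m : int) : 0 < k -> 0 < a -> C2_on (disk a) w ->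
  (forall x, disk a x -> laplacian w x + k ^+ 2 * w x = 0) ->
  (exists c, forall r, 0 <= r < a -> circ_int w (fun t => cos (m%:~R * t)) r = c * besselJ m (k * r)) /\
  (exists c, forall r, 0 <= r < a -> circ_int w (fun t => sin (m%:~R * t)) r = c * besselJ m (k * r)).
Proof.
move=> k0 a0 hw hl.
have [[dU [ddU HU]] [dV [ddV HV]]] := bessel_ode_circ_int_trig m hw hl.
pose n := `|m|%N.
have [dJ [ddJ HJ]] := @bessel_ode_besselJ k a n a0.
have Em : (n%:Z)%:~R ^+ 2 = m%:~R ^+ 2 :> R.
  by rewrite /n; case: (m) => p //; rewrite NegzE mulrNz sqrrN.
rewrite Em in HJ.
have [d d0 dpos] := @besselJ_nat_small R n.
(* The comparison with J_n requires a solution that is positive on some interval ]0, d / k[. *)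
have Jpos r : 0 < r < d / k -> 0 < 2 * pi * besselJ_nat n (k * r).
  move=> /andP[r0 rd]; rewrite !mulr_gt0 ?pi_gt0// dpos// mulr_gt0//=.
  by rewrite mulrC -ltr_pdivlMr.
have dk0 : 0 < d / k by rewrite divr_gt0.
have [c hc] := bessel_ode_unique a0 dk0 HU HJ Jpos.
have [c' hc'] := bessel_ode_unique a0 dk0 HV HJ Jpos.
(* The orders m and -m share one equation; e is the sign in J_(-p) = (-1)^p J_p. *)
have [e eE] : exists e : R, forall x, e * besselJ m x = besselJ_nat n x.
  rewrite /n; case: (m) => p; first by exists 1 => x; rewrite mul1r.
  by exists ((-1) ^+ p.+1) => x /=; rewrite mulrA -exprD addnn -mul2n exprM sqrrN !expr1n mul1r.
split; [exists (c * (2 * pi) * e)|exists (c' * (2 * pi) * e)] => r ra.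
  by rewrite hc// -eE; ring.
by rewrite hc'// -eE; ring.
Qed.

Lemma fourier_coefE (f : R -> R[i]) (m : int) : fourier_coef f m =
  ((2 * pi)^-1)%:C * (
   (\int[lebesgue_measure]_(t in @angles R)
     (complex.Re (f t) * cos (m%:~R * t) + complex.Im (f t) * sin (m%:~R * t))) +i*
   (\int[lebesgue_measure]_(t in @angles R)
     (complex.Im (f t) * cos (m%:~R * t) - complex.Re (f t) * sin (m%:~R * t)))).
Proof.
rewrite /fourier_coef; congr (_ * _); congr Complex; apply: eq_Rintegral => t _;
  rewrite ?ReM ?ImM /expi /= cosN sinN; ring.
Qed.

Lemma fourier_coef_helmholtz k a (u : R * R -> R[i]) : 0 < k -> 0 < a -> helmholtz k a u ->
  exists c : int -> R[i], forall m r, 0 <= r < a ->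
    fourier_coef (fun t => u (polar r t)) m = c m * (besselJ m (k * r))%:C.
Proof.
move=> k0 a0 [[h1 h2] hl]; suff /choice[c hc] : forall m : int, exists c, forall r, 0 <= r < a ->
    fourier_coef (fun t => u (polar r t)) m = c * (besselJ m (k * r))%:C by exists c.
move=> m.
have l1 x : disk a x -> laplacian (fun x => complex.Re (u x)) x + k ^+ 2 * complex.Re (u x) = 0.
  by move=> /hl /(congr1 (@complex.Re R)); rewrite ReD ReM /= mul0r subr0.
have l2 x : disk a x -> laplacian (fun x => complex.Im (u x)) x + k ^+ 2 * complex.Im (u x) = 0.
  by move=> /hl /(congr1 (@complex.Im R)); rewrite ImD ImM /= mul0r addr0.
have [[c1 C1] [c2 C2]] := circ_int_besselJ m k0 a0 h1 l1.
have [[c3 C3] [c4 C4]] := circ_int_besselJ m k0 a0 h2 l2.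
exists (((2 * pi)^-1)%:C * ((c1 + c4) +i* (c3 - c2))) => r ra.
rewrite fourier_coefE -mulrA; congr (_ * _).
have ra' : `|r| < a by case/andP: ra => r0 ra; rewrite ger0_norm.
have [cc cs] : continuous (fun t : R => cos (m%:~R * t)) /\ continuous (fun t : R => sin (m%:~R * t)).
  by split => t; [have := (is_derive_cosM m%:~R t).1|have := (is_derive_cosM m%:~R t).2];
    move/is_derive_continuous.
have [cr _ _] := C1_continuous_disk (let: And3 h _ _ := h1 in h).
have [ci _ _] := C1_continuous_disk (let: And3 h _ _ := h2 in h).
have E1 := RintegralDZ 1 1 (integrable_circ cr cc ra') (integrable_circ ci cs ra').
have E2 := RintegralDZ 1 (-1) (integrable_circ ci cc ra') (integrable_circ cr cs ra').
apply: complexP; rewrite ?ReM ?ImM /= ?mulr0 ?subr0 ?addr0 ?add0r.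
  rewrite mulrDl -C1// -C4//; move: E1; rewrite !mul1r => <-.
  by apply: eq_Rintegral => t _; rewrite !mul1r.
rewrite mulrBl -C2// -C3//; move: E2; rewrite !mul1r mulN1r => <-.
by apply: eq_Rintegral => t _; rewrite mul1r mulN1r.
Qed.

End HelmholtzModes.

(** * Square-integrable complex functions of the angle *)

Section SquareIntegrable.
Variable R : realType.
Implicit Types (f g : R -> R[i]) (b z : R[i]).

Definition nsq z : R := complex.Re z ^+ 2 + complex.Im z ^+ 2.

Lemma normc_sq z : ComplexField.Normc.normc z ^+ 2 = nsq z.
Proof.
by case: z => x y; rewrite /= sqr_sqrtr// addr_ge0// sqr_ge0.
Qed.

Lemma nsq_ge0 z : 0 <= nsq z.
Proof.
by rewrite addr_ge0// sqr_ge0.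
Qed.

Lemma nsqM (y z : R[i]) : nsq (y * z) = nsq y * nsq z.
Proof.
by rewrite /nsq ReM ImM; ring.
Qed.

Lemma nsqN z : nsq (- z) = nsq z.
Proof.
by rewrite /nsq ReN ImN !sqrrN.
Qed.

Lemma nsqD_le (y z : R[i]) : nsq (y + z) <= 2 * nsq y + 2 * nsq z.
Proof.
rewrite /nsq ReD ImD.
have := sqr_ge0 (complex.Re y - complex.Re z); have := sqr_ge0 (complex.Im y - complex.Im z).
by move: (complex.Re y) (complex.Re z) (complex.Im y) (complex.Im z) => p q r s; lra.
Qed.

Lemma nsq_eq0 z : nsq z = 0 -> z = 0.
Proof.
move=> /eqP; rewrite paddr_eq0 ?sqr_ge0// !sqrf_eq0 => /andP[/eqP h1 /eqP h2].
exact: complexP.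
Qed.

Lemma nsq_expi (t : R) : nsq (expi t) = 1.
Proof.
by rewrite /nsq /= cos2Dsin2.
Qed.

Definition mu_int (h : R -> R) := (@lebesgue_measure R).-integrable (@angles R) (EFin \o h).

Definition sqint f := [/\ measurable_fun (@angles R) (fun t => complex.Re (f t)),
  measurable_fun (@angles R) (fun t => complex.Im (f t)) & mu_int (fun t => nsq (f t))].

Definition nrm2 f : R := \int[lebesgue_measure]_(t in @angles R) nsq (f t).

Lemma mu_int_dom (g f : R -> R) : measurable_fun (@angles R) g -> mu_int f ->
  (forall t, `|g t| <= f t) -> mu_int g.
Proof.
move=> mg h le; apply: (le_integrable _ _ _ h); first exact: measurable_itv.
  by apply/measurable_EFinP; exact: mg.
by move=> t _; rewrite lee_fin /= (le_trans (le t))// ler_norm.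
Qed.

Lemma mu_int_cst (c : R) : mu_int (fun=> c).
Proof.
by apply: integrable_angles => t; exact: cvg_cst.
Qed.

Lemma mu_intDZ (c d : R) (f g : R -> R) : mu_int f -> mu_int g -> mu_int (fun t => c * f t + d * g t).
Proof.
move=> hf hg.
have Zi (e : R) (h : R -> R) : mu_int h -> mu_int (fun t => e * h t).
  by move=> hh; apply: (integrableZl _ e hh); exact: measurable_itv.
by apply: (integrableD _ (Zi c _ hf) (Zi d _ hg)); exact: measurable_itv.
Qed.

Lemma measurable_continuous (f : R -> R) : continuous f -> measurable_fun (@angles R) f.
Proof.
by move=> h; apply: measurable_funTS; exact: continuous_measurable_fun.
Qed.

(** Since |y| <= 1 + y^2 and the angles have finite measure, square integrability implies
    integrability. *)
Lemma sqint_Re f (c : R -> R) : sqint f -> measurable_fun (@angles R) c -> (forall t, `|c t| <= 1) ->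
  mu_int (fun t => complex.Re (f t) * c t) /\ mu_int (fun t => complex.Im (f t) * c t).
Proof.
move=> [mr mi h] mc c1.
have d1 := mu_intDZ 1 1 (mu_int_cst 1) h.
have bnd (x y : R) t : `|x| <= 1 -> y ^+ 2 <= nsq (f t) -> `|y * x| <= 1 * 1 + 1 * nsq (f t).
  move=> x1 yn; rewrite normrM.
  apply: (@le_trans _ _ `|y|); first by rewrite -[leRHS]mulr1 ler_wpM2l.
  have := real_normK (num_real y) => yy.
  move: yn; rewrite -yy; have := sqr_ge0 (`|y| - 1); have := sqr_ge0 `|y|.
  by move: (`|y|) (nsq _) => z N; clear; lra.
split; (apply: (mu_int_dom _ d1); first exact: measurable_funM) => t; apply: bnd => //.
  by rewrite /nsq lerDl sqr_ge0.
by rewrite /nsq lerDr sqr_ge0.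
Qed.

Lemma sqint_bounded f (M : R) : measurable_fun (@angles R) (fun t => complex.Re (f t)) ->
  measurable_fun (@angles R) (fun t => complex.Im (f t)) -> (forall t, nsq (f t) <= M) -> sqint f.
Proof.
move=> mr mi hM; split => //; apply: (mu_int_dom _ (mu_int_cst M)).
  by apply: measurable_funD; exact: measurable_funX.
by move=> t; rewrite ger0_norm// nsq_ge0.
Qed.

Lemma sqint_continuous f : continuous (fun t => complex.Re (f t)) ->
  continuous (fun t => complex.Im (f t)) -> sqint f.
Proof.
move=> cr ci; split; try exact: measurable_continuous.
apply: integrable_angles => t; apply: cvgD; rewrite !expr2; apply: cvgM;
  (exact: cr || exact: ci).
Qed.

Lemma sqintD f g : sqint f -> sqint g -> sqint (fun t => f t + g t).
Proof.
move=> [fr fi hf] [gr gi hg].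
have mr : measurable_fun (@angles R) (fun t => complex.Re (f t + g t)).
  by under eq_fun do rewrite ReD; exact: measurable_funD.
have mi : measurable_fun (@angles R) (fun t => complex.Im (f t + g t)).
  by under eq_fun do rewrite ImD; exact: measurable_funD.
split => //; apply: (mu_int_dom _ (mu_intDZ 2 2 hf hg)).
  by apply: measurable_funD; exact: measurable_funX.
by move=> t; rewrite ger0_norm ?nsq_ge0// nsqD_le.
Qed.

Lemma sqintM f g (M : R) : sqint f -> measurable_fun (@angles R) (fun t => complex.Re (g t)) ->
  measurable_fun (@angles R) (fun t => complex.Im (g t)) -> (forall t, nsq (g t) <= M) ->
  sqint (fun t => f t * g t).
Proof.
move=> [fr fi hf] gr gi hM.
have mr : measurable_fun (@angles R) (fun t => complex.Re (f t * g t)).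
  by under eq_fun do rewrite ReM; apply: measurable_funB; exact: measurable_funM.
have mi : measurable_fun (@angles R) (fun t => complex.Im (f t * g t)).
  by under eq_fun do rewrite ImM; apply: measurable_funD; exact: measurable_funM.
split => //; apply: (mu_int_dom _ (mu_intDZ M 0 hf hf)).
  by apply: measurable_funD; exact: measurable_funX.
by move=> t; rewrite ger0_norm ?nsq_ge0// nsqM mul0r addr0 mulrC ler_wpM2r// nsq_ge0.
Qed.

Lemma continuous_expi (c : R) :
  continuous (fun t => complex.Re (expi (c * t))) /\ continuous (fun t => complex.Im (expi (c * t))).
Proof.
split => t; [have := (is_derive_cosM c t).1|have := (is_derive_cosM c t).2];
    exact: is_derive_continuous.
Qed.

Lemma sqintZ f b : sqint f -> sqint (fun t => f t * b).
Proof.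
by move=> hf; apply: (sqintM (M := nsq b)).
Qed.

Lemma sqintN f : sqint f -> sqint (fun t => - f t).
Proof.
move=> /(sqintZ (-1)) h.
by rewrite (_ : (fun t => - f t) = (fun t => f t * -1)); last by apply/funext => t; rewrite mulrN1.
Qed.

Lemma sqint_expi (c : R) b : sqint (fun t => b * expi (c * t)).
Proof.
have [c1 c2] := continuous_expi c.
rewrite (_ : (fun t => _) = (fun t => expi (c * t) * b)); last by apply/funext => t; rewrite mulrC.
by apply: sqintZ; exact: sqint_continuous.
Qed.

Lemma nrm2_ge0 f : 0 <= nrm2 f.
Proof.
by apply: Rintegral_ge0 => t _; exact: nsq_ge0.
Qed.

Lemma le_mu_int (f g : R -> R) : mu_int f -> mu_int g -> (forall t, f t <= g t) ->
  \int[lebesgue_measure]_(t in @angles R) f t <= \int[lebesgue_measure]_(t in @angles R) g t.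
Proof.
by move=> hf hg h; apply: le_Rintegral => //; exact: measurable_itv.
Qed.

Lemma nrm2D_le f g : sqint f -> sqint g -> nrm2 (fun t => f t + g t) <= 2 * nrm2 f + 2 * nrm2 g.
Proof.
move=> hf hg; have [_ _ h] := sqintD hf hg; have [_ _ h1] := hf; have [_ _ h2] := hg.
rewrite /nrm2 -RintegralDZ//; apply: le_mu_int => //; first exact: mu_intDZ.
by move=> t; exact: nsqD_le.
Qed.

End SquareIntegrable.

(** * Fourier coefficients, orthogonality and Bessel's inequality *)

Section FourierCoefficients.
Variable R : realType.
Implicit Types (f g : R -> R[i]) (b z : R[i]) (m n : int).

Lemma pi2_gt0 : 0 < 2 * pi :> R.
Proof.
by rewrite mulr_gt0// pi_gt0.
Qed.

Definition reint f m : R := \int[lebesgue_measure]_(t in @angles R)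
  (complex.Re (f t) * cos (m%:~R * t) + complex.Im (f t) * sin (m%:~R * t)).
Definition imint f m : R := \int[lebesgue_measure]_(t in @angles R)
  (complex.Im (f t) * cos (m%:~R * t) - complex.Re (f t) * sin (m%:~R * t)).

Lemma reint_coef f m : reint f m = 2 * pi * complex.Re (fourier_coef f m).
Proof.
rewrite fourier_coefE ReM /= mul0r subr0 mulrA divff ?mul1r// gt_eqF//; exact: pi2_gt0.
Qed.

Lemma imint_coef f m : imint f m = 2 * pi * complex.Im (fourier_coef f m).
Proof.
rewrite fourier_coefE ImM /= mul0r addr0 mulrA divff ?mul1r// gt_eqF//; exact: pi2_gt0.
Qed.

Lemma fourier_coef_ints f m : fourier_coef f m = ((2 * pi)^-1)%:C * (reint f m +i* imint f m).
Proof.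
exact: fourier_coefE.
Qed.

Lemma mu_int_trig f m : sqint f ->
  [/\ mu_int (fun t => complex.Re (f t) * cos (m%:~R * t)),
      mu_int (fun t => complex.Im (f t) * cos (m%:~R * t)),
      mu_int (fun t => complex.Re (f t) * sin (m%:~R * t)) &
      mu_int (fun t => complex.Im (f t) * sin (m%:~R * t))].
Proof.
move=> hf; have [c1 c2] := @continuous_expi R m%:~R.
have [h1 h2] := sqint_Re hf (measurable_continuous c1) (fun t => cos_max _).
by have [h3 h4] := sqint_Re hf (measurable_continuous c2) (fun t => sin_max _).
Qed.

Lemma mu_int_reim f m : sqint f ->
  mu_int (fun t => complex.Re (f t) * cos (m%:~R * t) + complex.Im (f t) * sin (m%:~R * t)) /\
  mu_int (fun t => complex.Im (f t) * cos (m%:~R * t) - complex.Re (f t) * sin (m%:~R * t)).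
Proof.
move=> /(mu_int_trig m)[h1 h2 h3 h4]; split.
  have := mu_intDZ 1 1 h1 h4; congr mu_int; by apply/funext => t; rewrite !mul1r.
have := mu_intDZ 1 (-1) h2 h3; congr mu_int; by apply/funext => t; rewrite mul1r mulN1r.
Qed.

Lemma fourier_coefD f g m : sqint f -> sqint g ->
  fourier_coef (fun t => f t + g t) m = fourier_coef f m + fourier_coef g m.
Proof.
move=> hf hg; have [f1 f2] := mu_int_reim m hf; have [g1 g2] := mu_int_reim m hg.
rewrite !fourier_coef_ints -mulrDr; congr (_ * _).
have E1 := RintegralDZ 1 1 f1 g1; have E2 := RintegralDZ 1 1 f2 g2.
apply: complexP => /=.
  rewrite /reint; move: E1; rewrite !mul1r => <-.
  by apply: eq_Rintegral => t _; rewrite ReD ImD; ring.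
rewrite /imint; move: E2; rewrite !mul1r => <-.
by apply: eq_Rintegral => t _; rewrite ReD ImD; ring.
Qed.

Lemma fourier_coefZ f b m : sqint f -> fourier_coef (fun t => f t * b) m = fourier_coef f m * b.
Proof.
move=> hf; have [f1 f2] := mu_int_reim m hf.
rewrite !fourier_coef_ints -mulrA; congr (_ * _).
have E1 := RintegralDZ (complex.Re b) (- complex.Im b) f1 f2.
have E2 := RintegralDZ (complex.Im b) (complex.Re b) f1 f2.
apply: complexP; rewrite ?ReM ?ImM /=.
  transitivity (complex.Re b * reint f m + - complex.Im b * imint f m); last by ring.
  rewrite /reint /imint -E1.
  by apply: eq_Rintegral => t _; rewrite ReM ImM; ring.
transitivity (complex.Im b * reint f m + complex.Re b * imint f m); last by ring.
rewrite /reint /imint -E2.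
by apply: eq_Rintegral => t _; rewrite ReM ImM; ring.
Qed.

Lemma fourier_coefB f g m : sqint f -> sqint g ->
  fourier_coef (fun t => f t - g t) m = fourier_coef f m - fourier_coef g m.
Proof.
move=> hf hg; rewrite fourier_coefD//; last exact: sqintN.
congr (_ + _); rewrite -mulrN1 -fourier_coefZ//.
by congr (fourier_coef _ m); apply/funext => t; rewrite mulrN1.
Qed.

Lemma Rintegral_trig m : m != 0 ->
  \int[lebesgue_measure]_(t in @angles R) cos (m%:~R * t) = 0 /\
  \int[lebesgue_measure]_(t in @angles R) sin (m%:~R * t) = 0.
Proof.
move=> m0; have mR : m%:~R != 0 :> R by rewrite intr_eq0.
have [c1 c2] := @continuous_expi R m%:~R.
have [e1 e2] := cos_sin_2pi_int R m.
split.
  have F (t : R) : is_derive t 1 (fun t : R => m%:~R^-1 * sin (m%:~R * t)) (cos (m%:~R * t)).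
    apply: (is_derive_eq (is_deriveZ m%:~R^-1 (is_derive_cosM m%:~R t).2)).
    by rewrite /GRing.scale /= mulKf.
  by rewrite (Rintegral_FTC2 F c1) e2 !mulr0 sin0 mulr0 subrr.
have F (t : R) : is_derive t 1 (fun t : R => - m%:~R^-1 * cos (m%:~R * t)) (sin (m%:~R * t)).
  apply: (is_derive_eq (is_deriveZ (- m%:~R^-1) (is_derive_cosM m%:~R t).1)).
  by rewrite /GRing.scale /= mulrA mulrNN mulVf// mul1r.
by rewrite (Rintegral_FTC2 F c2) e1 mulr0 cos0 subrr.
Qed.

Lemma fourier_coef_expi b m n : fourier_coef (fun t => b * expi (m%:~R * t)) n = if m == n then b else 0.
Proof.
have cmn (p : int) t : cos (m%:~R * t) * cos (n%:~R * t) + sin (m%:~R * t) * sin (n%:~R * t) =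
   cos ((m - n)%:~R * t) :> R.
  by rewrite intrB mulrBl cosB.
have smn (p : int) t : sin (m%:~R * t) * cos (n%:~R * t) - cos (m%:~R * t) * sin (n%:~R * t) =
   sin ((m - n)%:~R * t) :> R.
  by rewrite intrB mulrBl sinB.
have [c1 c2] := @continuous_expi R (m - n)%:~R.
have i1 := integrable_angles c1; have i2 := integrable_angles c2.
have E1 : reint (fun t => b * expi (m%:~R * t)) n =
   complex.Re b * \int[lebesgue_measure]_(t in @angles R) cos ((m - n)%:~R * t) +
   - complex.Im b * \int[lebesgue_measure]_(t in @angles R) sin ((m - n)%:~R * t).
  rewrite -RintegralDZ//; apply: eq_Rintegral => t _.
  by rewrite -(cmn 0) -(smn 0) ReM ImM /=; ring.
have E2 : imint (fun t => b * expi (m%:~R * t)) n =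
   complex.Im b * \int[lebesgue_measure]_(t in @angles R) cos ((m - n)%:~R * t) +
   complex.Re b * \int[lebesgue_measure]_(t in @angles R) sin ((m - n)%:~R * t).
  rewrite -RintegralDZ//; apply: eq_Rintegral => t _.
  by rewrite -(cmn 0) -(smn 0) ReM ImM /=; ring.
rewrite fourier_coef_ints E1 E2; case: eqP => [->|/eqP mn].
  rewrite subrr.
  have -> : \int[lebesgue_measure]_(t in @angles R) cos (0%:~R * t) = 2 * pi.
    rewrite -[RHS]mulr1 -Rintegral_angles_cst; apply: eq_Rintegral => t _.
    by rewrite mul0r cos0.
  have -> : \int[lebesgue_measure]_(t in @angles R) sin (0%:~R * t) = 0.
    rewrite -[RHS](mulr0 (2 * pi)) -Rintegral_angles_cst; apply: eq_Rintegral => t _.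
    by rewrite mul0r sin0.
  have p0 : 2 * pi != 0 :> R by rewrite gt_eqF// pi2_gt0.
  rewrite !mulr0 !addr0; apply: complexP; rewrite ?ReM ?ImM /= mul0r ?subr0 ?addr0;
    by rewrite mulrCA mulVf ?mulr1.
have [|-> ->] := @Rintegral_trig (m - n); first by rewrite subr_eq0.
by rewrite !mulr0 addr0; apply: complexP; rewrite ?ReM ?ImM /= !mulr0 ?subr0 ?addr0.
Qed.

Lemma nrm2_sub_mode f b m : sqint f ->
  nrm2 (fun t => f t - b * expi (m%:~R * t)) =
  nrm2 f - 2 * pi * nsq (fourier_coef f m) + 2 * pi * nsq (fourier_coef f m - b).
Proof.
move=> hf; have [_ _ h] := hf; have [f1 f2] := mu_int_reim m hf.
have i1 := mu_intDZ (- 2 * complex.Re b) (- 2 * complex.Im b) f1 f2.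
have i2 := mu_intDZ 1 1 h i1.
transitivity (1 * (1 * nrm2 f + 1 * (- 2 * complex.Re b * reint f m + (- 2 * complex.Im b) * imint f m))
    + nsq b * (2 * pi * 1)).
  rewrite -Rintegral_angles_cst /reint /imint -RintegralDZ// /nrm2 -RintegralDZ//.
  rewrite -RintegralDZ//; last exact: mu_int_cst.
  apply: eq_Rintegral => t _; rewrite /nsq ReD ImD ReN ImN ReM ImM /=.
  have h1 := cos2Dsin2 (m%:~R * t : R); have h2 : 1 * 1 = 1 :> R by rewrite mulr1.
  have -> : (complex.Re b ^+ 2 + complex.Im b ^+ 2) * 1 = (complex.Re b ^+ 2 + complex.Im b ^+ 2) *
    (cos (m%:~R * t) ^+ 2 + sin (m%:~R * t) ^+ 2) by rewrite h1.
  ring.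
by rewrite reint_coef imint_coef /nsq ReD ImD ReN ImN; ring.
Qed.

Definition trig_poly (s : seq int) (b : int -> R[i]) (t : R) : R[i] :=
  \sum_(m <- s) b m * expi (m%:~R * t).

Lemma trig_poly_cons m s (b : int -> R[i]) t : trig_poly (m :: s) b t = b m * expi (m%:~R * t) + trig_poly s b t.
Proof.
by rewrite /trig_poly big_cons.
Qed.

Lemma sqint_trig_poly s (b : int -> R[i]) : sqint (trig_poly s b).
Proof.
elim: s => [|m s IH].
  rewrite (_ : trig_poly _ _ = fun=> 0); last by apply/funext => t; rewrite /trig_poly big_nil.
  by apply: sqint_continuous => t; exact: cvg_cst.
have := sqintD (sqint_expi m%:~R (b m)) IH; congr sqint.
by apply/funext => t; rewrite trig_poly_cons.
Qed.

(** Modes are removed one at a time by completing the square; orthogonality leaves the remaining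
    coefficients untouched. Bessel's inequality and the error of every cut-off Fourier sum are read
    off from this identity. *)
Lemma nrm2_sub_trig_poly f s (b : int -> R[i]) : uniq s -> sqint f ->
  nrm2 (fun t => f t - trig_poly s b t) =
  nrm2 f - 2 * pi * (\sum_(m <- s) nsq (fourier_coef f m))
  + 2 * pi * (\sum_(m <- s) nsq (fourier_coef f m - b m)).
Proof.
elim: s f => [|m s IH] f us hf.
  rewrite !big_nil !mulr0 subr0 addr0; congr nrm2.
  by apply/funext => t; rewrite /trig_poly big_nil subr0.
move: us => /= /andP[ms us].
pose g t := f t - b m * expi (m%:~R * t).
have hg : sqint g by apply: sqintD => //; apply: sqintN; exact: sqint_expi.
have -> : (fun t => f t - trig_poly (m :: s) b t) = (fun t => g t - trig_poly s b t).
  by apply/funext => t; rewrite trig_poly_cons /g opprD addrA.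
rewrite IH// /g nrm2_sub_mode// -/g !big_cons.
have E n : n \in s -> fourier_coef g n = fourier_coef f n.
  move=> ns; rewrite fourier_coefB//; last exact: sqint_expi.
  by rewrite fourier_coef_expi; case: eqP ms => [->|]; rewrite ?ns ?subr0.
rewrite (eq_big_seq (fun n => nsq (fourier_coef f n))); last by move=> n /E ->.
rewrite (eq_big_seq (F1 := fun n => nsq (fourier_coef g n - b n))
  (fun n => nsq (fourier_coef f n - b n))); last by move=> n /E ->.
by rewrite -/g; ring.
Qed.

Lemma bessel_inequality f s : uniq s -> sqint f ->
  2 * pi * (\sum_(m <- s) nsq (fourier_coef f m)) <= nrm2 f.
Proof.
move=> us hf; have := nrm2_ge0 (fun t => f t - trig_poly s (fourier_coef f) t).
rewrite nrm2_sub_trig_poly//.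
rewrite [X in _ + _ * X]big1_seq; first by rewrite mulr0 addr0 subr_ge0.
by move=> m _; rewrite subrr /nsq /= expr0n addr0.
Qed.

End FourierCoefficients.

(** * Pointwise and mean-square convergence of Fourier series *)

Section Chernoff.
Variable R : realType.
Implicit Types (f g : R -> R[i]) (z w : R[i]) (m n : int) (t : R).

(** Distance is measured along the chord of the unit circle, and C bounds the squared ratio. This
    builds in 2 pi-periodicity and bounds the quotient of g(s) - g(t) by e^(is) - e^(it)
    directly. *)
Definition chord_lipschitz (C : R) g :=
  forall s t, nsq (g s - g t) <= C * nsq (expi s - expi t).

Lemma complex_inv w : w^-1 = (complex.Re w * (nsq w)^-1) +i* (- (complex.Im w * (nsq w)^-1)).
Proof.
by case: w.
Qed.

Lemma measurable_invr (f : R -> R) : (forall t, 0 <= f t) -> measurable_fun (@angles R) f ->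
  measurable_fun (@angles R) (fun t => (f t)^-1).
Proof.
move=> f0 mf.
have -> : (fun t => (f t)^-1) = (fun x : R => x `^ (- 1)) \o f.
  by apply/funext => t /=; rewrite powR_inv1.
exact: (measurableT_comp (measurable_powR (- 1)) mf).
Qed.

Lemma cvg_eq (u v : nat -> R) (l : R) : (forall k, u k = v k) -> v k @[k --> \oo] --> l ->
  u k @[k --> \oo] --> l.
Proof.
by move=> /funext ->.
Qed.

Lemma cvg0_le (u : nat -> R) : (forall k, 0 <= u k) ->
  (u k @[k --> \oo] --> (0 : R)) <-> (forall e, 0 < e -> \forall k \near \oo, u k <= e).
Proof.
move=> u0; have E k : `|0 - u k| = u k by rewrite sub0r normrN ger0_norm.
split => h; last first.
  by apply/cvgrPdist_le => e /h; apply: filterS => k; rewrite E.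
by move=> e e0; move/cvgrPdist_le : h => /(_ e e0); apply: filterS => k; rewrite E.
Qed.

Lemma cvg_subr0 (u : nat -> R) (l : R) : u k @[k --> \oo] --> (0 : R) -> l - u k @[k --> \oo] --> l.
Proof.
by move=> h; rewrite -[X in _ --> X]subr0; apply: cvgB => //; exact: cvg_cst.
Qed.

Lemma fourier_coef_shift f m : fourier_coef f (m - 1) = fourier_coef (fun t => f t * expi t) m.
Proof.
rewrite !fourier_coef_ints; congr (_ * (_ +i* _)); apply: eq_Rintegral => t _.
  by rewrite intrB mulrBl mul1r cosB sinB ReM ImM /=; ring.
by rewrite intrB mulrBl mul1r cosB sinB ReM ImM /=; ring.
Qed.

Lemma cvg_nsq0 (z : nat -> R[i]) : nsq (z k) @[k --> \oo] --> (0 : R) ->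
  complex.Re (z k) @[k --> \oo] --> (0 : R) /\ complex.Im (z k) @[k --> \oo] --> (0 : R).
Proof.
move=> h.
have key (x : nat -> R) : (forall k, x k ^+ 2 <= nsq (z k)) -> x k @[k --> \oo] --> (0 : R).
  move=> hx; apply/cvgrPdist_le => e e0; move/cvgrPdist_le : h => /(_ (e ^+ 2)).
  move=> /(_ (exprn_gt0 _ e0)); apply: filterS => k.
  rewrite !sub0r !normrN (ger0_norm (nsq_ge0 _)) => hk.
  rewrite -ler_sqr ?nnegrE ?(ltW e0)// real_normK ?num_real//.
  exact: le_trans (hx k) hk.
split; apply: key => k; rewrite /nsq; [rewrite lerDl|rewrite lerDr]; exact: sqr_ge0.
Qed.

Lemma nsq_cvg0 (z : nat -> R[i]) : complex.Re (z k) @[k --> \oo] --> (0 : R) ->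
  complex.Im (z k) @[k --> \oo] --> (0 : R) -> nsq (z k) @[k --> \oo] --> (0 : R).
Proof.
move=> h1 h2; rewrite (_ : 0 = 0 * 0 + 0 * 0 :> R); last by rewrite !mulr0 addr0.
apply: (cvg_eq (v := fun k => complex.Re (z k) * complex.Re (z k) + complex.Im (z k) * complex.Im (z k))).
  by move=> k; rewrite /nsq !expr2.
by apply: cvgD; apply: cvgM.
Qed.

(** By Bessel's inequality the series of squared coefficients has bounded partial sums, so its terms
    tend to 0. *)
Lemma riemann_lebesgue f : sqint f ->
  nsq (fourier_coef f (Posz k)) @[k --> \oo] --> (0 : R) /\
  nsq (fourier_coef f (Negz k)) @[k --> \oo] --> (0 : R).
Proof.
move=> hf.
have key (p : nat -> int) : injective p -> nsq (fourier_coef f (p k)) @[k --> \oo] --> (0 : R).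
  move=> pinj; apply: cvg_series_cvg_0; apply: nondecreasing_is_cvgn.
    by apply: nondecreasing_series => k _ _; exact: nsq_ge0.
  exists (nrm2 f / (2 * pi)) => _ [N _ <-].
  rewrite ler_pdivlMr ?pi2_gt0// mulrC.
  have us : uniq (map p (iota 0 N)) by rewrite map_inj_uniq// iota_uniq.
  have := bessel_inequality us hf; rewrite big_map.
  by rewrite /series /= /index_iota subn0.
by split; apply: key => i j [].
Qed.

(** As [Negz i] is -(i + 1), the list holds -N, ..., N - 1: N terms from each of the two half-series
    of [bilateral_sum_to]. *)
Definition sym_range (N : nat) : seq int := map Posz (iota 0 N) ++ map Negz (iota 0 N).

Lemma sym_range_uniq N : uniq (sym_range N).
Proof.
rewrite cat_uniq !map_inj_uniq ?iota_uniq ?andbT//=; try by move=> i j [].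
by apply/hasPn => _ /mapP[j _ ->]; apply/negP => /mapP[].
Qed.

Lemma big_sym_range (F : int -> R[i]) N :
  \sum_(m <- sym_range N) F m = series (fun i => F (Posz i)) N + series (fun i => F (Negz i)) N.
Proof.
by rewrite big_cat /= !big_map /series /= /index_iota subn0.
Qed.

(* Chernoff's argument: dividing g - g(t0) by e^(it) - e^(i t0) turns the partial sums of the
   Fourier series of g at t0 into a telescoping sum. *)
Lemma chernoff C g t0 : sqint g -> 0 <= C -> chord_lipschitz C g ->
  exists K : int -> R[i],
  [/\ forall m, fourier_coef g m * expi (m%:~R * t0) = (if m == 0 then g t0 else 0) + K m - K (m + 1),
      forall m, nsq (K m) <= C,
      nsq (K (Posz k)) @[k --> \oo] --> (0 : R) & nsq (K (Negz k)) @[k --> \oo] --> (0 : R)].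
Proof.
move=> hg C0 lip.
pose h t := (g t - g t0) / (expi t - expi t0).
(* Where the chord vanishes, h is 0 because the inverse of 0 is 0, and the Lipschitz bound forces g
   t = g t0; the identity therefore holds for every t. *)
have hE t : h t * (expi t - expi t0) = g t - g t0.
  have [e|ne] := eqVneq (expi t - expi t0) 0; last by rewrite /h divfK.
  rewrite e mulr0; apply/esym/nsq_eq0/eqP; rewrite eq_le nsq_ge0 andbT.
  by rewrite (le_trans (lip t t0))// e /nsq /= expr0n addr0 mulr0.
have hC t : nsq (h t) <= C.
  have [e|ne] := eqVneq (expi t - expi t0) 0.
    by rewrite /h e invr0 mulr0 /nsq /= expr0n addr0.
  have np : 0 < nsq (expi t - expi t0).
    by rewrite lt_def nsq_ge0 andbT; apply: contra ne => /eqP/nsq_eq0 ->.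
  by have := lip t t0; rewrite -hE nsqM ler_pM2r.
have [ec es] : continuous (fun t => complex.Re (expi t : R[i])) /\ continuous (fun t => complex.Im (expi t : R[i])).
  by split; [exact: continuous_cos|exact: continuous_sin].
have se : sqint (fun t => expi t : R[i]) by exact: sqint_continuous.
have scst (z : R[i]) : sqint (fun=> z) by apply: sqint_continuous => t; exact: cvg_cst.
have [mdr mdi _] : sqint (fun t => expi t - expi t0) by exact: sqintD se (scst _).
have [mnr mni _] : sqint (fun t => g t - g t0) by exact: sqintD hg (scst _).
have mnsq : measurable_fun (@angles R) (fun t => nsq (expi t - expi t0)).
  by apply: measurable_funD; exact: measurable_funX.
have minv := measurable_invr (fun t => nsq_ge0 _) mnsq.
have mr : measurable_fun (@angles R) (fun t => complex.Re (h t)).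
  under eq_fun do rewrite /h complex_inv ReM /=.
  by apply: measurable_funB; apply: measurable_funM => //; first apply: measurable_funM => //;
   apply: measurable_funN; exact: measurable_funM.
have mi : measurable_fun (@angles R) (fun t => complex.Im (h t)).
  under eq_fun do rewrite /h complex_inv ImM /=.
  by apply: measurable_funD; apply: measurable_funM => //;
   [apply: measurable_funN; exact: measurable_funM|exact: measurable_funM].
have sh : sqint h := sqint_bounded mr mi hC.
have she : sqint (fun t => h t * expi t).
  have [e1 e2 _] := se.
  by apply: (sqintM (M := 1) sh e1 e2) => t; rewrite nsq_expi.
(* Coefficient m of g - g(t0) = h e^(it) - h e^(i t0): multiplication by e^(it) shifts the index by
   one. *)
have coef m : fourier_coef g m - (if m == 0 then g t0 else 0) =
   fourier_coef h (m - 1) - fourier_coef h m * expi t0.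
  have -> : (if m == 0 then g t0 else 0) = fourier_coef (fun t => g t0) m.
    have := fourier_coef_expi (g t0) 0 m; rewrite eq_sym => <-.
    by congr (fourier_coef _ m); apply/funext => t; rewrite mul0r /expi cos0 sin0 mulr1.
  rewrite -fourier_coefB// -fourier_coefZ//.
  rewrite fourier_coef_shift.
  rewrite -fourier_coefB//; last exact: sqintZ.
  by congr (fourier_coef _ m); apply/funext => t; rewrite -mulrBr hE.
(* After multiplication by e^(i m t0) the two terms of the recursion become consecutive values of
   this sequence. *)
exists (fun m => expi (m%:~R * t0) * fourier_coef h (m - 1)).
have nsqh m : nsq (fourier_coef h m) <= C.
  have := bessel_inequality (s := [:: m]) isT sh; rewrite big_seq1 => hb.
  rewrite -(ler_pM2l (pi2_gt0 R)); apply: (le_trans hb).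
  rewrite -Rintegral_angles_cst; have [_ _ i1] := sh.
  by apply: le_mu_int => //; exact: mu_int_cst.
have [rl1 rl2] := riemann_lebesgue sh.
split.
- move=> m; rewrite addrK.
  have hm : (if m == 0 then g t0 else 0) * expi (m%:~R * t0) = if m == 0 then g t0 else 0.
    case: eqP => [->|_]; last by rewrite mul0r.
    by rewrite mul0r /expi cos0 sin0 mulr1.
  have -> : fourier_coef g m = (if m == 0 then g t0 else 0) +
      (fourier_coef h (m - 1) - fourier_coef h m * expi t0) by rewrite -coef addrC subrK.
  rewrite mulrDl hm.
  have -> : expi ((m + 1)%:~R * t0) = expi (m%:~R * t0) * expi t0.
    rewrite intrD mulrDl mul1r /expi cosD sinD; apply: complexP; rewrite ?ReM ?ImM /=; ring.
  ring.
- by move=> m; rewrite nsqM nsq_expi mul1r.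
- apply: (cvg_eq (v := fun k => nsq (fourier_coef h (Posz k - 1)))).
    by move=> k; rewrite nsqM nsq_expi mul1r.
  rewrite -(cvg_shiftS (fun k => nsq (fourier_coef h (Posz k - 1)))) /=.
  by apply: (cvg_eq _ rl1) => k; rewrite -addn1 PoszD addrK.
- apply: (cvg_eq (v := fun k => nsq (fourier_coef h (Negz k.+1)))).
    by move=> k; rewrite nsqM nsq_expi mul1r !NegzE -(addn1 k.+1) PoszD opprD.
  by rewrite (cvg_shiftS (fun k => nsq (fourier_coef h (Negz k)))).
Qed.

(** Each half-series telescopes. The two occurrences of K 0 cancel in the full sum, whose distance
    to g t0 is carried by the two ends K (N + 1) and K (Negz N) alone. *)
Lemma chernoff_partial C g t0 : sqint g -> 0 <= C -> chord_lipschitz C g ->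
  exists K : int -> R[i],
  [/\ forall N, series (fun i => fourier_coef g (Posz i) * expi ((Posz i)%:~R * t0)) N.+1 = g t0 + K 0 - K N.+1%:Z,
      forall N, series (fun i => fourier_coef g (Negz i) * expi ((Negz i)%:~R * t0)) N.+1 = K (Negz N) - K 0,
      forall m, nsq (K m) <= C,
      nsq (K (Posz k)) @[k --> \oo] --> (0 : R) & nsq (K (Negz k)) @[k --> \oo] --> (0 : R)].
Proof.
move=> hg C0 lip; have [K [E bK l1 l2]] := chernoff t0 hg C0 lip; exists K; split => //.
- elim=> [|N IH]; first by rewrite /series /= big_nat1 E.
  rewrite seriesSr IH /= E add0r -[N.+1%:Z + 1]PoszD addn1; ring.
- elim=> [|N IH]; first by rewrite /series /= big_nat1 E add0r.
  rewrite seriesSr IH /= E add0r.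
  have -> : Negz N.+1 + 1 = Negz N by rewrite !NegzE -(addn1 N.+1) PoszD opprD subrK.
  ring.
Qed.

Lemma fourier_inversion C g t0 : sqint g -> 0 <= C -> chord_lipschitz C g ->
  bilateral_sum_to (fun m => fourier_coef g m * expi (m%:~R * t0)) (g t0).
Proof.
move=> hg C0 lip; have [K [E1 E2 bK /cvg_nsq0[l1 l1'] /cvg_nsq0[l2 l2']]] := chernoff_partial t0 hg C0 lip.
have Re_series (a : nat -> R[i]) : series (fun i => complex.Re (a i)) = (fun N => complex.Re (series a N)).
  apply/funext; elim=> [|N IH]; first by rewrite /series /= !big_geq.
  by rewrite !seriesSr IH ReD.
have Im_series (a : nat -> R[i]) : series (fun i => complex.Im (a i)) = (fun N => complex.Im (series a N)).
  apply/funext; elim=> [|N IH]; first by rewrite /series /= !big_geq.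
  by rewrite !seriesSr IH ImD.
have shift (u : nat -> R) l : u N.+1 @[N --> \oo] --> l -> u @ \oo --> l by rewrite cvg_shiftS.
exists (g t0 + K 0), (- K 0); split; last by rewrite addrK.
- rewrite /sum_to Re_series Im_series; split; apply: shift.
  + apply: (cvg_eq (v := fun N => complex.Re (g t0 + K 0) - complex.Re (K N.+1%:Z))).
      by move=> N; rewrite E1 ReD ReN.
    by apply: cvg_subr0; rewrite (cvg_shiftS (fun k => complex.Re (K (Posz k)))).
  + apply: (cvg_eq (v := fun N => complex.Im (g t0 + K 0) - complex.Im (K N.+1%:Z))).
      by move=> N; rewrite E1 ImD ImN.
    by apply: cvg_subr0; rewrite (cvg_shiftS (fun k => complex.Im (K (Posz k)))).
- rewrite /sum_to Re_series Im_series; split; apply: shift.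
  + apply: (cvg_eq (v := fun N => complex.Re (K (Negz N)) - complex.Re (K 0))).
      by move=> N; rewrite E2 ReD ReN.
    by rewrite ReN -[X in _ --> X]add0r; apply: cvgB => //; exact: cvg_cst.
  + apply: (cvg_eq (v := fun N => complex.Im (K (Negz N)) - complex.Im (K 0))).
      by move=> N; rewrite E2 ImD ImN.
    by rewrite ImN -[X in _ --> X]add0r; apply: cvgB => //; exact: cvg_cst.
Qed.

(** The pointwise error is K (N + 1) - K (Negz N): it tends to 0 and its square is at most 4 C
    uniformly in t, so dominated convergence applies. *)
Lemma nrm2_partial_sum_cvg0 C g : sqint g -> 0 <= C -> chord_lipschitz C g ->
  nrm2 (fun t => g t - trig_poly (sym_range N.+1) (fourier_coef g) t) @[N --> \oo] --> (0 : R).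
Proof.
move=> hg C0 lip.
pose D N t := g t - trig_poly (sym_range N.+1) (fourier_coef g) t.
have sD N : sqint (D N) by apply: sqintD => //; apply: sqintN; exact: sqint_trig_poly.
have DK t : exists K : int -> R[i], [/\ forall N, D N t = K N.+1%:Z - K (Negz N),
   forall m, nsq (K m) <= C,
   nsq (K (Posz k)) @[k --> \oo] --> (0 : R) & nsq (K (Negz k)) @[k --> \oo] --> (0 : R)].
  have [K [E1 E2 bK l1 l2]] := chernoff_partial t hg C0 lip; exists K; split => // N.
  by rewrite /D /trig_poly big_sym_range E1 E2; ring.
have bD N t : nsq (D N t) <= 4 * C.
  have [K [-> bK _ _]] := DK t; apply: (le_trans (nsqD_le _ _)).
  by rewrite nsqN; have := bK N.+1; have := bK (Negz N); lra.
have cD t : nsq (D N t) @[N --> \oo] --> (0 : R).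
  have [K [E _ /cvg_nsq0[l1 l1'] /cvg_nsq0[l2 l2']]] := DK t.
  apply: nsq_cvg0.
    apply: (cvg_eq (v := fun N => complex.Re (K N.+1%:Z) - complex.Re (K (Negz N)))).
      by move=> N; rewrite E ReD ReN.
    rewrite -[X in _ --> X]subr0; apply: cvgB => //.
    by rewrite (cvg_shiftS (fun k => complex.Re (K (Posz k)))).
  apply: (cvg_eq (v := fun N => complex.Im (K N.+1%:Z) - complex.Im (K (Negz N)))).
    by move=> N; rewrite E ImD ImN.
  rewrite -[X in _ --> X]subr0; apply: cvgB => //.
  by rewrite (cvg_shiftS (fun k => complex.Im (K (Posz k)))).
have iD N : mu_int (fun t => nsq (D N t)) by have [] := sD N.
have [] := @dominated_convergence _ _ R lebesgue_measure (@angles R) (measurable_itv _)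
  (fun N t => (nsq (D N t))%:E) (cst 0%:E) (cst (4 * C)%:E).
- by move=> N; exact: (measurable_int _ (iD N)).
- exact: measurable_cst.
- by apply: aeW => t _; apply: cvg_EFin; [exact: nearW|exact: cD].
- exact: (mu_int_cst (4 * C)).
- by apply: aeW => t N _; rewrite abse_EFin lee_fin ger0_norm ?nsq_ge0.
move=> _ _; rewrite integral0 => /fine_cvgP[_]; exact.
Qed.

(** Write S for the partial sum. Then f - S f is the sum of (f - g) - S (f - g) and g - S g. The
    first has norm at most that of f - g; with both squared norms at most e / 4, [nrm2D_le] gives
    e. *)
Lemma nrm2_partial_sum_cvg0_closure f : sqint f ->
  (forall e, 0 < e -> exists C g, [/\ sqint g, 0 <= C, chord_lipschitz C g & nrm2 (fun t => f t - g t) <= e]) ->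
  nrm2 (fun t => f t - trig_poly (sym_range N.+1) (fourier_coef f) t) @[N --> \oo] --> (0 : R).
Proof.
move=> hf H; apply/cvg0_le => [N|e e0]; first exact: nrm2_ge0.
have e4 : 0 < e / 4 by rewrite divr_gt0.
have [C [g [hg C0 lip fg]]] := H _ e4.
have /cvg0_le h := nrm2_partial_sum_cvg0 hg C0 lip.
have := h (fun N => nrm2_ge0 _) _ e4; apply: filterS => N hN.
have sd : sqint (fun t => f t - g t) by apply: sqintD => //; exact: sqintN.
have us := sym_range_uniq N.+1.
have E : (fun t => f t - trig_poly (sym_range N.+1) (fourier_coef f) t) =
  (fun t => ((f t - g t) - trig_poly (sym_range N.+1) (fourier_coef (fun t => f t - g t)) t) +
     (g t - trig_poly (sym_range N.+1) (fourier_coef g) t)).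
  apply/funext => t; rewrite addrACA subrK -opprD; congr (_ - _).
  rewrite /trig_poly -big_split /=; apply: eq_bigr => m _.
  by rewrite -mulrDl fourier_coefB// subrK.
have s1 : sqint (fun t => (f t - g t) - trig_poly (sym_range N.+1) (fourier_coef (fun t => f t - g t)) t).
  by apply: sqintD => //; apply: sqintN; exact: sqint_trig_poly.
have s2 : sqint (fun t => g t - trig_poly (sym_range N.+1) (fourier_coef g) t).
  by apply: sqintD => //; apply: sqintN; exact: sqint_trig_poly.
have := nrm2D_le s1 s2; rewrite -E => h1.
have h2 : nrm2 (fun t => (f t - g t) - trig_poly (sym_range N.+1) (fourier_coef (fun t => f t - g t)) t)
   <= nrm2 (fun t => f t - g t).
  rewrite nrm2_sub_trig_poly//.
  rewrite [X in _ + _ * X]big1_seq; last by move=> m _; rewrite subrr /nsq /= expr0n addr0.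
  rewrite mulr0 addr0 gerBl mulr_ge0 ?(ltW (pi2_gt0 R))//.
  by apply: sumr_ge0 => m _; exact: nsq_ge0.
move: h1 h2 fg hN; move: (nrm2 _) (nrm2 _) (nrm2 _) (nrm2 _) => a b c d; clear; lra.
Qed.

End Chernoff.

(** * The L^2 and H^{1/2} norms on a circle in terms of Fourier coefficients *)

Section SobolevNorms.
Variable R : realType.
Implicit Types (f g : R -> R[i]) (r a : R) (m : int) (s : seq int).

Lemma L2norm_integral r f : L2norm r f =
  sqrte (\int[lebesgue_measure]_(t in @angles R) (r * nsq (f t))%:E)%E.
Proof.
by rewrite /L2norm; congr sqrte; apply: eq_integral => t _; rewrite normc_sq.
Qed.

Lemma L2normE r f : sqint f -> L2norm r f = (Num.sqrt (r * nrm2 f))%:E.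
Proof.
move=> [_ _ h]; rewrite L2norm_integral.
have hr : mu_int (fun t => r * nsq (f t)).
  have := mu_intDZ r 0 h h; congr mu_int; by apply/funext => t; rewrite mul0r addr0.
have E : \int[lebesgue_measure]_(t in @angles R) (r * nsq (f t)) = r * nrm2 f.
  have := RintegralDZ r 0 h h; rewrite mul0r addr0 => <-.
  by apply: eq_Rintegral => t _; rewrite mul0r addr0.
have fin : (\int[lebesgue_measure]_(t in @angles R) (r * nsq (f t))%:E)%E \is a fin_num.
  by apply: (integrable_fin_num _ hr); exact: measurable_itv.
rewrite -(fineK fin).
exact: (congr1 (fun z => (Num.sqrt z)%:E) E).
Qed.

Lemma inL2P r f : 0 < r -> inL2 r f <-> sqint f.
Proof.
move=> r0; split; last first.
  by move=> h; have [h1 h2 _] := h; split => //; rewrite L2normE// ltry.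
move=> [h1 h2]; rewrite L2norm_integral => h3; split => //.
have m : measurable_fun (@angles R) (fun t => nsq (f t)).
  by apply: measurable_funD; exact: measurable_funX.
have hr : mu_int (fun t => r * nsq (f t)).
  apply/integrableP; split.
    by apply/measurable_EFinP; apply: measurable_funM => //; exact: measurable_cst.
  have E : (\int[lebesgue_measure]_(t in @angles R) `|(r * nsq (f t))%:E|)%E =
      (\int[lebesgue_measure]_(t in @angles R) (r * nsq (f t))%:E)%E.
    by apply: eq_integral => t _; rewrite abse_EFin ger0_norm// mulr_ge0 ?nsq_ge0// ltW.
  have h4 : (\int[lebesgue_measure]_(t in @angles R) (r * nsq (f t))%:E < +oo)%E.
    by move: h3; case: (integral _ _ _) => //= x _; exact: ltry.
  by move: h4; rewrite -E.
have := mu_intDZ r^-1 0 hr hr; congr mu_int; apply/funext => t.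
by rewrite mul0r addr0 mulKf// gt_eqF.
Qed.

(** This is the square of the s_m used by the cut-offs, which appears as
    [Num.sqrt (sobolev_weight R m)]. *)
Definition sobolev_weight m : R := Num.sqrt (1 + m%:~R ^+ 2).

Lemma sobolev_weight_ge0 m : 0 <= sobolev_weight m.
Proof.
exact: sqrtr_ge0.
Qed.

Lemma H12norm_esum r f : H12norm r f = sqrte ((2 * pi * r)%:E *
  \esum_(m in [set: int]) (sobolev_weight m * nsq (fourier_coef f m))%:E)%E.
Proof.
rewrite /H12norm; congr (sqrte (_ * _)%E); apply: eq_esum => m _.
by rewrite normc_sq.
Qed.

Lemma H12norm_ge r f s (H : R) : 0 < r -> uniq s -> (H12norm r f <= H%:E)%E -> 0 <= H ->
  2 * pi * r * (\sum_(m <- s) sobolev_weight m * nsq (fourier_coef f m)) <= H ^+ 2.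
Proof.
move=> r0 us; rewrite H12norm_esum => hH H0.
have p0 : 0 <= 2 * pi * r by rewrite mulr_ge0 ?(ltW r0)// ltW// pi2_gt0.
have F0 m : 0 <= sobolev_weight m * nsq (fourier_coef f m).
  by rewrite mulr_ge0 ?sobolev_weight_ge0 ?nsq_ge0.
have le : ((\sum_(m <- s) sobolev_weight m * nsq (fourier_coef f m))%:E <=
   \esum_(m in [set: int]) (sobolev_weight m * nsq (fourier_coef f m))%:E)%E.
  apply: esum_ge; exists [set` s]; first by split => //; exact: finite_seq.
  by rewrite -fsbig_seq// sumEFin.
have -> : H ^+ 2 = fine (H%:E ^+ 2)%E by [].
have HE : H%:E = sqrte ((H ^+ 2)%:E)%E by rewrite /= sqrtr_sqr ger0_norm.
rewrite HE lee_sqrt in hH; last by rewrite lee_fin sqr_ge0.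
rewrite /= -lee_fin EFinM; apply: le_trans hH.
by apply: lee_wpmul2l => //; rewrite lee_fin.
Qed.

Lemma H12norm_trig_poly r s (b : int -> R[i]) : 0 < r -> uniq s ->
  H12norm r (trig_poly s b) =
  (Num.sqrt (2 * pi * r * (\sum_(m <- s) sobolev_weight m * nsq (b m))))%:E.
Proof.
move=> r0 us; rewrite H12norm_esum.
have coef m : fourier_coef (trig_poly s b) m = if m \in s then b m else 0.
  elim: s us => [_|n s IH /= /andP[ns us]].
    rewrite (_ : trig_poly _ _ = fun t => 0 * expi (0%:~R * t)); last first.
      by apply/funext => t; rewrite /trig_poly big_nil mul0r.
    by rewrite fourier_coef_expi; case: eqP.
  rewrite (_ : trig_poly _ _ = fun t => b n * expi (n%:~R * t) + trig_poly s b t); last first.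
    by apply/funext => t; rewrite trig_poly_cons.
  rewrite fourier_coefD; [|exact: sqint_expi|exact: sqint_trig_poly].
  rewrite fourier_coef_expi IH// inE eq_sym; case: eqP => [->|_] /=; last by rewrite add0r.
  by rewrite (negbTE ns) addr0.
have -> : \esum_(m in [set: int]) (sobolev_weight m * nsq (fourier_coef (trig_poly s b) m))%:E =
  (\sum_(m <- s) sobolev_weight m * nsq (b m))%:E.
  rewrite -sumEFin (fsbig_seq _ _ us) -esum_fset; first last.
  - by move=> m _; rewrite lee_fin mulr_ge0 ?sobolev_weight_ge0 ?nsq_ge0.
  - exact: finite_seq.
  rewrite [RHS]esum_mkcond; apply: eq_esum => m _; rewrite coef.
  have -> : (m \in [set` s]) = (m \in s) by apply/idP/idP; rewrite inE.
  by case: ifP => // _; rewrite /nsq /= expr0n addr0 mulr0.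
by rewrite -EFinM.
Qed.

End SobolevNorms.

(** * Lipschitz bounds on circles, and the expansion of a solution in Bessel modes *)

Section CircleLipschitz.
Variable R : realType.
Implicit Types (a r t : R) (w : R * R -> R).

(** The mean value theorem is applied along the chord of the circle, which stays in a compact disk
    where the gradient is bounded and has length r |e^(is) - e^(it)|. *)
Lemma C1_chord_lipschitz a w r : C1_on (disk a) w -> 0 <= r < a ->
  exists2 L, 0 <= L & forall s t, (w (polar r s) - w (polar r t)) ^+ 2 <= L * nsq (expi s - expi t).
Proof.
move=> hw ra; have [c0 c1 c2] := C1_continuous_disk hw.
have [M1 M10 hM1] := closed_disk_bounded c1 ra.
have [M2 M20 hM2] := closed_disk_bounded c2 ra.
have [r0 ra'] := andP ra.
exists (2 * (M1 ^+ 2 + M2 ^+ 2) * r ^+ 2).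
  by rewrite !mulr_ge0 ?sqr_ge0// addr_ge0 ?sqr_ge0.
move=> s t.
pose x := polar r s; pose y := polar r t.
pose p (h : R) := y.1 + h * (x.1 - y.1); pose q (h : R) := y.2 + h * (x.2 - y.2).
have inD h : 0 <= h <= 1 -> closed_disk r (p h, q h).
  move=> /andP[h0 h1]; rewrite /closed_disk /=.
  (* Convexity of the squared norm, with its exact defect. *)
  have -> : p h ^+ 2 + q h ^+ 2 = (1 - h) * (y.1 ^+ 2 + y.2 ^+ 2) + h * (x.1 ^+ 2 + x.2 ^+ 2)
     - h * (1 - h) * ((x.1 - y.1) ^+ 2 + (x.2 - y.2) ^+ 2) by rewrite /p /q; ring.
  rewrite !polar_norm2 -mulrDl subrK mul1r gerBl !mulr_ge0 ?subr_ge0//.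
  by rewrite addr_ge0 ?sqr_ge0.
have inD' h : 0 <= h <= 1 -> disk a (p h, q h).
  move=> /inD; rewrite /closed_disk /disk /= => /le_lt_trans; apply.
  by rewrite ltr_sqr ?nnegrE// ltW// (le_lt_trans r0).
have dl (z d h : R) : is_derive h 1 (fun h : R => z + h * d) d.
  have h1 : is_derive h 1 (fun h : R => h * d) d.
    rewrite (_ : (fun h : R => h * d) = d *: id); last by apply/funext => u; exact: mulrC.
    by apply: is_derive_eq; exact: mulr1.
  by apply: (is_derive_eq (is_deriveD (is_derive_cst z h 1) h1)); rewrite add0r.
have [|h h01 E] := @MVT01 R (fun h => w (p h, q h)) (fun h =>
   'D_(e1 R) w (p h, q h) * (x.1 - y.1) + 'D_(e2 R) w (p h, q h) * (x.2 - y.2)).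
  by move=> h h01; apply: (C1_chain hw (inD' h h01)); exact: dl.
have p1 : (p 1, q 1) = x by rewrite /p /q !mul1r ![_ + (_ - _)]addrC !subrK; case: (x).
have p0 : (p 0, q 0) = y by rewrite /p /q !mul0r !addr0; case: (y).
rewrite /= p1 p0 in E; rewrite E.
have b1 := hM1 _ (inD h h01); have b2 := hM2 _ (inD h h01).
have -> : r ^+ 2 = r * r by rewrite expr2.
have -> : 2 * (M1 ^+ 2 + M2 ^+ 2) * (r * r) * nsq (expi s - expi t) =
  2 * (M1 ^+ 2 + M2 ^+ 2) * ((x.1 - y.1) ^+ 2 + (x.2 - y.2) ^+ 2).
  by rewrite /nsq ReD ImD ReN ImN /x /y /=; ring.
have sq (D M : R) : `|D| <= M -> D ^+ 2 <= M ^+ 2.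
  move=> h1; have M0 : 0 <= M by apply: le_trans h1.
  by rewrite -real_normK ?num_real// ler_sqr ?nnegrE.
have := sq _ _ b1; have := sq _ _ b2.
move: ('D_(e1 R) w _) ('D_(e2 R) w _) (x.1 - y.1) (x.2 - y.2) => D1 D2 u v; clear => h2 h1.
have l1 : (D1 * u + D2 * v) ^+ 2 <= 2 * (D1 ^+ 2 * u ^+ 2) + 2 * (D2 ^+ 2 * v ^+ 2).
  by have := sqr_ge0 (D1 * u - D2 * v); nra.
have l2 : D1 ^+ 2 * u ^+ 2 <= M1 ^+ 2 * u ^+ 2 by rewrite ler_wpM2r// sqr_ge0.
have l3 : D2 ^+ 2 * v ^+ 2 <= M2 ^+ 2 * v ^+ 2 by rewrite ler_wpM2r// sqr_ge0.
have l4 : 0 <= M1 ^+ 2 * v ^+ 2 by rewrite mulr_ge0 ?sqr_ge0.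
have l5 : 0 <= M2 ^+ 2 * u ^+ 2 by rewrite mulr_ge0 ?sqr_ge0.
apply: (le_trans l1).
have -> : 2 * (M1 ^+ 2 + M2 ^+ 2) * (u ^+ 2 + v ^+ 2) = 2 * (M1 ^+ 2 * u ^+ 2) +
  2 * (M1 ^+ 2 * v ^+ 2) + 2 * (M2 ^+ 2 * u ^+ 2) + 2 * (M2 ^+ 2 * v ^+ 2) by ring.
lra.
Qed.

Lemma helmholtz_circle k a (u : R * R -> R[i]) r : helmholtz k a u -> 0 <= r < a ->
  sqint (fun t => u (polar r t)) /\
  exists2 L, 0 <= L & chord_lipschitz L (fun t => u (polar r t)).
Proof.
move=> [[[h1 _ _] [h2 _ _]] _] ra.
have [L1 L10 l1] := C1_chord_lipschitz h1 ra.
have [L2 L20 l2] := C1_chord_lipschitz h2 ra.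
have ra' : `|r| < a by case/andP: ra => r0 ra; rewrite ger0_norm.
have [c1 _ _] := C1_continuous_disk h1; have [c2 _ _] := C1_continuous_disk h2.
split; first by apply: sqint_continuous; [exact: (continuous_polar c1)|exact: (continuous_polar c2)].
exists (L1 + L2); first exact: addr_ge0.
by move=> s t; rewrite mulrDl {1}/nsq ReD ImD ReN ImN lerD.
Qed.

Lemma helmholtz_series k a (u : R * R -> R[i]) : 0 < k -> 0 < a -> helmholtz k a u ->
  exists c : int -> R[i],
    (forall m r, 0 <= r < a -> fourier_coef (fun t => u (polar r t)) m = c m * (besselJ m (k * r))%:C) /\
    forall r t, 0 <= r < a ->
      bilateral_sum_to (fun n => c n * (besselJ n (k * r))%:C * expi (n%:~R * t)) (u (polar r t)).
Proof.
move=> k0 a0 hu; have [c hc] := fourier_coef_helmholtz k0 a0 hu; exists c; split => // r t ra.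
have [su [L L0 lip]] := helmholtz_circle hu ra.
have := fourier_inversion t su L0 lip; congr bilateral_sum_to.
by apply/funext => m; rewrite hc.
Qed.

End CircleLipschitz.

(** * Finite sums of modes, zeros of J_m at ka, and ratios of Bessel functions *)

Section HelmholtzTrigPoly.
Variable R : realType.
Implicit Types (k a r t : R) (m : int) (s : seq int) (b : int -> R[i]).

Definition mode k m (x : R * R) : R[i] := wave_re k m x +i* wave_im k m x.

Definition mode_sum k s b (x : R * R) : R[i] := \sum_(m <- s) b m * mode k m x.

Lemma mode_polar k m r t : mode k m (polar r t) = (besselJ m (k * r))%:C * expi (m%:~R * t).
Proof.
have [h1 h2] := wave_polar k m r t.
by apply: complexP; rewrite ?ReM ?ImM /= ?h1 ?h2 mul0r ?subr0 ?addr0.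
Qed.

Lemma mode_sum_polar k s b r t :
  mode_sum k s b (polar r t) = trig_poly s (fun m => b m * (besselJ m (k * r))%:C) t.
Proof.
by apply: eq_bigr => m _; rewrite mode_polar mulrA.
Qed.

Lemma entire_helm_mode_sum k s b : entire_helm k (fun x => complex.Re (mode_sum k s b x)) /\
  entire_helm k (fun x => complex.Im (mode_sum k s b x)).
Proof.
elim: s => [|m s [IH1 IH2]].
  by split; [have := entire_helm0 k|have := entire_helm0 k]; congr entire_helm;
    apply/funext => x; rewrite /mode_sum big_nil.
have [h1 h2] := entire_helm_wave k m.
split.
  have := entire_helm_lcomb 1 1 (entire_helm_lcomb (complex.Re (b m)) (- complex.Im (b m)) h1 h2) IH1.
  congr entire_helm; apply/funext => x; rewrite /lcomb /mode_sum big_cons ReD ReM /=; ring.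
have := entire_helm_lcomb 1 1 (entire_helm_lcomb (complex.Im (b m)) (complex.Re (b m)) h1 h2) IH2.
congr entire_helm; apply/funext => x; rewrite /lcomb /mode_sum big_cons ImD ImM /=; ring.
Qed.

Lemma helmholtz_mode_sum k s b r : helmholtz k r (mode_sum k s b).
Proof.
have [/entire_helmE[c1 l1] /entire_helmE[c2 l2]] := entire_helm_mode_sum k s b.
split; first by split; exact: C2_on_setT.
move=> x _; rewrite /laplacianC l1 l2; apply: complexP; rewrite ?ReD ?ImD ?ReM ?ImM /=; ring.
Qed.

Lemma nrm2_trig_poly s b : uniq s -> nrm2 (trig_poly s b) = 2 * pi * \sum_(m <- s) nsq (b m).
Proof.
move=> us; have h0 : sqint (fun=> 0 : R[i]) by apply: sqint_continuous => t; exact: cvg_cst.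
have c0 m : fourier_coef (fun=> 0 : R[i]) m = 0.
  have E : fourier_coef (fun=> 0 : R[i]) m = fourier_coef (fun=> 0) m * 0.
    by rewrite -fourier_coefZ//; congr (fourier_coef _ m); apply/funext => t; rewrite mulr0.
  by rewrite E mulr0.
have nsq0 : nsq (0 : R[i]) = 0 by rewrite /nsq /= expr0n addr0.
have := nrm2_sub_trig_poly (fun m => - b m) us h0.
have -> : (fun t => 0 - trig_poly s (fun m => - b m) t) = trig_poly s b.
  by apply/funext => t; rewrite sub0r /trig_poly -sumrN; apply: eq_bigr => m _; rewrite mulNr opprK.
move=> ->; rewrite big1; last by move=> m _; rewrite c0.
rewrite mulr0 subr0 (_ : nrm2 _ = 0); last first.
  rewrite /nrm2 -[RHS](mulr0 (2 * pi)) -Rintegral_angles_cst.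
  by apply: eq_Rintegral => t _.
by rewrite add0r; congr (_ * _); apply: eq_bigr => m _; rewrite c0 sub0r opprK.
Qed.

Lemma cvg_sum0 (T : Type) (F : set_system T) (f : int -> T -> R) s : Filter F ->
  (forall m, f m x @[x --> F] --> (0 : R)) -> \sum_(m <- s) f m x @[x --> F] --> (0 : R).
Proof.
move=> FF hf; elim: s => [|m s IH].
  rewrite (_ : (fun x => _) = fun=> 0); first exact: cvg_cst.
  by apply/funext => x; rewrite big_nil.
rewrite (_ : (fun x => _) = (fun x => f m x + \sum_(m <- s) f m x)); last first.
  by apply/funext => x; rewrite big_cons.
have h := cvgD (hf m) IH; rewrite addr0 in h; exact: h.
Qed.

(** On circles such a sum is a trigonometric polynomial with coefficients b_m J_m(kr), so the trace
    property reduces to continuity of each J_m at k rho. *)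
Lemma dirichlet_solution_mode_sum k rho s b : 0 < rho -> uniq s ->
  dirichlet_solution k rho (fun t => mode_sum k s b (polar rho t)) (mode_sum k s b).
Proof.
move=> r0 us.
have E r : (fun t => mode_sum k s b (polar r t)) = trig_poly s (fun m => b m * (besselJ m (k * r))%:C).
  by apply/funext => t; exact: mode_sum_polar.
split; last 2 first.
- exact: helmholtz_mode_sum.
- rewrite /is_trace.
  pose S r := \sum_(m <- s) nsq (b m) * (besselJ m (k * r) - besselJ m (k * rho)) ^+ 2.
  have LE r : L2norm rho (fun t => mode_sum k s b (polar r t) - mode_sum k s b (polar rho t)) =
     (Num.sqrt (rho * (2 * pi * S r)))%:E.
    have -> : (fun t => mode_sum k s b (polar r t) - mode_sum k s b (polar rho t)) =
       trig_poly s (fun m => b m * (besselJ m (k * r) - besselJ m (k * rho))%:C).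
      apply/funext => t; rewrite !mode_sum_polar /trig_poly -sumrB; apply: eq_bigr => m _.
      by rewrite rmorphB /= mulrBr mulrBl.
    rewrite L2normE; last exact: sqint_trig_poly.
    rewrite nrm2_trig_poly//; congr (Num.sqrt (_ * (_ * _)))%:E.
    by apply: eq_bigr => m _; rewrite nsqM; congr (_ * _); rewrite /nsq /= expr0n addr0.
  have cS : S r @[r --> rho^'-] --> (0 : R).
    apply: cvg_sum0 => m; rewrite -(mulr0 (nsq (b m))); apply: cvgM; first exact: cvg_cst.
    have cJ : besselJ m (k * r) - besselJ m (k * rho) @[r --> rho^'-] --> (0 : R).
      rewrite -(subrr (besselJ m (k * rho))); apply: cvgB; last exact: cvg_cst.
      apply: cvg_at_left_filter.
      apply: (@continuous_comp _ _ _ (fun r : R => k * r) (besselJ m)); last exact: continuous_besselJ.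
      by apply: cvgM; [exact: cvg_cst|exact: cvg_id].
    by rewrite -(mulr0 0); under eq_fun do rewrite expr2; apply: cvgM.
  have cL : Num.sqrt (rho * (2 * pi * S r)) @[r --> rho^'-] --> (0 : R).
    rewrite -(sqrtr0 R); apply: continuous_cvg; first exact: sqrt_continuous.
    rewrite -(mulr0 rho) -(mulr0 (2 * pi)); apply: cvgM; first exact: cvg_cst.
    by apply: cvgM => //; exact: cvg_cst.
  rewrite (_ : (fun r => _) = (fun r => (Num.sqrt (rho * (2 * pi * S r)))%:E)); last first.
    by apply/funext => r; rewrite LE.
  by apply: cvg_EFin; [exact: nearW|exact: cL].
rewrite E; split; first by apply/inL2P => //; exact: sqint_trig_poly.
by rewrite H12norm_trig_poly// ltry.
Qed.

Lemma besselJ_abs m (x : R) : `|besselJ m x| = `|besselJ_nat `|m|%N x|.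
Proof.
by case: m => n //=; rewrite normrM normrX normrN1 expr1n mul1r.
Qed.

(** If J_m(ka) = 0, the mode of order |m| vanishes on the circle of radius a and is a Dirichlet
    eigenfunction; it is nonzero at points close to the origin. *)
Lemma not_dirichlet_besselJ_neq0 k a m : 0 < k -> 0 < a -> ~ dirichlet_eigenvalue a (k ^+ 2) ->
  besselJ m (k * a) != 0.
Proof.
move=> k0 a0 hnd; rewrite -normr_eq0 besselJ_abs normr_eq0; apply/negP => /eqP J0; apply: hnd.
set n := `|m|%N in J0 *.
(* As ka > 0, the zero belongs to the factor E_n, a function of |x|^2; the mode then vanishes on the
   circle in its Cartesian description. *)
have E0 : besselE n ((k / 2) ^+ 2 * a ^+ 2) = 0 :> R.
  move/eqP: J0; rewrite besselJ_natE mulf_eq0 expf_eq0 => /orP[/andP[_]|/eqP].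
    by rewrite mulf_eq0 mulf_eq0 gt_eqF//= gt_eqF//= invr_eq0 pnatr_eq0.
  by rewrite mulrAC exprMn.
have ME : mode_sum k [:: n%:Z] (fun=> 1) = mode k n.
  by apply/funext => x; rewrite /mode_sum big_seq1 mul1r.
have [[hC1 hC2] hL] := helmholtz_mode_sum k [:: n%:Z] (fun=> 1) a.
rewrite ME in hC1 hC2 hL.
have [c1 c2] := continuous_wave k n.
exists (mode k n); split.
- by split.
- by split; apply: continuous_subspaceT; [exact: c1|exact: c2].
- move=> x; rewrite /circle /= => xa.
  by rewrite /mode /wave_re /wave_im /wave_nat /= xa E0 !mulr0.
- by move=> x /hL /eqP; rewrite addr_eq0 => /eqP ->; rewrite opprK.
have [d d0 hd] := @besselJ_nat_small R n.
pose r := Num.min a (d / k) / 2.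
have m0 : 0 < Num.min a (d / k) by rewrite lt_min a0 divr_gt0.
have r0 : 0 < r by rewrite divr_gt0.
have rm : r < Num.min a (d / k) by rewrite ltr_pdivrMr// ltr_pMr// ltr1n.
move: rm; rewrite lt_min => /andP[ra rd].
exists (polar r 0); first by apply: polar_disk; rewrite gtr0_norm.
rewrite mode_polar /= mulr0 /expi cos0 sin0 mulr1 => /(congr1 (@complex.Re R)) /= e.
have : 0 < besselJ_nat n (k * r) by apply: hd; rewrite mulr_gt0//= mulrC -ltr_pdivlMr.
by rewrite e ltxx.
Qed.

(** For large n both values are within a factor 2 of their leading terms, whose quotient is (y /
    x)^n; hence the 4. The order of x and y is free: y > x is used to bound v on the circle of
    radius rho, and y < x to bound discarded modes in (ii). *)
Lemma besselJ_nat_ratio (x y : R) : 0 < x -> 0 < y -> exists n0, forall n, (n0 <= n)%N ->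
  `|besselJ_nat n y| <= 4 * (y / x) ^+ n * `|besselJ_nat n x|.
Proof.
move=> x0 y0.
pose M := 2 * expR ((x / 2) ^+ 2) + 2 * expR ((y / 2) ^+ 2).
have M0 : 0 <= M by rewrite addr_ge0// mulr_ge0// expR_ge0.
exists (Num.bound M) => n hn.
have hM : M <= n.+1%:R.
  apply: (le_trans (ltW (archi_boundP M0))).
  by rewrite ler_nat leqW.
have hx : 2 * expR ((x / 2) ^+ 2) <= n.+1%:R by apply: le_trans hM; rewrite lerDl mulr_ge0// expR_ge0.
have hy : 2 * expR ((y / 2) ^+ 2) <= n.+1%:R by apply: le_trans hM; rewrite lerDr mulr_ge0// expR_ge0.
have /andP[x1 _] := besselJ_nat_asymp (ltW x0) hx.
have /andP[y1 y2] := besselJ_nat_asymp (ltW y0) hy.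
have A0 : 0 <= (x / 2) ^+ n / n`!%:R by rewrite divr_ge0 ?exprn_ge0 ?divr_ge0// ltW.
have BA : (y / 2) ^+ n / n`!%:R = (y / x) ^+ n * ((x / 2) ^+ n / n`!%:R).
  rewrite mulrA -exprMn; congr (_ ^+ n / _); field; rewrite gt_eqF//.
rewrite BA in y1 y2.
have q0 : 0 <= (y / x) ^+ n by rewrite exprn_ge0 ?divr_ge0// ltW.
have y0' : 0 <= besselJ_nat n y by apply: le_trans y1; rewrite divr_ge0// mulr_ge0.
have x0' : 0 <= besselJ_nat n x by apply: le_trans x1; rewrite divr_ge0.
rewrite !ger0_norm//; apply: (le_trans y2).
have -> : 4 * (y / x) ^+ n * besselJ_nat n x = (y / x) ^+ n * (2 * besselJ_nat n x) * 2 by ring.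
by rewrite ler_pM2r// ler_wpM2l//; lra.
Qed.

Lemma besselJ_ratio (x y : R) : 0 < x -> x <= y -> (forall m, besselJ m x != 0) ->
  exists2 C, 0 < C & forall m, `|besselJ m y| <= C * (y / x) ^+ `|m|%N * `|besselJ m x|.
Proof.
move=> x0 xy nz.
have y0 : 0 < y by apply: lt_le_trans xy.
have [n0 hn0] := besselJ_nat_ratio x0 y0.
have q1 : 1 <= y / x by rewrite ler_pdivlMr// mul1r.
(* The sum covers the finitely many orders below n0, where nonvanishing of the denominators and (y /
   x)^n >= 1 suffice. *)
pose C := 4 + \sum_(n < n0) `|besselJ_nat n y| / `|besselJ_nat n x|.
have S0 : 0 <= \sum_(n < n0) `|besselJ_nat n y| / `|besselJ_nat n x|.
  by apply: sumr_ge0 => n _; rewrite divr_ge0.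
exists C; first by rewrite ltr_wpDr.
move=> m; rewrite !besselJ_abs; set n := `|m|%N.
have nz' : 0 < `|besselJ_nat n x| by rewrite /n -besselJ_abs normr_gt0.
have qn : 1 <= (y / x) ^+ n by rewrite exprn_ege1.
have [hn|hn] := leqP n0 n.
  apply: (le_trans (hn0 n hn)).
  by rewrite -!mulrA ler_wpM2r ?mulr_ge0// ?lerDl// (le_trans ler01).
have h1 : `|besselJ_nat n y| / `|besselJ_nat n x| <= C.
  rewrite /C (bigD1 (Ordinal hn))//= addrCA lerDl addr_ge0// sumr_ge0// => i _.
rewrite ler_pdivrMr// in h1; apply: (le_trans h1).
rewrite ler_wpM2r// ler_peMr//.
by rewrite addr_ge0.
Qed.

End HelmholtzTrigPoly.

(** * Fourier series of traces, and the error and size of a cut-off sum *)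

Section Traces.
Variable R : realType.
Implicit Types (f g : R -> R[i]) (k a r rho t : R) (m : int).

Lemma trace_nrm2 k a f (u : R * R -> R[i]) (e : R) : 0 < a -> helmholtz k a u -> sqint f ->
  is_trace a u f -> 0 < e -> \forall s \near a^'-, nrm2 (fun t => f t - u (polar s t)) <= e.
Proof.
move=> a0 hu sf /fine_cvgP[_ tr] e0.
have se : 0 < Num.sqrt (a * e) by rewrite sqrtr_gt0 mulr_gt0.
move/cvgrPdist_le : tr => /(_ _ se) tr; near=> s.
have s0a : 0 <= s < a.
  by apply/andP; split; near: s; [exact: nbhs_left_ge|exact: nbhs_left_lt].
have [su _] := helmholtz_circle hu s0a.
have : `|0 - fine (L2norm a (fun t => u (polar s t) - f t))| <= Num.sqrt (a * e) by near: s.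
rewrite L2normE; last by apply: sqintD => //; exact: sqintN.
rewrite sub0r normrN /= ger0_norm ?sqrtr_ge0// ler_sqrt; last by rewrite mulr_ge0// ltW.
rewrite ler_pM2l//; apply: le_trans; rewrite le_eqVlt; apply/orP; left; apply/eqP.
by apply: eq_Rintegral => t _; rewrite -nsqN opprB.
Unshelve. all: by end_near.
Qed.

(** Bessel's inequality for a single mode makes Fourier coefficients continuous in L^2, so the
    formula passes from radius s to a together with J_m(ks). *)
Lemma trace_fourier_coef k a f (u : R * R -> R[i]) (c : int -> R[i]) m : 0 < a ->
  helmholtz k a u -> sqint f -> is_trace a u f ->
  (forall r, 0 <= r < a -> fourier_coef (fun t => u (polar r t)) m = c m * (besselJ m (k * r))%:C) ->
  fourier_coef f m = c m * (besselJ m (k * a))%:C.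
Proof.
move=> a0 hu sf tr hc; apply/eqP; rewrite -subr_eq0; apply/eqP/nsq_eq0/eqP.
rewrite eq_le nsq_ge0 andbT; apply/ler_addgt0Pr => e e0; rewrite add0r.
have cJ : nsq (c m) * (besselJ m (k * s) - besselJ m (k * a)) ^+ 2 @[s --> a^'-] --> (0 : R).
  have h : besselJ m (k * s) - besselJ m (k * a) @[s --> a^'-] --> (0 : R).
    rewrite -(subrr (besselJ m (k * a))); apply: cvgB; last exact: cvg_cst.
    apply: cvg_at_left_filter.
    apply: (@continuous_comp _ _ _ (fun r : R => k * r) (besselJ m)); last exact: continuous_besselJ.
    by apply: cvgM; [exact: cvg_cst|exact: cvg_id].
  rewrite (_ : (fun s => _) = (fun s => nsq (c m) * ((besselJ m (k * s) - besselJ m (k * a)) *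
     (besselJ m (k * s) - besselJ m (k * a))))); last by apply/funext => s; rewrite expr2.
  have := cvgM (cvg_cst (nsq (c m))) (cvgM h h); rewrite mulr0 mulr0; exact.
(* The two errors, at most e / 4 each, are doubled by [nsqD_le]. *)
have e4 : 0 < e / 4 by rewrite divr_gt0.
have pe : 0 < 2 * pi * (e / 4) by rewrite mulr_gt0// pi2_gt0.
have tr' := trace_nrm2 a0 hu sf tr pe.
move/cvgrPdist_le : cJ => /(_ _ e4) cJ.
near a^'- => s.
have s0a : 0 <= s < a.
  by apply/andP; split; near: s; [exact: nbhs_left_ge|exact: nbhs_left_lt].
have [su _] := helmholtz_circle hu s0a.
have h1 : nrm2 (fun t => f t - u (polar s t)) <= 2 * pi * (e / 4) by near: s.
have h2 : `|0 - nsq (c m) * (besselJ m (k * s) - besselJ m (k * a)) ^+ 2| <= e / 4 by near: s.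
have sd : sqint (fun t => f t - u (polar s t)) by apply: sqintD => //; exact: sqintN.
have := bessel_inequality (s := [:: m]) isT sd; rewrite big_seq1 fourier_coefB// hc// => h3.
have h4 : nsq (fourier_coef f m - c m * (besselJ m (k * s))%:C) <= e / 4.
  by rewrite -(ler_pM2l (pi2_gt0 R)) (le_trans h3).
have -> : fourier_coef f m - c m * (besselJ m (k * a))%:C =
  (fourier_coef f m - c m * (besselJ m (k * s))%:C) +
  c m * (besselJ m (k * s) - besselJ m (k * a))%:C by rewrite rmorphB /= mulrBr subrKA.
apply: (le_trans (nsqD_le _ _)).
have -> : nsq (c m * (besselJ m (k * s) - besselJ m (k * a))%:C) =
  nsq (c m) * (besselJ m (k * s) - besselJ m (k * a)) ^+ 2.
  by rewrite nsqM; congr (_ * _); rewrite /nsq /= expr0n addr0.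
rewrite sub0r normrN in h2; have h5 := le_trans (ler_norm _) h2.
by move: h4 h5; move: (nsq (_ - _)) (nsq _ * _) => x y; clear; lra.
Unshelve. all: by end_near.
Qed.

(** The restrictions of u to circles of radius s < a are chord-Lipschitz and converge to f in L^2,
    so f lies in the required closure. *)
Lemma trace_partial_sum_cvg0 k a f (u : R * R -> R[i]) : 0 < a -> helmholtz k a u -> sqint f ->
  is_trace a u f ->
  nrm2 (fun t => f t - trig_poly (sym_range N.+1) (fourier_coef f) t) @[N --> \oo] --> (0 : R).
Proof.
move=> a0 hu sf tr; apply: nrm2_partial_sum_cvg0_closure => // e e0.
have tr' := trace_nrm2 a0 hu sf tr e0.
near a^'- => s.
have s0a : 0 <= s < a.
  by apply/andP; split; near: s; [exact: nbhs_left_ge|exact: nbhs_left_lt].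
have [su [L L0 lip]] := helmholtz_circle hu s0a.
by exists L, (fun t => u (polar s t)); split => //; near: s.
Unshelve. all: by end_near.
Qed.

Lemma mem_sym_range N m : m \notin sym_range N -> (N <= `|m|)%N.
Proof.
rewrite mem_cat negb_or => /andP[h1 h2]; case: m h1 h2 => i h1 h2.
  by rewrite leqNgt; apply: contra h1 => h; rewrite map_f// mem_iota.
by rewrite leqNgt; apply: contra h2 => h; rewrite map_f// mem_iota/= (ltn_trans _ h).
Qed.

Lemma big_sym_range_widen (F : int -> R[i]) N M : (N <= M)%N -> (forall m, m \notin sym_range N -> F m = 0) ->
  \sum_(m <- sym_range N) F m = \sum_(m <- sym_range M) F m.
Proof.
move=> NM F0.
have key (p : nat -> int) : (forall i, (N <= i)%N -> p i \notin sym_range N) ->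
    series (fun i => F (p i)) M = series (fun i => F (p i)) N.
  move=> hp; rewrite /series /= (big_cat_nat (leq0n N) NM) /=.
  rewrite [X in _ + X]big1_seq ?addr0// => i /andP[_]; rewrite mem_index_iota => /andP[Ni _].
  by rewrite F0// hp.
have nPos i : (N <= i)%N -> Posz i \notin sym_range N.
  move=> Ni; rewrite mem_cat; apply/negP => /orP[] /mapP[j]; rewrite mem_iota /= => jN [] // ij.
  by rewrite -ij ltnNge Ni in jN.
have nNeg i : (N <= i)%N -> Negz i \notin sym_range N.
  move=> Ni; rewrite mem_cat; apply/negP => /orP[] /mapP[j]; rewrite mem_iota /= => jN [] // ij.
  by rewrite -ij ltnNge Ni in jN.
by rewrite !big_sym_range (key Posz)// (key Negz).
Qed.

(** The finite sum is read over a larger range, where the squared error splits into the Fourier tail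
    of f, which tends to 0, and a diagonal sum bounded by B^2. *)
Lemma approx_error a f (b : int -> R[i]) N (B : R) : 0 < a -> sqint f ->
  nrm2 (fun t => f t - trig_poly (sym_range N.+1) (fourier_coef f) t) @[N --> \oo] --> (0 : R) ->
  (forall m, m \notin sym_range N -> b m = 0) -> 0 <= B ->
  (forall M, 2 * pi * a * (\sum_(m <- sym_range M) nsq (fourier_coef f m - b m)) <= B ^+ 2) ->
  (L2norm a (fun t => f t - trig_poly (sym_range N) b t)%R <= B%:E)%E.
Proof.
move=> a0 sf /cvg0_le cf b0 B0 hB.
have sN := sqintN (sqint_trig_poly (sym_range N) b).
rewrite L2normE; last exact: sqintD.
rewrite lee_fin -[leRHS]ger0_norm// -sqrtr_sqr ler_sqrt ?sqr_ge0//.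
apply/ler_addgt0Pr => e e0.
have ea : 0 < e / a by rewrite divr_gt0.
have {}cf := cf (fun N => nrm2_ge0 _) _ ea.
near \oo => M.
have NM : (N <= M.+1)%N by apply: leqW; near: M; exact: nbhs_infty_ge.
have hM : nrm2 (fun t => f t - trig_poly (sym_range M.+1) (fourier_coef f) t) <= e / a by near: M.
have -> : (fun t => f t - trig_poly (sym_range N) b t) = (fun t => f t - trig_poly (sym_range M.+1) b t).
  apply/funext => t; congr (_ - _); apply: big_sym_range_widen => // m /b0 ->.
  by rewrite mul0r.
have us := sym_range_uniq M.+1.
have E1 := nrm2_sub_trig_poly b us sf; have E2 := nrm2_sub_trig_poly (fourier_coef f) us sf.
rewrite [X in _ + _ * X]big1_seq in E2; last by move=> m _; rewrite subrr /nsq /= expr0n addr0.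
rewrite mulr0 addr0 in E2; rewrite E1 -E2 mulrDr addrC lerD//.
  by rewrite mulrA [a * _]mulrC; exact: hB.
by rewrite -(mulVKf (lt0r_neq0 a0) e) ler_pM2l// mulrC.
Unshelve. all: by end_near.
Qed.

(** The factor sqrt(rho / a) compares the arc lengths built into the norms on the two circles; the
    rest is Bessel's inequality. *)
Lemma approx_size a rho f (b : int -> R[i]) s (Q : R) : 0 < a -> 0 < rho -> sqint f -> uniq s -> 0 <= Q ->
  (forall m, sobolev_weight R m * nsq (b m) <= Q ^+ 2 * nsq (fourier_coef f m)) ->
  (H12norm rho (trig_poly s b) <= (Num.sqrt (rho / a) * Q)%:E * L2norm a f)%E.
Proof.
move=> a0 r0 sf us Q0 hb.
rewrite H12norm_trig_poly// L2normE// -EFinM lee_fin.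
have -> : Num.sqrt (rho / a) * Q * Num.sqrt (a * nrm2 f) = Num.sqrt (rho * (Q ^+ 2 * nrm2 f)).
  rewrite -{1}[Q]ger0_norm// -sqrtr_sqr -!sqrtrM ?divr_ge0 ?(ltW r0) ?(ltW a0)//; last first.
    by rewrite mulr_ge0 ?sqr_ge0// divr_ge0 ?ltW.
  by congr Num.sqrt; field; rewrite gt_eqF.
rewrite ler_sqrt; last by rewrite !mulr_ge0 ?sqr_ge0 ?nrm2_ge0// ltW.
rewrite [2 * pi * rho]mulrC -mulrA ler_pM2l//.
apply: le_trans (ler_wpM2l (sqr_ge0 Q) (bessel_inequality us sf)).
rewrite mulrCA ler_pM2l ?pi2_gt0// mulr_sumr; exact: ler_sum.
Qed.

(** Common core of (i) and (ii). The multiplier enters through two estimates only: 1 - l controls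
    the error on the circle of radius a, and s_m l_m J_m(k rho) / J_m(ka) the size on the circle of
    radius rho. *)
Lemma mode_approximation k a rho f (u : R * R -> R[i]) (c : int -> R[i]) (l : int -> R) N (B Q : R) :
  0 < a -> 0 < rho -> helmholtz k a u -> sqint f -> is_trace a u f ->
  (forall m, fourier_coef f m = c m * (besselJ m (k * a))%:C) ->
  (forall m, m \notin sym_range N -> l m = 0) -> 0 <= B -> 0 <= Q ->
  (forall M, 2 * pi * a * (\sum_(m <- sym_range M) (1 - l m) ^+ 2 * nsq (fourier_coef f m)) <= B ^+ 2) ->
  (forall m, Num.sqrt (sobolev_weight R m) * `|l m| * `|besselJ m (k * rho)| <= Q * `|besselJ m (k * a)|) ->
  exists (v : R * R -> R[i]) (h : R -> R[i]),
    [/\ dirichlet_solution k rho h v,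
        (L2norm a (fun t => f t - v (polar a t))%R <= B%:E)%E &
        (H12norm rho h <= (Num.sqrt (rho / a) * Q)%:E * L2norm a f)%E].
Proof.
move=> a0 r0 hu sf tr hc l0 B0 Q0 hB hQ.
pose s := sym_range N; have us : uniq s := sym_range_uniq N.
pose v := mode_sum k s (fun m => (l m)%:C * c m).
have nsqR (x : R) : nsq (x%:C) = x ^+ 2 by rewrite /nsq /= expr0n addr0.
exists v, (fun t => v (polar rho t)); split; first exact: dirichlet_solution_mode_sum.
- have -> : (fun t => f t - v (polar a t)) =
     (fun t => f t - trig_poly (sym_range N) (fun m => (l m)%:C * fourier_coef f m) t).
    apply/funext => t; congr (_ - _); rewrite /v mode_sum_polar.
    by apply: eq_bigr => m _; rewrite hc mulrA.
  apply: approx_error => //; first exact: (trace_partial_sum_cvg0 a0 hu sf tr).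
    by move=> m /l0 ->; rewrite mul0r.
  move=> M; apply: le_trans (hB M); rewrite le_eqVlt; apply/orP; left; apply/eqP.
  congr (_ * _); apply: eq_bigr => m _.
  have -> : fourier_coef f m - (l m)%:C * fourier_coef f m = (1 - l m)%:C * fourier_coef f m.
    by rewrite rmorphB /= mulrBl mul1r.
  by rewrite nsqM nsqR.
- have -> : (fun t => v (polar rho t)) = trig_poly s (fun m => (l m)%:C * c m * (besselJ m (k * rho))%:C).
    by apply/funext => t; rewrite /v mode_sum_polar.
  apply: approx_size => // m; rewrite hc !nsqM !nsqR.
  have := hQ m; rewrite -ler_sqr ?nnegrE ?mulr_ge0 ?sqrtr_ge0// !exprMn.
  rewrite sqr_sqrtr ?sobolev_weight_ge0// !real_normK ?num_real// => h.
  have := ler_wpM2l (nsq_ge0 (c m)) h.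
  by congr (_ <= _); ring.
Qed.

End Traces.

(** * Estimates for the two cut-offs *)

Section CutOffs.
Variable R : realType.
Implicit Types (m : int) (n : nat) (x y : R).

Lemma sobolev_weight_ge1 m : 1 <= sobolev_weight R m.
Proof.
have s0 : 0 <= m%:~R ^+ 2 :> R by exact: sqr_ge0.
by rewrite /sobolev_weight -[leLHS]sqrtr1 ler_sqrt ?lerDl// addr_ge0.
Qed.

Lemma absz_sqr m : (`|m|%N%:R) ^+ 2 = m%:~R ^+ 2 :> R.
Proof.
by case: m => n //; rewrite NegzE mulrNz sqrrN.
Qed.

Lemma sobolev_weight_ge m : `|m|%N%:R <= sobolev_weight R m.
Proof.
rewrite -[leLHS]ger0_norm// -sqrtr_sqr ler_sqrt; last by rewrite addr_ge0 ?sqr_ge0.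
by rewrite absz_sqr lerDr.
Qed.

Lemma sqrt_sobolev_weight_ge1 m : 1 <= Num.sqrt (sobolev_weight R m).
Proof.
rewrite -[leLHS]sqrtr1 ler_sqrt ?sobolev_weight_ge0//; exact: sobolev_weight_ge1.
Qed.

Lemma sqrt_sobolev_weight_le m : Num.sqrt (sobolev_weight R m) <= 1 + `|m|%N%:R.
Proof.
have n0 : 0 <= `|m|%N%:R :> R by [].
have h : sobolev_weight R m <= (1 + `|m|%N%:R) ^+ 2.
  rewrite -[leRHS]ger0_norm ?sqr_ge0// -sqrtr_sqr ler_sqrt ?sqr_ge0// -absz_sqr.
  move: n0; move: (`|m|%N%:R) => x x0; have x2 := sqr_ge0 x; have x3 : 0 <= x ^+ 3 by rewrite exprn_ge0.
  have x4 : 0 <= x ^+ 4 by rewrite exprn_ge0.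
  have -> : (1 + x) ^+ 2 ^+ 2 = 1 + 4 * x + 6 * x ^+ 2 + 4 * x ^+ 3 + x ^+ 4 by ring.
  by move: x2 x3 x4; clear -x0; move: (x ^+ 2) (x ^+ 3) (x ^+ 4) => p q r; lra.
rewrite -[leRHS]ger0_norm ?addr_ge0// -sqrtr_sqr ler_sqrt// sqr_ge0//.
Qed.

Lemma expr_expR x n : 0 < x -> x ^+ n = expR (ln x * n%:R).
Proof.
by move=> x0; rewrite expRM_natr lnK.
Qed.

(* With T = 1/e and n <= s^2, the exponent L s^2 falls short of L T^2 by at least L (T - s),
   which absorbs the factor s (1 - e s) <= T - s. *)
Lemma cutoff_bound (L e s : R) n : 0 < L -> 0 < e < 1 -> 1 <= s -> n%:R <= s ^+ 2 ->
  s * `|Num.max 0 (1 - e * s)| * expR (L * n%:R) <= L^-1 * expR (L * e ^- 2).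
Proof.
move=> L0 /andP[e0 e1] s1 ns.
have s0 : 0 < s by apply: lt_le_trans s1.
have R0 : 0 <= L^-1 * expR (L * e ^- 2) by rewrite mulr_ge0 ?expR_ge0// invr_ge0 ltW.
have [h|h] := leP (1 - e * s) 0; first by rewrite normr0 mulr0 mul0r.
pose T := e^-1; have T1 : 1 < T by rewrite invf_gt1.
have eT : e * T = 1 by rewrite divff// gt_eqF.
have sT : s < T by rewrite -(ltr_pM2l e0) eT -subr_gt0.
rewrite gtr0_norm//.
have h1 : s * (1 - e * s) <= T - s.
  have -> : 1 - e * s = e * (T - s) by rewrite mulrBr eT.
  rewrite mulrA ler_piMl ?subr_ge0 ?(ltW sT)//.
  by rewrite mulrC -eT ler_wpM2l// ltW.
have h2 : expR (L * n%:R) <= expR (L * e ^- 2 - L * (T - s)).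
  rewrite ler_expR -mulrBr ler_pM2l//; apply: (le_trans ns).
  have -> : e ^- 2 = T ^+ 2 by rewrite exprVn.
  have : 0 <= (T - s) * (T + s - 1) by rewrite mulr_ge0 ?subr_ge0 ?(ltW sT)// ; lra.
  have gen (x y : R) : 0 <= (x - y) * (x + y - 1) -> y ^+ 2 <= x ^+ 2 - (x - y).
    by rewrite -subr_ge0 => xy; rewrite -subr_ge0; move: xy; congr (_ <= _); ring.
  exact: gen.
apply: (@le_trans _ _ ((T - s) * expR (L * e ^- 2 - L * (T - s)))).
  by apply: ler_pM => //; rewrite mulr_ge0 ?ltW.
rewrite expRD expRN -(ler_pM2l L0) [leRHS]mulrA divff ?gt_eqF// mul1r.
rewrite mulrA mulrCA ger_pMr ?expR_gt0// ler_pdivrMr ?expR_gt0// mul1r.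
(* The exponential gained from the slack dominates the linear factor: x <= exp(x) at x = L (T -
   s). *)
by have := expR_ge1Dx (L * (T - s)); lra.
Qed.

(** With tau = ln p / ln q >= 1 one has p^n = (q^n)^tau and s <= s^tau, so the left side is at most
    (q^n s)^tau. *)
Lemma cutoff_powR (p q e s : R) n : 1 < q -> q <= p -> 0 < e -> 1 <= s -> q ^+ n * s <= 4 / e ->
  s * p ^+ n <= 4 `^ (ln p / ln q) * e `^ (- (ln p / ln q)).
Proof.
move=> q1 qp e0 s1 h; set tau := ln p / ln q.
have p1 := lt_le_trans q1 qp.
have q0 : 0 < q by exact: lt_trans q1.
have p0 : 0 < p by exact: lt_trans p1.
have s0 : 0 < s by exact: lt_le_trans s1.
have Lq : 0 < ln q by exact: ln_gt0.
have tau1 : 1 <= tau by rewrite ler_pdivlMr// mul1r ler_ln.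
have pq : p ^+ n = (q ^+ n) `^ tau.
  rewrite /powR gt_eqF ?exprn_gt0// lnXn// -mulr_natl expr_expR//; congr expR.
  by rewrite /tau; field; rewrite gt_eqF.
have es : s <= s `^ tau by rewrite -[leLHS]powRr1 ?(ltW s0)// ler_powR.
have qn0 : 0 <= q ^+ n by rewrite exprn_ge0// ltW.
have -> : 4 `^ tau * e `^ (- tau) = (4 / e) `^ tau.
  rewrite powRM ?invr_ge0 ?(ltW e0)//; congr (_ * _).
  by rewrite -powR_inv1 ?(ltW e0)// -powRrM mulN1r.
apply: (@le_trans _ _ ((q ^+ n * s) `^ tau)).
  by rewrite powRM ?(ltW s0)// -pq mulrC ler_wpM2l// exprn_ge0// ltW.
apply: ge0_ler_powR h; first exact: le_trans tau1.
  by rewrite nnegrE mulr_ge0// ltW.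
by rewrite nnegrE divr_ge0// ltW.
Qed.

(** Since s_m^2 >= |m|, the taper is zero as soon as |m| >= e^-2. *)
Lemma cutoff_vanishes (e : R) : 0 < e -> exists N : nat, forall m, m \notin sym_range N ->
  Num.max 0 (1 - e * Num.sqrt (sobolev_weight R m)) = 0.
Proof.
move=> e0; have e2 : 0 <= e ^- 2 by rewrite invr_ge0 sqr_ge0.
exists (Num.bound (e ^- 2)) => m /mem_sym_range hm.
apply/max_idPl; rewrite subr_le0 -ler_pdivrMl// mulr1.
rewrite -[leLHS]ger0_norm ?invr_ge0 ?(ltW e0)// -sqrtr_sqr exprVn.
rewrite ler_sqrt ?sobolev_weight_ge0//; apply: le_trans (sobolev_weight_ge m).
by apply: (le_trans (ltW (archi_boundP e2))); rewrite ler_nat.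
Qed.

End CutOffs.

Theorem proposition3p2 (R : realType) (k a : R) (hk : 0 < k) (ha : 0 < a)
    (hnd : ~ dirichlet_eigenvalue a (k ^+ 2)) :
  [/\ (forall (f : R -> R[i]) (u : R * R -> R[i]),
         dirichlet_solution k a f u ->
         exists c : int -> R[i],
           forall r t : R, 0 <= r < a ->
             bilateral_sum_to
               (fun n => c n * (besselJ n (k * r))%:C * expi (n%:~R * t))
               (u (polar r t))),
      (forall rho : R, a < rho ->
         exists C : R, 0 < C /\
           forall (f : R -> R[i]) (u : R * R -> R[i]),
             dirichlet_solution k a f u ->
             forall eps : R, 0 < eps < 1 ->
               exists (v : R * R -> R[i]) (h : R -> R[i]),
                 [/\ dirichlet_solution k rho h v,
                     (L2norm a (fun t => f t - v (polar a t))%R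
                        <= eps%:E * H12norm a f)%E
                   & (H12norm rho h
                        <= (C * expR (ln (rho / a) * eps ^- 2))%:E
                           * L2norm a f)%E])
    & (forall sigma rho : R, a < sigma -> sigma < rho ->
         exists C : R, 0 < C /\
           forall (f : R -> R[i]) (u : R * R -> R[i]),
             dirichlet_solution k a f u ->
             forall (g : R -> R[i]) (w : R * R -> R[i]),
               dirichlet_solution k sigma g w ->
               (forall x, disk a x -> w x = u x) ->
               forall eps : R, 0 < eps < 1 ->
                 exists (v : R * R -> R[i]) (h : R -> R[i]),
                   [/\ dirichlet_solution k rho h v,
                       (L2norm a (fun t => f t - v (polar a t))%R
                          <= eps%:E * H12norm sigma g)%E
                     & (H12norm rho h
                          <= (C * eps `^ (- (ln (rho / a) / ln (sigma / a))))%:E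
                             * L2norm a f)%E])].
Proof.
have Jnz m : besselJ m (k * a) != 0 by exact: not_dirichlet_besselJ_neq0.
have ka0 : 0 < k * a by rewrite mulr_gt0.
have ratio_k (x y : R) : (k * x) / (k * y) = x / y by rewrite -mulf_div divff ?gt_eqF// mul1r.
have H12fin (r : R) f : inH12 r f -> exists2 H : R, 0 <= H & H12norm r f = H%:E.
  move=> [_ hf]; have h0 : (0 <= H12norm r f)%E by exact: sqrte_ge0.
  have hfin : H12norm r f \is a fin_num by rewrite ge0_fin_numE.
  by exists (fine (H12norm r f)); [exact: fine_ge0|rewrite fineK].
split.
- move=> f u [_ hu _]; have [c [_ hc]] := helmholtz_series hk ha hu.
  by exists c.
- move=> rho arho.
  have rho0 : 0 < rho by exact: lt_trans arho.
  have q1 : 1 < rho / a by rewrite ltr_pdivlMr// mul1r.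
  have L0 : 0 < ln (rho / a) by exact: ln_gt0.
  have [|C0 C00 hC] := @besselJ_ratio R (k * a) (k * rho) ka0 _ Jnz; first by rewrite ler_pM2l// ltW.
  have sq0 : 0 < Num.sqrt (rho / a) by rewrite sqrtr_gt0 divr_gt0.
  (* The factors come from the two arc lengths, from the ratios of Bessel functions and from
     [cutoff_bound]. *)
  exists (Num.sqrt (rho / a) * (C0 / ln (rho / a))); split.
    by rewrite mulr_gt0// divr_gt0.
  move=> f u [[/(inL2P _ ha) sf fH] hu tr] eps heps; have [e0 e1] := andP heps.
  have [c [hc _]] := helmholtz_series hk ha hu.
  have fc m : fourier_coef f m = c m * (besselJ m (k * a))%:C.
    by apply: (trace_fourier_coef ha hu sf tr) => r; exact: hc.
  have [H H0 HE] : exists2 H : R, 0 <= H & H12norm a f = H%:E.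
    by apply: H12fin; split => //; apply/inL2P.
  have [N hN] := @cutoff_vanishes R eps e0.
  have Q0 : 0 <= C0 / ln (rho / a) * expR (ln (rho / a) * eps ^- 2).
    by rewrite mulr_ge0 ?expR_ge0// divr_ge0// ltW.
  have [|||v [h [dv E1 E2]]] := @mode_approximation R k a rho f u c
    (fun m => Num.max 0 (1 - eps * Num.sqrt (sobolev_weight R m))) N (eps * H) _ ha rho0 hu sf tr fc hN _ Q0.
  + by rewrite mulr_ge0// ltW.
  + move=> M; rewrite exprMn; have le : (H12norm a f <= H%:E)%E by rewrite HE.
    apply: le_trans (ler_wpM2l (sqr_ge0 eps) (H12norm_ge ha (sym_range_uniq M) le H0)).
    rewrite mulrCA ler_pM2l ?mulr_gt0 ?pi_gt0// mulr_sumr; apply: ler_sum => m _.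
    rewrite mulrA ler_wpM2r ?nsq_ge0//.
    have w0 := sobolev_weight_ge0 R m.
    have -> : eps ^+ 2 * sobolev_weight R m = (eps * Num.sqrt (sobolev_weight R m)) ^+ 2.
      by rewrite exprMn sqr_sqrtr.
    have p0 : 0 <= eps * Num.sqrt (sobolev_weight R m) by rewrite mulr_ge0 ?sqrtr_ge0// ltW.
    move: p0; move: (eps * _) => p p0.
    (* With p = eps s_m, the multiplier is at most 1 and at least 1 - p, so 0 <= 1 - l_m <= p. *)
    rewrite ler_sqr ?nnegrE//; last by rewrite subr_ge0 ge_max ler01 gerBl.
    by rewrite lerBlDl -lerBlDr le_max lexx orbT.
  + move=> m; apply: le_trans (ler_wpM2l _ (hC m)) _; first by rewrite mulr_ge0 ?sqrtr_ge0.
    rewrite ratio_k mulrA ler_wpM2r// expr_expR ?(lt_trans ltr01)//.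
    have := @cutoff_bound R _ _ _ `|m|%N L0 heps (sqrt_sobolev_weight_ge1 R m).
    rewrite sqr_sqrtr ?sobolev_weight_ge0// => /(_ (sobolev_weight_ge R m)) /(ler_wpM2l (ltW C00)).
    move=> le; apply: le_trans (_ : _ <= C0 * ((ln (rho / a))^-1 * expR (ln (rho / a) * eps ^- 2))) _.
      by apply: le_trans le; rewrite mulrCA.
    by rewrite mulrA.
  + exists v, h; split => //; first by rewrite HE.
    by rewrite -[_ * (C0 / _) * _]mulrA.
- move=> sigma rho asig sigrho.
  have sig0 : 0 < sigma by exact: lt_trans asig.
  have arho : a < rho by exact: lt_trans sigrho.
  have rho0 : 0 < rho by exact: lt_trans arho.
  pose q := sigma / a; have q1 : 1 < q by rewrite ltr_pdivlMr// mul1r.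
  pose p := rho / a; have p1 : 1 < p by rewrite ltr_pdivlMr// mul1r.
  have q0 : 0 < q by exact: lt_trans q1.
  have p0 : 0 < p by exact: lt_trans p1.
  have Lq : 0 < ln q by exact: ln_gt0.
  have Lp : 0 < ln p by exact: ln_gt0.
  pose tau := ln p / ln q.
  have tau1 : 1 <= tau.
    by rewrite ler_pdivlMr// mul1r ler_ln ?posrE// ler_pM2r ?invr_gt0// ltW.
  have [|C0 C00 hC] := @besselJ_ratio R (k * a) (k * rho) ka0 _ Jnz; first by rewrite ler_pM2l// ltW.
  have ks0 : 0 < k * sigma by rewrite mulr_gt0.
  (* Here J_m(ka) is bounded by J_m(k sigma). The order n0 depends on k, a and sigma only, which
     keeps the final constant independent of u and eps. *)
  have [n0 hn0] := besselJ_nat_ratio ks0 ka0.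
  have sq0 : 0 < Num.sqrt p by rewrite sqrtr_gt0.
  (* M0 bounds s_m p^|m| for the orders below n0, all of which are kept; in K the term 4^tau serves
     the kept orders from n0 on. *)
  pose M0 := (1 + n0%:R) * p ^+ n0; have M00 : 0 <= M0 by rewrite mulr_ge0 ?addr_ge0// exprn_ge0// ltW.
  pose K := M0 + 4 `^ tau; have K0 : 0 < K by rewrite ltr_wpDl// powR_gt0.
  exists (Num.sqrt p * (C0 * K)); split; first by rewrite !mulr_gt0.
  move=> f u [[/(inL2P _ ha) sf fH] hu tr] g w [[/(inL2P _ sig0) sg gH] hw trw] wu eps /andP[e0 e1].
  (* The coefficients are taken from the extension w, so that one sequence c describes the traces at
     both radii a and sigma. *)
  have [c [hc _]] := helmholtz_series hk sig0 hw.
  have fc m : fourier_coef f m = c m * (besselJ m (k * a))%:C.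
    apply: (trace_fourier_coef ha hu sf tr) => r ra.
    rewrite -hc; last by case/andP: ra => r0 ra; rewrite r0 (lt_trans ra).
    congr (fourier_coef _ m); apply/funext => t; rewrite wu//; apply: polar_disk.
    by case/andP: ra => r0 ra; rewrite ger0_norm.
  have gc m : fourier_coef g m = c m * (besselJ m (k * sigma))%:C.
    by apply: (trace_fourier_coef sig0 hw sg trw) => r; exact: hc.
  have [H H0 HE] : exists2 H : R, 0 <= H & H12norm sigma g = H%:E.
    by apply: H12fin; split => //; apply/inL2P.
  pose s m := Num.sqrt (sobolev_weight R m).
  have s1 m : 1 <= s m by exact: sqrt_sobolev_weight_ge1.
  have s0 m : 0 <= s m by exact: sqrtr_ge0.
  (* For |m| >= n0, 4 (a/sigma)^|m| bounds |J_m(ka) / J_m(k sigma)|, hence the threshold 4 / eps. *)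
  pose keep m := (`|m|%N < n0)%N || (q ^+ `|m|%N * s m <= 4 / eps).
  pose l m : R := if keep m then 1 else 0.
  (* Beyond n0 the first test fails; the second fails because q^n >= 1 + n ln q exceeds 4 / eps and
     s_m >= 1. *)
  pose N := (n0 + Num.bound (4 / eps / ln q))%N.
  have hN m : m \notin sym_range N -> l m = 0.
    move=> /mem_sym_range Nm; rewrite /l; suff /negbTE -> : ~~ keep m by [].
    rewrite negb_or -leqNgt -ltNge (leq_trans (leq_addr _ _) Nm) /=.
    apply: (@lt_le_trans _ _ (q ^+ `|m|%N)); last by rewrite ler_peMr// exprn_ge0// ltW.
    rewrite expr_expR//; apply: lt_le_trans (expR_ge1Dx _); rewrite ltr_pwDl// -ler_pdivrMl// mulrC.
    have b0 : 0 <= 4 / eps / ln q by rewrite !divr_ge0// ltW.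
    apply: (le_trans (ltW (archi_boundP b0))).
    by rewrite ler_nat (leq_trans (leq_addl _ _) Nm).
  (* This lets the eps-free bound M0 for the low orders be absorbed into K eps^(-tau). *)
  have epow : 1 <= eps `^ (- tau).
    rewrite /powR gt_eqF// -expR0 ler_expR mulNr oppr_ge0 mulr_ge0_le0 ?(le_trans ler01 tau1)//.
    by rewrite ln_le0// ltW.
  have Q0 : 0 <= C0 * (K * eps `^ (- tau)) by rewrite !mulr_ge0 ?powR_ge0// ltW.
  have [|||v [h [dv E1 E2]]] := @mode_approximation R k a rho f u c l N (eps * H) _ ha rho0 hu sf tr fc hN _ Q0.
  + by rewrite mulr_ge0// ltW.
  + move=> M; rewrite exprMn; have le : (H12norm sigma g <= H%:E)%E by rewrite HE.
    apply: le_trans (ler_wpM2l (sqr_ge0 eps) (H12norm_ge sig0 (sym_range_uniq M) le H0)).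
    (* Enlarging the arc length from a to sigma allows a comparison mode by mode with the norm of
       g. *)
    apply: (@le_trans _ _ (2 * pi * sigma * (\sum_(m <- sym_range M) (1 - l m) ^+ 2 * nsq (fourier_coef f m)))).
      rewrite ler_wpM2r ?sumr_ge0// => [m _|]; first by rewrite mulr_ge0 ?sqr_ge0 ?nsq_ge0.
      by rewrite ler_pM2l ?pi2_gt0// ltW.
    rewrite mulrCA ler_pM2l ?mulr_gt0 ?pi_gt0// mulr_sumr; apply: ler_sum => m _.
    rewrite /l; have [_|] := boolP (keep m).
      rewrite subrr expr0n mul0r mulr_ge0 ?sqr_ge0// mulr_ge0 ?nsq_ge0//.
      exact: sobolev_weight_ge0.
    rewrite negb_or -leqNgt -ltNge => /andP[nm qs].
    rewrite subr0 expr1n mul1r fc gc !nsqM.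
    have nsqR (x : R) : nsq (x%:C) = `|x| ^+ 2 by rewrite /nsq /= expr0n addr0 real_normK ?num_real.
    rewrite !nsqR [leRHS]mulrA [leRHS]mulrCA ler_wpM2l ?nsq_ge0//.
    have w2 : sobolev_weight R m = s m ^+ 2 by rewrite sqr_sqrtr ?sobolev_weight_ge0.
    rewrite w2 -!exprMn ler_sqr ?nnegrE ?mulr_ge0// ?(ltW e0)//.
    (* For a discarded mode |J_m(ka)| <= 4 q^(-|m|) |J_m(k sigma)|, and failing the threshold test
       means 4 q^(-|m|) < eps s_m. *)
    rewrite !besselJ_abs; apply: (le_trans (hn0 _ nm)); rewrite ratio_k ler_wpM2r//.
    have -> : a / sigma = q^-1 by rewrite /q invf_div.
    rewrite exprVn ler_pdivrMr ?exprn_gt0// -mulrA [s m * _]mulrC -ler_pdivrMl//.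
    by rewrite [leLHS]mulrC ltW.
  + move=> m; apply: le_trans (ler_wpM2l _ (hC m)) _; first by rewrite mulr_ge0 ?sqrtr_ge0.
    rewrite ratio_k mulrA ler_wpM2r// mulrCA ler_pM2l// -/p -/(s m) /l.
    have [km|_] := boolP (keep m); last by rewrite normr0 mulr0 mul0r mulr_ge0 ?powR_ge0// ltW.
    rewrite normr1 mulr1; case/orP: km => [nm|qs].
      apply: (@le_trans _ _ K); last by rewrite ler_peMr// ltW.
      apply: (@le_trans _ _ M0); last by rewrite lerDl powR_ge0.
      apply: ler_pM => //; first by rewrite exprn_ge0// ltW.
        apply: (le_trans (sqrt_sobolev_weight_le R m)).
        by rewrite lerD2l ler_nat ltnW.
      by apply: ler_weXn2l; [exact: ltW|exact: ltnW].
    apply: (@le_trans _ _ (4 `^ tau * eps `^ (- tau))).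
      apply: cutoff_powR qs => //.
      by rewrite ler_pM2r ?invr_gt0// ltW.
    by rewrite ler_wpM2r ?powR_ge0// /K lerDr.
  + exists v, h; split => //; first by rewrite HE.
    by rewrite -!mulrA in E2 *.
Qed.
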